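(* Let $D\ge1$ and let $g\in\mathbf{P}_3(\mathbb{R}^D)\cap L^p(\mathbb{R}^D)$, $p\in(1,\infty]$, be such that $$\int_{\mathbb{R}^D}x\,g(x)\,dx=0,\qquad\int_{\mathbb{R}^D}x\otimes x\,g(x)\,dx=\mathrm{Id},\qquad\int_{\mathbb{R}^D}|x|^3g(x)\,dx=:M_3.$$ Define the iterated and renormalized convolution $g_N(x):=N^{D/2}\,g^{( *N)}(\sqrt N\,x)$. Then there exist an integer $N(p)$ and a constant $C_{BE}=C(p,D,M_3(g),\|g\|_{L^p})$ such that $$\forall\,N\ge N(p)\qquad\|g_N-\gamma\|_{L^\infty}\le\frac{C_{BE}}{\sqrt N}.$$
   Context: $\mathbf{P}_3(\mathbb{R}^D)$ is the set of probability measures on $\mathbb{R}^D$ with finite third moment. $g^{( *N)}$ is the $N$-fold convolution of $g$ with itself. $\gamma(x)=(2\pi)^{-D/2}e^{-|x|^2/2}$ is the standard Gaussian density on $\mathbb{R}^D$. *)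

(* Defs.v *)
From HB Require Import structures.
From mathcomp Require Import all_boot all_order all_algebra.
From mathcomp Require Import all_classical all_reals all_analysis.

Set Implicit Arguments.
Unset Strict Implicit.
Unset Printing Implicit Defensive.

Import Order.TTheory GRing.Theory Num.Theory.
Import numFieldNormedType.Exports.

Local Open Scope classical_set_scope.
Local Open Scope ring_scope.

(* The library provides the product sigma-algebra on n.-tuple T but no n-fold
   product of measures; it is built here by iterating the binary product. *)
Section cons_measure.
Context d (T : measurableType d) (R : realType) (n : nat).

Definition tcons (x : T * n.-tuple T) : n.+1.-tuple T :=
  [tuple of x.1 :: x.2].

Lemma measurable_tcons : measurable_fun setT tcons.
Proof. exact: measurable_cons. Qed.

Variables (m1 : {sigma_finite_measure set T -> \bar R})
  (m2 : {sigma_finite_measure set (n.-tuple T) -> \bar R}).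

Definition cons_measure : set (n.+1.-tuple T) -> \bar R :=
  pushforward (m1 \x m2)%E tcons.

Let measurable_preimage_tcons A :
  measurable A -> measurable (tcons @^-1` A).
Proof.
by move=> mA; rewrite -[X in measurable X]setTI; exact: measurable_tcons.
Qed.

Let cons_measure0 : cons_measure set0 = 0%E.
Proof. by rewrite /cons_measure /pushforward preimage_set0 measure0. Qed.

Let cons_measure_ge0 A : (0 <= cons_measure A)%E.
Proof. by rewrite /cons_measure /pushforward; apply: measure_ge0. Qed.

Let cons_measure_sigma_additive : semi_sigma_additive cons_measure.
Proof.
move=> F mF tF mUF; rewrite /cons_measure /pushforward preimage_bigcup.
apply: measure_semi_sigma_additive.
- by move=> k; exact: measurable_preimage_tcons.
- apply/trivIsetP => /= i j _ _ ij; rewrite -preimage_setI.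
  by move/trivIsetP : tF => /(_ _ _ _ _ ij) ->//; rewrite preimage_set0.
- by rewrite -preimage_bigcup; exact: measurable_preimage_tcons.
Qed.

HB.instance Definition _ := isMeasure.Build _ _ _ cons_measure
  cons_measure0 cons_measure_ge0 cons_measure_sigma_additive.

Lemma cons_measureE (A : set T) (B : set (n.-tuple T)) :
  measurable A -> measurable B ->
  cons_measure [set x | A (thead x) /\ B [tuple of behead x]] =
  (m1 A * m2 B)%E.
Proof.
move=> mA mB; rewrite -product_measure1E//.
rewrite /cons_measure /pushforward; congr ((m1 \x m2)%E _).
apply/seteqP; split=> -[a b] /=.
- case=> Aa Bb; split; first by rewrite theadE in Aa.
  by rewrite (_ : b = [tuple of behead (tcons (a, b))])//; exact: val_inj.
- case=> Aa Bb; split; first by rewrite theadE.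
  by rewrite (_ : [tuple of _] = b)//; exact: val_inj.
Qed.

Let measurable_thead_behead (A : set T) (B : set (n.-tuple T)) :
  measurable A -> measurable B ->
  measurable [set x : n.+1.-tuple T | A (thead x) /\ B [tuple of behead x]].
Proof.
move=> mA mB; apply: measurableI.
- rewrite -[X in measurable X]setTI.
  exact: (@measurable_tnth _ T n.+1 ord0).
- rewrite -[X in measurable X]setTI.
  exact: (@measurable_behead _ T n).
Qed.

Let cons_measure_sigma_finite : sigma_finite setT cons_measure.
Proof.
have /sigma_finiteP[F [TF ndF Foo]] := sigma_finiteT m1.
have /sigma_finiteP[G [TG ndG Goo]] := sigma_finiteT m2.
exists (fun k => [set x | F k (thead x) /\ G k [tuple of behead x]]).
  rewrite predeqE => x; split=> // _.
  have [i _ Fi] : (\bigcup_i F i) (thead x) by rewrite -TF.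
  have [j _ Gj] : (\bigcup_i G i) [tuple of behead x] by rewrite -TG.
  exists (maxn i j) => //; split.
  - by move: (thead x) Fi; exact/subsetPset/ndF/leq_maxl.
  - by move: [tuple of behead x] Gj; exact/subsetPset/ndG/leq_maxr.
move=> k; have [? ?] := Foo k; have [? ?] := Goo k.
split; first exact: measurable_thead_behead.
by rewrite cons_measureE// lte_mul_pinfty// ge0_fin_numE.
Qed.

HB.instance Definition _ := Measure_isSigmaFinite.Build _ _ _ cons_measure
  cons_measure_sigma_finite.

End cons_measure.

Fixpoint measure_power d (T : measurableType d) (R : realType)
    (m : {sigma_finite_measure set T -> \bar R}) (n : nat) :
    {sigma_finite_measure set (n.-tuple T) -> \bar R} :=
  match n with
  | 0 => @dirac _ (0.-tuple T) [tuple] R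
  | n'.+1 => cons_measure m (measure_power m n')
  end.

Lemma measure_power_box d (T : measurableType d) (R : realType)
    (m : {sigma_finite_measure set T -> \bar R}) (n : nat)
    (A : 'I_n -> set T) : (forall i, measurable (A i)) ->
  measure_power m n [set x | forall i, A i (tnth x i)] =
  (\prod_(i < n) m (A i))%E.
Proof.
elim: n A => [|n IH] A mA.
  rewrite big_ord0 /= diracE mem_set//.
  by move=> [].
rewrite big_ord_recl -(IH (fun i => A (lift ord0 i)))//= -cons_measureE//.
- congr (cons_measure _ _ _); apply/seteqP; split=> x /= Ax.
  + split; first exact: Ax.
    by move=> i; have := Ax (lift ord0 i); rewrite [x in tnth x _]tuple_eta tnthS.
  + case: Ax => A0 A1 i; have [->//|i0] := eqVneq i ord0.
    have [j ->] : exists j, i = lift ord0 j.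
      by case: (unliftP ord0 i) i0 => [j ->|->]; [exists j|rewrite eqxx].
    by rewrite [x in tnth x _]tuple_eta tnthS.
- rewrite (_ : [set x | _] = \bigcap_(i in [set: 'I_n])
      ((@tnth n T)^~ i @^-1` A (lift ord0 i))); last first.
    by apply/seteqP; split=> x /= h i; [move=> _|]; exact: (h i).
  apply: fin_bigcap_measurable => [|i _]; first exact: finite_finset.
  by rewrite -[X in measurable X]setTI; exact: measurable_tnth.
Qed.

(* R^D, with its product (= Borel) sigma-algebra. *)
Notation euclid R D := (D.-tuple (measurableTypeR R)).

Definition lebesgue (R : realType) (D : nat) :
    {sigma_finite_measure set (euclid R D) -> \bar R} :=
  measure_power (@lebesgue_measure R) D.

Section euclid.
Context (R : realType) (D : nat).
Implicit Types (x y : euclid R D) (g : euclid R D -> R).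

Definition coord x (i : 'I_D) : R := tnth x i.

Definition esub x y : euclid R D := [tuple coord x i - coord y i | i < D].

Definition escale (a : R) x : euclid R D := [tuple a * coord x i | i < D].

Definition enorm x : R := Num.sqrt (\sum_(i < D) coord x i ^+ 2).

Local Open Scope ereal_scope.

(* Nonnegativity is only required almost everywhere, g standing for an element
   of a Lebesgue space. *)
Definition is_density g :=
  [/\ measurable_fun setT g, {ae lebesgue R D, forall x, (0 <= g x)%R} &
      \int[lebesgue R D]_x (g x)%:E = 1].

Definition moment (k : nat) g : \bar R :=
  \int[lebesgue R D]_x (enorm x ^+ k * g x)%:E.

Definition density_P3 g := is_density g /\ moment 3 g < +oo.

Definition centered g :=
  forall i, \int[lebesgue R D]_x (coord x i * g x)%:E = 0.

Definition identity_covariance g :=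
  forall i j, \int[lebesgue R D]_x (coord x i * coord x j * g x)%:E =
    ((i == j)%:R)%:E.

(* Convolutions take values in \bar R: the integral may diverge at some
   points. *)
Definition convolution (f h : euclid R D -> \bar R) x : \bar R :=
  \int[lebesgue R D]_y (f (esub x y) * h y).

(* The N-fold convolution for N >= 1; the value at N = 0 is irrelevant. *)
Definition convolution_power g (N : nat) : euclid R D -> \bar R :=
  iter N.-1 (convolution (EFin \o g)) (EFin \o g).

Definition normalized_convolution g (N : nat) x : \bar R :=
  (N%:R `^ (D%:R / 2))%:E * convolution_power g N (escale (Num.sqrt N%:R) x).

Definition gaussian x : R :=
  ((2 * pi) `^ (- (D%:R / 2)) * expR (- (enorm x ^+ 2 / 2)))%R.

End euclid.

(* Main.v *)
Require Import Defs.
From HB Require Import structures.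
From mathcomp Require Import all_boot all_order all_algebra.
From mathcomp Require Import all_classical all_reals all_analysis.
From mathcomp Require Import measurable_realfun ess_sup_inf.
From mathcomp Require Import ring lra zify.
Import Defs.

Set Implicit Arguments.
Unset Strict Implicit.
Unset Printing Implicit Defensive.

Import Order.TTheory GRing.Theory Num.Theory.
Import numFieldNormedType.Exports.

Local Open Scope classical_set_scope.
Local Open Scope ring_scope.

(** Write [phi] for the characteristic function of [g]. That of the [N]-fold
    convolution of [g] is [phi ^ N], and the sup norm of the difference of two
    densities is at most [(2 pi)^-D] times the integral of the difference of
    their characteristic functions. It is therefore enough to show that
    [phi ^ N] and [exp (- N |xi|^2 / 2)] are at distance [O (N^(-(D+1)/2))] in
    [L^1]: rescaling space by [sqrt N] multiplies densities by [N^(D/2)], which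
    leaves the rate [N^(-1/2)].

    The frequencies are split at [delta = 1 / (8 (M + 1))], where [M] is the
    third moment of [g].
    - For [|xi| <= delta], centering, the identity covariance and the third
      moment give [|phi - (1 - |xi|^2 / 2)| <= C |xi|^3] ([cf_cos_taylor],
      [cf_sin_taylor]). Telescoping [z^N - w^N] ([cpow_sub_le]) bounds the gap
      by [C N |xi|^3 exp (- N |xi|^2 / 8)], hence by a multiple of
      [N^(-1/2) exp (- N |xi|^2 / 16)] ([cpow_near_gauss]), whose integral has
      the required order.
    - For [|xi| >= delta], the Gaussian is exponentially small, and
      [|phi| <= tau] for some [tau < 1] that depends on [D], [M] and the
      [L^p] norm only ([cf_sqr_le_of_separated]). Then [|phi|^N] is at most
      [tau^(N - 2(k+1)) |phi|^(2(k+1))], and the last factor is integrable as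
      soon as the [(k+1)]-fold convolution of [g] is bounded
      ([integral_cf_sqr_le]).

    The integer [k] is where [p] enters. If [1 + 1/k <= p], then the integral
    [S] of [u = g^(1 + 1/k)] is controlled by the [L^p] norm
    ([integrability_gain]), and the inequality between arithmetic and geometric
    means bounds the [(k+1)]-fold convolution by [S^k] ([convolution_power_le]);
    this is the part of Young's inequality that the argument needs. So
    [N(p) = 2 (k + 1)].

    The Fourier analysis is real and uses Tonelli's theorem in place of complex
    integrals and inversion. The characteristic function of a density [G] is
    read off the nonnegative integrals of [G y * (1 + cos (xi . y + th))], for
    all phases [th] ([one_plus_cf]). Averaging them in [xi] against a Gaussian
    produces a Gaussian smoothing of [G] ([heat_representation]), so an
    inequality between characteristic functions becomes one between smoothed
    densities. The smoothing is then removed: since the indicator function of a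
    bounded set moves little in [L^1] under small shifts
    ([vanishing_shift_osc]), the inequality holds for the integrals over all
    bounded sets, hence almost everywhere ([ae_le_density]). *)

(** * Lebesgue measure on Euclidean space *)

Section change_of_variables.
Context d1 d2 (T1 : measurableType d1) (T2 : measurableType d2) (R : realType).
Local Open Scope ereal_scope.

Lemma ge0_integral_change (m1 : {measure set T1 -> \bar R})
    (m2 : {measure set T2 -> \bar R}) (phi : T1 -> T2) (c : R) (f : T2 -> \bar R) :
  (0 <= c)%R -> measurable_fun setT phi ->
  (forall A, measurable A -> m1 (phi @^-1` A) = c%:E * m2 A) ->
  measurable_fun setT f -> (forall x, 0 <= f x) ->
  \int[m1]_x f (phi x) = c%:E * \int[m2]_x f x.
Proof.
move=> c0 mphi h mf f0.
have := @ge0_integral_pushforward _ _ _ _ R phi mphi m1 setT f measurableT mf (fun x _ => f0 x).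
rewrite preimage_setT => <-.
rewrite [LHS](eq_measure_integral (mscale (NngNum c0) m2)).
  by rewrite ge0_integral_mscale.
by move=> A mA _; rewrite /= /mscale/= -h.
Qed.

End change_of_variables.

Section lebesgue_line.
Context (R : realType).
Local Notation mu := (@lebesgue_measure R).
Local Open Scope ereal_scope.

Lemma measurable_affine (a b : R) :
  measurable_fun setT ((fun x => a * x + b)%R : measurableTypeR R -> measurableTypeR R).
Proof. by apply: measurable_funD => //; apply: measurable_funM. Qed.

Lemma lebesgue_measure_affine (a b : R) (A : set (measurableTypeR R)) :
  (0 < a)%R -> measurable A ->
  mu ((fun x => a * x + b)%R @^-1` A) = (a^-1)%:E * mu A.
Proof.
move=> a0 mA.
pose phi := ((fun x => a * x + b)%R : measurableTypeR R -> measurableTypeR R).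
pose m : {measure set (measurableTypeR R) -> \bar R} :=
  mscale (NngNum (ltW a0)) (pushforward mu phi).
suff -> : mu A = m (measurable_affine a b) A.
  by rewrite /m /= /mscale /= muleA -EFinM mulVf ?gt_eqF// mul1e.
apply: lebesgue_measure_unique => //= _ [[x y]] _ <-.
rewrite /m /mscale /= /pushforward.
rewrite (_ : _ @^-1` _ = `](x - b) / a, (y - b) / a]%classic)%R; last first.
  by apply/seteqP; split => z /=; rewrite !in_itv/=;
    rewrite ltr_pdivrMr// ler_pdivlMr// ltrBlDr lerBrDr [(z * a)%R]mulrC.
rewrite !lebesgue_measure_itv/= !lte_fin ltr_pM2r ?invr_gt0// ltrD2r.
case: ifPn => _; last by rewrite mule0.
by rewrite -!EFinB -EFinM -mulrBl; congr EFin; field; rewrite gt_eqF.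
Qed.

Lemma ge0_integral_affine (a b : R) (f : measurableTypeR R -> \bar R) :
  (a != 0)%R -> measurable_fun setT f -> (forall x, 0 <= f x) ->
  \int[mu]_x f (a * x + b)%R = (`|a|^-1)%:E * \int[mu]_x f x.
Proof.
move=> a0 mf f0.
have pos (c d : R) (h : measurableTypeR R -> \bar R) : (0 < c)%R ->
    measurable_fun setT h -> (forall x, 0 <= h x) ->
    \int[mu]_x h (c * x + d)%R = (c^-1)%:E * \int[mu]_x h x.
  move=> c0 mh h0.
  rewrite -(ge0_integral_change _ _ (fun A mA => lebesgue_measure_affine d c0 mA))//.
    by rewrite invr_ge0 ltW.
  exact: measurable_affine.
have [agt|alt] := ltP 0%R a; first by rewrite gtr0_norm// pos.
have aN : (0 < - a)%R by rewrite oppr_gt0 lt_neqAle a0.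
have mN : measurable_fun setT (-%R : measurableTypeR R -> measurableTypeR R).
  exact: oppr_measurable.
have mfN : measurable_fun setT (fun x : measurableTypeR R => f (- x)%R).
  exact: (measurableT_comp mf).
transitivity (\int[mu]_x f (- (- a * x + - b))%R).
  by apply: eq_integral => x _; congr f; ring.
rewrite (pos _ _ (fun x : measurableTypeR R => f (- x)%R))// ler0_norm//; congr (_ * _).
rewrite (@ge0_integral_change _ _ _ _ _ mu mu -%R 1%R)// ?mul1e//.
by move=> A mA; rewrite mul1e; exact: lebesgue_measureN.
Qed.

End lebesgue_line.

Section euclid_basics.
Context (R : realType).
Local Open Scope ereal_scope.

(** Tonelli's theorem in the form that drives every induction on the dimension. *)
Lemma ge0_integral_cons (n : nat) (f : euclid R n.+1 -> \bar R) :
  measurable_fun setT f -> (forall x, 0 <= f x) ->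
  \int[lebesgue R n.+1]_x f x =
  \int[@lebesgue_measure R]_a \int[lebesgue R n]_v f (tcons (a, v)).
Proof.
move=> mf f0.
have mt := measurable_tcons (T := measurableTypeR R) (n := n).
rewrite -(@fubini_tonelli1 _ _ _ _ _ lebesgue_measure (lebesgue R n) (fun z => f (tcons z)))//=; last first.
  exact: measurableT_comp mf mt.
have mA A : measurable A -> (lebesgue_measure \x lebesgue R n) (@tcons _ _ n @^-1` A) =
    1%:E * lebesgue R n.+1 A by move=> _; rewrite mul1e.
by rewrite (ge0_integral_change ler01 mt mA mf f0) mul1e.
Qed.

Lemma ge0_integral_nil (f : euclid R 0 -> \bar R) :
  measurable_fun setT f -> \int[lebesgue R 0]_x f x = f [tuple].
Proof. by move=> mf; rewrite /lebesgue/= integral_dirac// diracE in_setT mul1e. Qed.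

End euclid_basics.

Section euclid_operations.
Context (R : realType).
Local Open Scope ring_scope.

Definition eaffine D (a : R) (b x : euclid R D) : euclid R D :=
  [tuple a * coord x i + coord b i | i < D].

Definition dot D (x y : euclid R D) : R := \sum_(i < D) coord x i * coord y i.

Lemma euclidP D (x y : euclid R D) : (forall i, coord x i = coord y i) -> x = y.
Proof. by move=> xy; apply: eq_from_tnth. Qed.

Lemma coord_tuple D (F : 'I_D -> R) i : coord ([tuple F j | j < D] : euclid R D) i = F i.
Proof. by rewrite /coord tnth_mktuple. Qed.

Lemma coord_tcons0 D (p : measurableTypeR R * euclid R D) :
  coord (tcons p) ord0 = p.1.
Proof. by []. Qed.

Lemma coord_tconsS D (p : measurableTypeR R * euclid R D) i :
  coord (tcons p) (lift ord0 i) = coord p.2 i.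
Proof. by rewrite /coord tnthS. Qed.

Lemma coord_esub D (x y : euclid R D) i : coord (esub x y) i = coord x i - coord y i.
Proof. by rewrite /coord tnth_mktuple. Qed.

Lemma coord_escale D a (x : euclid R D) i : coord (escale a x) i = a * coord x i.
Proof. by rewrite /coord tnth_mktuple. Qed.

Lemma coord_eaffine D a (b x : euclid R D) i :
  coord (eaffine a b x) i = a * coord x i + coord b i.
Proof. by rewrite /coord tnth_mktuple. Qed.

Lemma tcons_surj D (x : euclid R D.+1) : exists a v, x = tcons (a, v).
Proof.
exists (thead x), [tuple of behead x]; apply: euclidP => i.
by rewrite /tcons/= -tuple_eta.
Qed.

Lemma dot_tcons D a b (x y : euclid R D) :
  dot (tcons (a, x)) (tcons (b, y)) = a * b + dot x y.
Proof.
rewrite /dot big_ord_recl !coord_tcons0; congr +%R.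
by apply: eq_bigr => i _; rewrite !coord_tconsS.
Qed.

Lemma dotC D (x y : euclid R D) : dot x y = dot y x.
Proof. by apply: eq_bigr => i _; rewrite mulrC. Qed.

Lemma dotBr D (z x y : euclid R D) : dot z (esub x y) = dot z x - dot z y.
Proof. by rewrite /dot -sumrB; apply: eq_bigr => i _; rewrite coord_esub mulrBr. Qed.

Lemma dotZr D a (x y : euclid R D) : dot x (escale a y) = a * dot x y.
Proof. by rewrite /dot mulr_sumr; apply: eq_bigr => i _; rewrite coord_escale mulrCA. Qed.

Lemma dotZl D a (x y : euclid R D) : dot (escale a x) y = a * dot x y.
Proof. by rewrite dotC dotZr dotC. Qed.

Lemma dotxx_ge0 D (x : euclid R D) : 0 <= dot x x.
Proof. by apply: sumr_ge0 => i _; rewrite -expr2 sqr_ge0. Qed.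

Lemma enormE D (x : euclid R D) : enorm x = Num.sqrt (dot x x).
Proof. by congr Num.sqrt; apply: eq_bigr => i _; rewrite expr2. Qed.

Lemma enorm_ge0 D (x : euclid R D) : 0 <= enorm x.
Proof. exact: sqrtr_ge0. Qed.

Lemma enorm_sqr D (x : euclid R D) : enorm x ^+ 2 = dot x x.
Proof. by rewrite enormE sqr_sqrtr// dotxx_ge0. Qed.

Lemma dot_escale D a (x : euclid R D) : dot (escale a x) (escale a x) = a ^+ 2 * dot x x.
Proof. by rewrite dotZr dotZl mulrA expr2. Qed.

Lemma abs_coord_le D (x : euclid R D) i : `|coord x i| <= enorm x.
Proof.
rewrite -(ler_pXn2r (n:=2))// ?nnegrE ?enorm_ge0//.
rewrite enorm_sqr -normrX ger0_norm ?sqr_ge0// /dot (bigD1 i)//= expr2 lerDl.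
by apply: sumr_ge0 => j _; rewrite -expr2 sqr_ge0.
Qed.

(** Lagrange's identity writes the difference of the two sides as half of
    [\sum_(i, j) (x_i y_j - x_j y_i)^2]. *)
Lemma cauchy_schwarz_dot D (x y : euclid R D) : dot x y ^+ 2 <= dot x x * dot y y.
Proof.
(* The factor 2 makes the sum over ordered pairs of indices. *)
rewrite -subr_ge0 -(@pmulr_rge0 _ 2)//.
have -> : 2 * (dot x x * dot y y - dot x y ^+ 2) =
  \sum_(i < D) \sum_(j < D) (coord x i * coord y j - coord x j * coord y i) ^+ 2.
  transitivity (\sum_(i < D) \sum_(j < D)
    ((coord x i * coord x i) * (coord y j * coord y j) +
     (coord y i * coord y i) * (coord x j * coord x j) -
     2 * ((coord x i * coord y i) * (coord x j * coord y j)))).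
    rewrite [RHS](eq_bigr (fun i => (coord x i * coord x i) * dot y y +
     (coord y i * coord y i) * dot x x - 2 * ((coord x i * coord y i) * dot x y))); last first.
      by move=> i _; rewrite sumrB big_split/= -!mulr_sumr.
    by rewrite sumrB big_split/= -!mulr_suml -mulr_sumr -mulr_suml /dot; ring.
  by apply: eq_bigr => i _; apply: eq_bigr => j _; ring.
by apply: sumr_ge0 => i _; apply: sumr_ge0 => j _; apply: sqr_ge0.
Qed.

Lemma abs_dot_le D (x y : euclid R D) : `|dot x y| <= enorm x * enorm y.
Proof.
rewrite -(ler_pXn2r (n:=2))// ?nnegrE ?mulr_ge0 ?enorm_ge0//.
by rewrite -normrX ger0_norm ?sqr_ge0// exprMn !enorm_sqr cauchy_schwarz_dot.
Qed.

End euclid_operations.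

Section euclid_measurability.
Context d (T : measurableType d) (R : realType) (D : nat).

Lemma measurable_coord (f : T -> euclid R D) i :
  measurable_fun setT f -> measurable_fun setT (fun t => coord (f t) i).
Proof. by move=> /measurable_fun_tnthP; apply. Qed.

Lemma measurable_euclid (f : T -> euclid R D) :
  (forall i, measurable_fun setT (fun t => coord (f t) i)) -> measurable_fun setT f.
Proof. by move=> h; apply/measurable_fun_tnthP => i; exact: h. Qed.

Lemma measurable_esub (f g : T -> euclid R D) : measurable_fun setT f ->
  measurable_fun setT g -> measurable_fun setT (fun t => esub (f t) (g t)).
Proof.
move=> mf mg; apply: measurable_euclid => i; under eq_fun do rewrite coord_esub.
by apply: measurable_funB; exact: measurable_coord.
Qed.

Lemma measurable_eaffine a b (f : T -> euclid R D) : measurable_fun setT f ->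
  measurable_fun setT (fun t => eaffine a b (f t)).
Proof.
move=> mf; apply: measurable_euclid => i; under eq_fun do rewrite coord_eaffine.
by apply: measurable_funD => //; apply: measurable_funM => //; exact: measurable_coord.
Qed.

Lemma measurable_escale a (f : T -> euclid R D) : measurable_fun setT f ->
  measurable_fun setT (fun t => escale a (f t)).
Proof.
move=> mf; apply: measurable_euclid => i; under eq_fun do rewrite coord_escale.
by apply: measurable_funM => //; exact: measurable_coord.
Qed.

Lemma measurable_dot (f g : T -> euclid R D) : measurable_fun setT f ->
  measurable_fun setT g -> measurable_fun setT (fun t => dot (f t) (g t)).
Proof.
move=> mf mg; apply: measurable_sum => i.
by apply: measurable_funM; exact: measurable_coord.
Qed.

Lemma measurable_enorm (f : T -> euclid R D) : measurable_fun setT f ->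
  measurable_fun setT (fun t => enorm (f t)).
Proof.
move=> mf; under eq_fun do rewrite enormE.
apply: (@measurableT_comp _ _ _ _ _ _ (@Num.sqrt R)); last exact: measurable_dot.
by apply: continuous_measurable_fun; exact: sqrt_continuous.
Qed.

End euclid_measurability.

Section euclid_affine.
Context (R : realType).
Local Open Scope ereal_scope.

Lemma ge0_integral_eaffine D (a : R) (b : euclid R D) (f : euclid R D -> \bar R) :
  (a != 0)%R -> measurable_fun setT f -> (forall x, 0 <= f x) ->
  \int[lebesgue R D]_x f (eaffine a b x) =
  ((`|a|^-1) ^+ D)%:E * \int[lebesgue R D]_x f x.
Proof.
move=> a0; elim: D b f => [|D IH] b f mf f0.
  rewrite !ge0_integral_nil ?expr0 ?mul1e//.
    by congr f; apply: euclidP => -[].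
  by apply: measurableT_comp => //; exact: measurable_eaffine.
have [b0 [b' bE]] := tcons_surj b.
rewrite ge0_integral_cons//; last first.
  by apply: measurableT_comp => //; exact: measurable_eaffine.
have mft : measurable_fun setT (fun p => f (tcons p)).
  by apply: measurableT_comp => //; exact: measurable_tcons.
transitivity (\int[lebesgue_measure]_x \int[lebesgue R D]_v
    f (tcons ((a * x + b0)%R : measurableTypeR R, eaffine a b' v))).
  apply: eq_integral => x _; apply: eq_integral => v _; congr f.
  apply: euclidP => i; rewrite coord_eaffine bE.
  by have [j ->|->] := unliftP ord0 i; rewrite ?coord_tconsS ?coord_tcons0//= coord_eaffine.
under eq_integral => x _.
  rewrite (IH b' (fun v => f (tcons ((a * x + b0)%R : measurableTypeR R, v))))//; last first.
    apply: (measurableT_comp mft); exact: measurable_pair1.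
  over.
have mF : measurable_fun setT (fun x : measurableTypeR R => \int[lebesgue R D]_v f (tcons (x, v))).
  exact: (@measurable_fun_fubini_tonelli_F _ _ _ _ R (lebesgue R D) (fun p => f (tcons p))).
have F0 x : 0 <= \int[lebesgue R D]_v f (tcons (x, v)) by exact: integral_ge0.
rewrite ge0_integralZl//; last first.
  exact: (measurableT_comp mF (measurable_affine a b0)).
rewrite (ge0_integral_affine b0 a0 mF)// [in RHS]ge0_integral_cons//.
by rewrite muleA -EFinM exprSr.
Qed.

Lemma ge0_integral_esub D (b : euclid R D) (f : euclid R D -> \bar R) :
  measurable_fun setT f -> (forall x, 0 <= f x) ->
  \int[lebesgue R D]_x f (esub b x) = \int[lebesgue R D]_x f x.
Proof.
move=> mf f0; have := @ge0_integral_eaffine D (-1)%R b f.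
rewrite oppr_eq0 oner_eq0 normrN1 invr1 expr1n mul1e => <-//.
apply: eq_integral => x _; congr f; apply: euclidP => i.
by rewrite coord_esub coord_eaffine mulN1r addrC.
Qed.

Lemma ge0_integral_esubl D (b : euclid R D) (f : euclid R D -> \bar R) :
  measurable_fun setT f -> (forall x, 0 <= f x) ->
  \int[lebesgue R D]_x f (esub x b) = \int[lebesgue R D]_x f x.
Proof.
move=> mf f0; have := @ge0_integral_eaffine D 1%R (escale (-1) b) f.
rewrite oner_eq0 normr1 invr1 expr1n mul1e => <-//.
apply: eq_integral => x _; congr f; apply: euclidP => i.
by rewrite coord_esub coord_eaffine coord_escale mulN1r mul1r.
Qed.

(** Null sets are detected by the integral of their indicator function, whose
    behaviour under affine changes of variable is known. *)
Lemma ae_eaffine D (a : R) (b : euclid R D) (P : set (euclid R D)) : (a != 0)%R ->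
  {ae lebesgue R D, forall x, P x} -> {ae lebesgue R D, forall x, P (eaffine a b x)}.
Proof.
move=> a0 [A [mA A0 PA]].
have mT : measurable_fun setT (eaffine a b) by exact: measurable_eaffine.
have mTA : measurable (eaffine a b @^-1` A) by rewrite -[X in measurable X]setTI; exact: mT.
exists (eaffine a b @^-1` A); split => //; last by move=> x /= /PA.
have m1A : measurable_fun setT (fun x => (\1_A x)%:E : \bar R).
  exact/measurable_EFinP.
have i0 : \int[lebesgue R D]_x (\1_A x)%:E = 0.
  by rewrite integral_indic// setIT; exact: A0.
have : \int[lebesgue R D]_x (\1_A (eaffine a b x))%:E = 0.
  rewrite (@ge0_integral_eaffine _ _ _ (fun x => (\1_A x)%:E))//.
  by rewrite i0 mule0.
rewrite -[X in X = _ -> _]/(\int[lebesgue R D]_x (\1_(eaffine a b @^-1` A) x)%:E).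
by rewrite integral_indic// setIT.
Qed.

Lemma ae_esub D (b : euclid R D) (P : set (euclid R D)) :
  {ae lebesgue R D, forall x, P x} -> {ae lebesgue R D, forall x, P (esub b x)}.
Proof.
have N1 : (-1 != 0 :> R)%R by rewrite oppr_eq0 oner_eq0.
move=> /(ae_eaffine b N1); apply: filterS => x.
congr (P _); apply: euclidP => i.
by rewrite coord_esub coord_eaffine mulN1r addrC.
Qed.

Lemma ae_escale D (a : R) (P : set (euclid R D)) : (a != 0)%R ->
  {ae lebesgue R D, forall x, P x} -> {ae lebesgue R D, forall x, P (escale a x)}.
Proof.
move=> a0 /(ae_eaffine [tuple 0%R | i < D] a0); apply: filterS => x.
congr (P _); apply: euclidP => i.
by rewrite coord_escale coord_eaffine /coord [X in (_ + X)%R]tnth_mktuple addr0.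
Qed.

End euclid_affine.

(** * Gaussian integrals *)

Section measurable_elementary.
Context d (T : measurableType d) (R : realType).
Implicit Types f : T -> R.

Lemma measurable_cos_comp f : measurable_fun setT f ->
  measurable_fun setT (fun x => cos (f x)).
Proof.
apply: (measurableT_comp (f := @cos R)).
by apply: continuous_measurable_fun; exact: continuous_cos.
Qed.

Lemma measurable_sin_comp f : measurable_fun setT f ->
  measurable_fun setT (fun x => sin (f x)).
Proof.
apply: (measurableT_comp (f := @sin R)).
by apply: continuous_measurable_fun; exact: continuous_sin.
Qed.

Lemma measurable_expR_comp f : measurable_fun setT f ->
  measurable_fun setT (fun x => expR (f x)).
Proof. exact: (measurableT_comp (f := @expR R)). Qed.

Lemma measurable_opp_comp f : measurable_fun setT f ->
  measurable_fun setT (fun x => - f x).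
Proof. exact: (measurableT_comp (f := @GRing.opp R)). Qed.

End measurable_elementary.

Section gaussian_line.
Context (R : realType).
Local Notation mu := (@lebesgue_measure R).

(** The fundamental theorem of calculus on [[-n, n]], followed by dominated
    convergence. *)
Lemma integral_derive_eq0 (h h' : R -> R) :
  (forall x, is_derive (x : R) (1:R) h (h' x)) -> continuous h' ->
  mu.-integrable setT (EFin \o h') ->
  h n%:R @[n --> \oo] --> 0 -> h (- n%:R) @[n --> \oo] --> 0 ->
  (\int[mu]_x (h' x)%:E = 0)%E.
Proof.
move=> dh ch' ih' hp hm.
have ch : continuous h.
  by move=> x; apply/differentiable_continuous/derivable1_diffP; case: (dh x).
pose f n x : \bar R := ((EFin \o h') \_ `[- n.+1%:R, n.+1%:R]) x.
have fE n : (\int[mu]_x f n x = (h n.+1%:R - h (- n.+1%:R))%:E)%E.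
  rewrite -integral_mkcond (@continuous_FTC2 _ _ h).
  - by rewrite EFinB.
  - by rewrite -subr_gt0 opprK addr_gt0.
  - exact: continuous_subspaceT.
  - split.
    + by move=> x _; case: (dh x).
    + exact/cvg_at_right_filter/ch.
    + exact/cvg_at_left_filter/ch.
  - by move=> x _; rewrite derive1E; case: (dh x).
have mh' : measurable_fun setT h' by exact: continuous_measurable_fun.
have c1 : (\int[mu]_x f n x @[n --> \oo] --> \int[mu]_x (h' x)%:E)%E.
  have [] := @dominated_convergence _ _ R mu setT measurableT f (EFin \o h') (abse \o (EFin \o h')).
  - move=> n; apply/(measurable_restrictT _ _).1 => //.
    exact/measurable_EFinP/measurable_funTS.
  - exact/measurable_EFinP.
  - apply: aeW => x _; apply/cvg_ballP => e e0.
    have [m xm] : exists m : nat, `|x| <= m%:R.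
      by exists (Num.trunc `|x|).+1; rewrite ltW// truncnS_gt.
    exists m => //= n /= mn; rewrite /f patchE mem_set; first exact: ballxx.
    rewrite /= in_itv/= -ler_norml (le_trans xm)// ler_nat.
    by rewrite (leq_trans mn).
  - exact: integrable_abse.
  - by apply: aeW => x n _; rewrite /f patchE; case: ifPn => //=; rewrite normr0 lee_fin.
  - by [].
have c2 : (\int[mu]_x f n x @[n --> \oo] --> (0 : R)%:E)%E.
  under eq_fun do rewrite fE.
  apply: cvg_EFin; first exact: nearW.
  rewrite -[X in _ --> X](subr0 0); apply: cvgB.
  - by move: hp; rewrite -(cvg_shiftS (fun n => h n%:R)).
  - by move: hm; rewrite -(cvg_shiftS (fun n => h (- n%:R))).
exact: (cvg_unique _ c1 c2).
Qed.

Lemma integral_gauss_line (a : R) : 0 < a ->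
  (\int[mu]_x (expR (- (a * x ^+ 2)))%:E = (Num.sqrt (pi / a))%:E)%E.
Proof.
move=> a0.
have sa0 : Num.sqrt a != 0 by rewrite gt_eqF ?sqrtr_gt0.
transitivity (\int[mu]_x (fun y : measurableTypeR R => (gauss_fun y)%:E) (Num.sqrt a * x + 0)%R)%E.
  by apply: eq_integral => x _; rewrite /= /gauss_fun addr0 exprMn sqr_sqrtr ?ltW.
rewrite (@ge0_integral_affine _ _ 0 (fun y : measurableTypeR R => (gauss_fun y)%:E))//; last 2 first.
  by apply/measurable_EFinP; exact: measurable_gauss_fun.
  by move=> x; rewrite lee_fin gauss_fun_ge0.
rewrite integralT_gauss -EFinM; congr EFin.
by rewrite ger0_norm ?sqrtr_ge0// sqrtrM ?pi_ge0// sqrtrV ?ltW// mulrC.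
Qed.

Lemma integrable_gauss_line (a : R) : 0 < a ->
  mu.-integrable setT (fun x => (expR (- (a * x ^+ 2)))%:E).
Proof.
move=> a0; apply/integrableP; split.
  apply/measurable_EFinP; apply: measurableT_comp => //.
  by apply: measurableT_comp => //; apply: measurable_funM.
under eq_integral do rewrite gee0_abs ?lee_fin ?expR_ge0//.
by rewrite integral_gauss_line// ltry.
Qed.

(** [e^(y^2/4) >= 1 + y^2/4 >= |y|]; the Gaussian thus absorbs polynomial
    factors at the cost of a smaller exponent. *)
Lemma abs_le_expR_sqr (x : R) : `|x| <= expR (x ^+ 2 / 4).
Proof.
apply: (le_trans _ (expR_ge1Dx _)).
have := sqr_ge0 (`|x| / 2 - 1); rewrite sqrrB1 expr_div_n real_normK ?num_real//.
lra.
Qed.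

Lemma abs_gauss_le (x : R) : `|x| * expR (- (x ^+ 2 / 2)) <= expR (- (4^-1 * x ^+ 2)).
Proof.
have -> : - (4^-1 * x ^+ 2) = x ^+ 2 / 4 + - (x ^+ 2 / 2) by lra.
by rewrite expRD ler_pM2r ?expR_gt0// abs_le_expR_sqr.
Qed.

Let G (th t x : R) : R := expR (- (x ^+ 2 / 2)) * cos (t * x + th).
Let dG (th t x : R) : R := - (x * expR (- (x ^+ 2 / 2)) * sin (t * x + th)).

Let is_derive_G th t x : is_derive t (1:R) (fun t => G th t x) (dG th t x).
Proof.
rewrite /G /dG; apply: is_derive_eq.
by rewrite !scaler0 !(add0r, addr0) /GRing.scale/=; ring.
Qed.

Let mexp : measurable_fun setT (fun x : R => expR (- (x ^+ 2 / 2))).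
Proof.
apply: measurableT_comp => //; apply: measurableT_comp => //.
by apply: measurable_funM.
Qed.

Let mlin (t th : R) : measurable_fun setT (fun x : R => t * x + th).
Proof. by apply: measurable_funD => //; apply: measurable_funM. Qed.

Let mG th t : measurable_fun setT (G th t).
Proof.
by apply: measurable_funM => //; exact: measurable_cos_comp.
Qed.

Let mdG th t : measurable_fun setT (dG th t).
Proof.
apply: measurableT_comp => //; apply: measurable_funM.
  exact: measurable_funM.
exact: measurable_sin_comp.
Qed.

Let iexp : mu.-integrable setT (fun x : R => (expR (- (x ^+ 2 / 2)))%:E).
Proof.
have := @integrable_gauss_line 2^-1; rewrite invr_gt0 ltr0n => /(_ isT).
by congr (mu.-integrable setT _); apply/funext => x; rewrite mulrC.
Qed.

Let iG th t : mu.-integrable setT (EFin \o G th t).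
Proof.
apply: (le_integrable measurableT _ _ iexp); first by apply/measurable_EFinP; exact: mG.
move=> x _; rewrite /= lee_fin /G normrM ler_piMr//.
by rewrite ler_norml cos_geN1 cos_le1.
Qed.

Let dG_le th t x : `|dG th t x| <= expR (- (4^-1 * x ^+ 2)).
Proof.
rewrite /dG normrN normrM; apply: le_trans (abs_gauss_le x).
rewrite normrM (ger0_norm (expR_ge0 _)) ler_piMr ?mulr_ge0 ?expR_ge0//.
by rewrite ler_norml sin_geN1 sin_le1.
Qed.

Let i4 : mu.-integrable setT (fun x : R => (expR (- (4^-1 * x ^+ 2)))%:E).
Proof. by apply: integrable_gauss_line. Qed.

Let idG th t : mu.-integrable setT (EFin \o dG th t).
Proof.
apply: (le_integrable measurableT _ _ i4); first by apply/measurable_EFinP; exact: mdG.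
by move=> x _; rewrite /= lee_fin [leRHS]ger0_norm ?expR_ge0.
Qed.

Let F th t : R := (\int[mu]_x G th t x)%R.

Let partial_G th t x : partial1of2 (G th) t x = dG th t x.
Proof.
by rewrite partial1of2E; have [_ ->] := is_derive_G th t x.
Qed.

Let is_derive_F0 th t : is_derive t (1 : R) (F th) (\int[mu]_x dG th t x)%R.
Proof.
have tI : `](t - 1), (t + 1)[%classic t.
  by rewrite /= in_itv/= ltrBlDr !ltrDl ltr01.
have i1 s : `](t - 1), (t + 1)[%classic s -> mu.-integrable setT (EFin \o G th s).
  by move=> _; exact: iG.
have i2 s x : `](t - 1), (t + 1)[%classic s -> setT x -> derivable ((G th) ^~ x) s 1.
  by move=> _ _; have [] := is_derive_G th s x.
have i3 y : 0 <= expR (- (4^-1 * y ^+ 2)) :> R by exact: expR_ge0.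
have i5 s y : `](t - 1), (t + 1)[%classic s -> setT y ->
    `|partial1of2 (G th) s y| <= expR (- (4^-1 * y ^+ 2)).
  by move=> _ _; rewrite partial_G dG_le.
apply: DeriveDef.
  exact: (derivable_under_integral measurableT tI i1 i2 i3 i4 i5).
rewrite -derive1E (differentiation_under_integral measurableT tI i1 i2 i3 i4 i5).
by apply: eq_Rintegral => x _; rewrite partial_G.
Qed.

(** The integrand [dG + t G] is the derivative of [exp(-x^2/2) sin(t x + th)],
    which vanishes at both infinities. *)
Let integral_dG th t : (\int[mu]_x dG th t x)%R = - t * F th t.
Proof.
pose h (x : R) := expR (- (x ^+ 2 / 2)) * sin (t * x + th).
pose h' (x : R) := dG th t x + t * G th t x.
have dh (x : R) : is_derive x (1 : R) h (h' x).
  rewrite /h /h' /G /dG; apply: is_derive_eq.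
  by rewrite /GRing.scale/=; field.
have itG : mu.-integrable setT (EFin \o (fun x => t * G th t x)).
  exact: (integrableZl measurableT t (iG th t)).
have hle (x : R) : 1 <= `|x| -> `|h x| <= `|x|^-1.
  move=> x1; rewrite -[leRHS]div1r ler_pdivlMr ?(lt_le_trans _ x1)//.
  rewrite normrM mulrAC ger0_norm ?expR_ge0// [expR _ * _]mulrC.
  apply: (@le_trans _ _ (expR (- (4^-1 * x ^+ 2)) * 1)).
    apply: ler_pM; rewrite ?mulr_ge0 ?expR_ge0 ?abs_gauss_le//.
    by rewrite ler_norml sin_geN1 sin_le1.
  by rewrite mulr1 -[leRHS]expR0 ler_expR oppr_le0 mulr_ge0 ?sqr_ge0.
have hcvg (u : nat -> R) : (forall n, `|u n| = n%:R) -> h (u n) @[n --> \oo] --> 0.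
  move=> un; rewrite -cvg_shiftS; apply/cvgr0Pnorm_le => e e0.
  near=> n; apply: (le_trans (hle _ _)); rewrite un ?ler1n//.
  by apply: ltW; near: n; exact: near_infty_natSinv_lt (PosNum e0).
have ih : mu.-integrable setT (EFin \o h').
  exact: (integrableD measurableT (idG th t) itG).
have ch' : continuous h'.
  move=> x; apply/differentiable_continuous/derivable1_diffP.
  rewrite /h' /G /dG.
  exact: ex_derive.
have h0 := integral_derive_eq0 dh ch' ih (hcvg _ (fun n => normr_nat _ n))
  (hcvg (fun n => - n%:R) (fun n => etrans (normrN _) (normr_nat _ n))).
have : (\int[mu]_x h' x)%R = 0 by rewrite /Rintegral h0.
rewrite /h' RintegralD// RintegralZl//.
by move/eqP; rewrite addr_eq0 => /eqP ->; rewrite mulNr.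
Unshelve. all: by end_near.
Qed.

(** By the two previous facts [F] solves [F' = - t F], so [exp (t^2/2) F] is
    constant. *)
Let F_E th t : F th t = expR (- (t ^+ 2 / 2)) * F th 0.
Proof.
pose H (s : R) := expR (s ^+ 2 / 2) * F th s.
have dH s : is_derive (s : R) (1 : R) H 0.
  have dF := is_derive_F0 th s.
  rewrite /H; apply: is_derive_eq.
  by rewrite integral_dG /GRing.scale/=; field.
have := @is_derive_0_is_cst _ H t 0 dH.
rewrite /H expr0n/= mul0r expR0 mul1r => <-.
by rewrite mulrA -expRD addNr expR0 mul1r.
Qed.

Lemma Rintegral_gauss_cos (th t : R) :
  (\int[mu]_x (expR (- (x ^+ 2 / 2)) * cos (t * x + th)))%R =
  Num.sqrt (2 * pi) * (expR (- (t ^+ 2 / 2)) * cos th).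
Proof.
have -> : (\int[mu]_x (expR (- (x ^+ 2 / 2)) * cos (t * x + th)))%R = F th t by [].
rewrite F_E mulrCA; congr (_ * _).
transitivity (\int[mu]_x (cos th * expR (- (2^-1 * x ^+ 2))))%R.
  by apply: eq_Rintegral => x _; rewrite /G mul0r add0r mulrC [_ / 2]mulrC.
rewrite RintegralZl//; last by apply: integrable_gauss_line.
by rewrite /Rintegral integral_gauss_line//= invrK [2 * pi]mulrC [cos th * _]mulrC.
Qed.

Lemma integral_gauss_1cos_line (b th t : R) :
  (\int[mu]_x (expR (- (x ^+ 2 / 2)) * (1 + b * cos (t * x + th)))%:E =
  (Num.sqrt (2 * pi) * (1 + b * (expR (- (t ^+ 2 / 2)) * cos th)))%:E)%E.
Proof.
have ib : mu.-integrable setT (fun x => (b * G th t x)%:E).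
  exact: (integrableZl measurableT b (iG th t)).
have -> : (fun x => (expR (- (x ^+ 2 / 2)) * (1 + b * cos (t * x + th)))%:E) =
    (fun x => (G 0 0 x)%:E + (b * G th t x)%:E)%E.
  apply/funext => x; rewrite -EFinD; congr EFin.
  by rewrite /G mul0r add0r cos0; ring.
rewrite integralD//; last exact: iG.
transitivity ((F 0 0)%:E + (b * F th t)%:E)%E.
  congr (_ + _)%E.
    by rewrite /F /Rintegral fineK//; apply: integrable_fin_num => //; exact: iG.
  rewrite /F -RintegralZl//.
  by rewrite /Rintegral fineK//; apply: integrable_fin_num.
rewrite /F !Rintegral_gauss_cos expr0n/= mul0r oppr0 expR0 cos0 -EFinD.
by congr EFin; ring.
Qed.
End gaussian_line.

Section gaussian_euclid.
Context (R : realType).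

Lemma measurable_gauss_1cos D (c b th : R) (t : euclid R D) :
  measurable_fun setT (fun x : euclid R D =>
    (expR (- (c * dot x x / 2)) * (1 + b * cos (dot t x + th)))%:E).
Proof.
apply/measurable_EFinP; apply: measurable_funM.
  apply: measurableT_comp => //; apply: measurableT_comp => //.
  apply: measurable_funM => //; apply: measurable_funM => //.
  exact: measurable_dot.
apply: measurable_funD => //; apply: measurable_funM => //.
apply: measurable_cos_comp.
by apply: measurable_funD => //; exact: measurable_dot.
Qed.

Lemma one_cos_ge0 (b u : R) : 0 <= b <= 1 -> 0 <= 1 + b * cos u.
Proof.
move=> /andP[b0 b1]; have := cos_geN1 u => c.
have : b * cos u >= - b by rewrite -mulrN1 ler_wpM2l.
by lra.
Qed.

(** Fourier transform of the Gaussian. The constant [1] keeps the integrand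
    nonnegative, and [b] carries the contribution of the coordinates that are
    already integrated in the induction on the dimension. *)
Let gauss1 D (b th : R) (t : euclid R D) : 0 <= b <= 1 ->
  (\int[lebesgue R D]_x
     (expR (- (1 * dot x x / 2)) * (1 + b * cos (dot t x + th)))%:E =
  (Num.sqrt (2 * pi) ^+ D * (1 + b * (expR (- (dot t t / 2)) * cos th)))%:E)%E.
Proof.
elim: D b th t => [|D IH] b th t b01.
  rewrite ge0_integral_nil; last exact: measurable_gauss_1cos.
  by rewrite /dot !big_ord0 mulr0 mul0r oppr0 expR0 add0r expr0 !mul1r.
have [t0 [t' ->]] := tcons_surj t.
rewrite ge0_integral_cons; last 2 first.
- exact: measurable_gauss_1cos.
- by move=> x; rewrite lee_fin mulr_ge0 ?expR_ge0// one_cos_ge0.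
transitivity (\int[lebesgue_measure]_x ((Num.sqrt (2 * pi) ^+ D)%:E *
   (expR (- (x ^+ 2 / 2)) *
     (1 + (b * expR (- (dot t' t' / 2))) * cos (t0 * x + th)))%:E))%E.
  apply: eq_integral => x _.
  transitivity (\int[lebesgue R D]_v ((expR (- (x ^+ 2 / 2)))%:E *
    (expR (- (1 * dot v v / 2)) * (1 + b * cos (dot t' v + (t0 * x + th))))%:E))%E.
    apply: eq_integral => v _; rewrite !dot_tcons -EFinM; congr EFin.
    rewrite mulrA -expRD; congr (expR _ * (1 + b * cos _)); last by ring.
    by field.
  rewrite ge0_integralZl//; last 2 first.
  - exact: measurable_gauss_1cos.
  - by move=> v _; rewrite lee_fin mulr_ge0 ?expR_ge0// one_cos_ge0.
  by rewrite IH// -!EFinM; congr EFin; ring.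
have b01' : 0 <= b * expR (- (dot t' t' / 2)) <= 1.
  case/andP: b01 => b0 b1; rewrite mulr_ge0 ?expR_ge0//= mulr_ile1 ?expR_ge0//.
  by rewrite -[leRHS]expR0 ler_expR oppr_le0 divr_ge0// dotxx_ge0.
rewrite ge0_integralZl//; last 2 first.
- apply/measurable_EFinP; apply: measurable_funM.
    apply: measurable_expR_comp; apply: measurable_opp_comp.
    by apply: measurable_funM => //; exact: measurable_funX.
  apply: measurable_funD => //; apply: measurable_funM => //.
  apply: measurable_cos_comp.
  by apply: measurable_funD => //; exact: measurable_funM.
- by move=> x _; rewrite lee_fin mulr_ge0 ?expR_ge0// one_cos_ge0.
rewrite integral_gauss_1cos_line -EFinM dot_tcons; congr EFin.
have -> : expR (- ((t0 * t0 + dot t' t') / 2)) =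
   expR (- (t0 ^+ 2 / 2)) * expR (- (dot t' t' / 2)).
  by rewrite -expRD; congr expR; field.
by rewrite (exprSr _ D); ring.
Qed.

Lemma integral_gauss_1cos D (c b th : R) (t : euclid R D) : 0 < c -> 0 <= b <= 1 ->
  (\int[lebesgue R D]_x
     (expR (- (c * dot x x / 2)) * (1 + b * cos (dot t x + th)))%:E =
  (Num.sqrt (2 * pi / c) ^+ D *
    (1 + b * (expR (- (dot t t / (2 * c))) * cos th)))%:E)%E.
Proof.
move=> c0 b01; pose r := Num.sqrt c.
have r0 : r != 0 by rewrite gt_eqF ?sqrtr_gt0.
have r2 : r ^+ 2 = c by rewrite sqr_sqrtr ?ltW.
pose z : euclid R D := escale 0 t.
have E x : eaffine r z x = escale r x.
  by apply: euclidP => i; rewrite coord_eaffine !coord_escale mul0r addr0.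
pose f (x : euclid R D) := (expR (- (1 * dot x x / 2)) *
  (1 + b * cos (dot (escale r^-1 t) x + th)))%:E.
transitivity (\int[lebesgue R D]_x f (eaffine r z x))%E.
  apply: eq_integral => x _ /=; rewrite /f E dot_escale r2 mul1r.
  by rewrite dotZr dotZl mulrA divff// mul1r.
rewrite ge0_integral_eaffine//; last 2 first.
- exact: measurable_gauss_1cos.
- by move=> x; rewrite lee_fin mulr_ge0 ?expR_ge0// one_cos_ge0.
rewrite /f gauss1// -EFinM; congr EFin; rewrite [LHS]mulrA -exprMn; congr (_ ^+ D * _).
  by rewrite ger0_norm ?sqrtr_ge0// mulrC -sqrtrV ?ltW// -sqrtrM// mulr_ge0 ?pi_ge0.
congr (1 + b * (expR _ * _)).
by rewrite dot_escale exprVn r2; field; rewrite gt_eqF.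
Qed.

Lemma integral_gauss D (c : R) : 0 < c ->
  (\int[lebesgue R D]_x (expR (- (c * dot x x / 2)))%:E =
  (Num.sqrt (2 * pi / c) ^+ D)%:E)%E.
Proof.
move=> c0; have := @integral_gauss_1cos D c 0 0 [tuple 0 | i < D] c0.
rewrite lexx ler01 !mul0r addr0 mulr1 => /(_ isT) <-.
by apply: eq_integral => x _; rewrite mul0r addr0 mulr1.
Qed.

End gaussian_euclid.

(** * Convolutions of nonnegative functions *)

Section convolution_theory.
Context (R : realType) (D : nat).
Local Notation E := (euclid R D).
Local Notation mu := (lebesgue R D).
Local Open Scope ereal_scope.
Implicit Types f h t : E -> \bar R.

Definition eadd (x y : E) : E := [tuple (coord x i + coord y i)%R | i < D].

Lemma coord_eadd (x y : E) i : coord (eadd x y) i = (coord x i + coord y i)%R.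
Proof. by rewrite /coord tnth_mktuple. Qed.

Lemma dotDr (z x y : E) : dot z (eadd x y) = (dot z x + dot z y)%R.
Proof. by rewrite /dot -big_split; apply: eq_bigr => i _; rewrite coord_eadd mulrDr. Qed.

Lemma esubK (x y : E) : eadd (esub x y) y = x.
Proof. by apply: euclidP => i; rewrite coord_eadd coord_esub subrK. Qed.

Lemma measurable_eadd d (T : measurableType d) (a b : T -> E) :
  measurable_fun setT a -> measurable_fun setT b ->
  measurable_fun setT (fun s => eadd (a s) (b s)).
Proof.
move=> mf mg; apply: measurable_euclid => i; under eq_fun do rewrite coord_eadd.
by apply: measurable_funD; exact: measurable_coord.
Qed.

Lemma measurable_esub_pair : measurable_fun setT (fun p : E * E => esub p.1 p.2).
Proof. by apply: measurable_esub. Qed.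

Lemma measurable_convolution_integrand f h :
  measurable_fun setT f -> measurable_fun setT h ->
  measurable_fun setT (fun p : E * E => f (esub p.1 p.2) * h p.2).
Proof.
move=> mf mh; apply: emeasurable_funM.
  exact: (measurableT_comp mf measurable_esub_pair).
exact: (measurableT_comp mh).
Qed.

Lemma measurable_convolution_section f h x :
  measurable_fun setT f -> measurable_fun setT h ->
  measurable_fun setT (fun y => f (esub x y) * h y).
Proof.
move=> mf mh; apply: emeasurable_funM => //.
by apply: (measurableT_comp mf); exact: measurable_esub.
Qed.

Lemma convolution_ge0 f h : (forall x, 0 <= f x) -> (forall x, 0 <= h x) ->
  forall x, 0 <= convolution f h x.
Proof. by move=> f0 h0 x; apply: integral_ge0 => y _; rewrite mule_ge0. Qed.

Lemma measurable_convolution f h : measurable_fun setT f -> (forall x, 0 <= f x) ->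
  measurable_fun setT h -> (forall x, 0 <= h x) ->
  measurable_fun setT (convolution f h).
Proof.
move=> mf f0 mh h0.
apply: (@measurable_fun_fubini_tonelli_F _ _ _ _ R mu
  (fun p : E * E => f (esub p.1 p.2) * h p.2)).
  exact: measurable_convolution_integrand.
by move=> p; rewrite mule_ge0.
Qed.

(** Testing a convolution against [t] amounts to testing the law of a sum of
    independent vectors. *)
Lemma integral_convolution f h t : measurable_fun setT f -> (forall x, 0 <= f x) ->
  measurable_fun setT h -> (forall x, 0 <= h x) ->
  measurable_fun setT t -> (forall x, 0 <= t x) ->
  \int[mu]_x (convolution f h x * t x) =
  \int[mu]_y (h y * \int[mu]_u (f u * t (eadd u y))).
Proof.
move=> mf f0 mh h0 mt t0.
transitivity (\int[mu]_x \int[mu]_y (f (esub x y) * h y * t x)).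
  apply: eq_integral => x _; rewrite -ge0_integralZr//.
  - exact: measurable_convolution_section.
  - by move=> y _; rewrite mule_ge0.
rewrite (fubini_tonelli (fun p : E * E => f (esub p.1 p.2) * h p.2 * t p.1))//=; last 2 first.
- apply: emeasurable_funM; first exact: measurable_convolution_integrand.
  exact: (measurableT_comp mt).
- by move=> p; rewrite !mule_ge0.
apply: eq_integral => y _.
have mft : measurable_fun setT (fun u => f u * t (eadd u y)).
  apply: emeasurable_funM => //; apply: (measurableT_comp mt).
  exact: measurable_eadd.
rewrite -[in RHS](ge0_integral_esubl y)//; last by move=> u; rewrite mule_ge0.
rewrite -ge0_integralZl//.
- by apply: eq_integral => x _; rewrite esubK muleA [h y * _]muleC.
- by apply: (measurableT_comp mft); exact: measurable_esub.
- by move=> x _; rewrite mule_ge0.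
Qed.

Lemma integral_convolution1 f h : measurable_fun setT f -> (forall x, 0 <= f x) ->
  measurable_fun setT h -> (forall x, 0 <= h x) ->
  \int[mu]_x convolution f h x = \int[mu]_x h x * \int[mu]_x f x.
Proof.
move=> mf f0 mh h0.
have := integral_convolution mf f0 mh h0 (measurable_cst (1 : \bar R)) (fun=> lee01).
under eq_integral do rewrite mule1.
move=> ->; rewrite -ge0_integralZr//; last by apply: integral_ge0.
by apply: eq_integral => y _; congr (_ * _); apply: eq_integral => u _; rewrite mule1.
Qed.

Lemma eq_convolution f f' h h' x :
  measurable_fun setT f -> measurable_fun setT f' ->
  measurable_fun setT h -> measurable_fun setT h' ->
  {ae mu, forall x, f x = f' x} -> {ae mu, forall x, h x = h' x} ->
  convolution f h x = convolution f' h' x.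
Proof.
move=> mf mf' mh mh' /(ae_esub x (P := fun y => f y = f' y)) ff' hh'.
apply: ae_eq_integral => //.
- exact: measurable_convolution_section.
- exact: measurable_convolution_section.
- by move: ff' hh'; apply: filterS2 => y ff' hh' _; rewrite ff' hh'.
Qed.

(** Convolutions of possibly different functions: the bound on convolution
    powers compares [k+1] factors [g] with products in which one factor [g]
    becomes the constant [1] and the others become [u]. *)
Fixpoint convolutions (f : nat -> E -> R) (n : nat) : E -> \bar R :=
  match n with
  | 0 => EFin \o f 0%N
  | m.+1 => convolution (EFin \o f 0%N) (convolutions (fun i => f i.+1) m)
  end.

Lemma convolutionsE (g : E -> R) n :
  convolutions (fun=> g) n = convolution_power g n.+1.
Proof. by elim: n => //= n ->. Qed.

Lemma convolutions_ge0 (f : nat -> E -> R) n : (forall i x, 0 <= f i x)%R ->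
  forall x, 0 <= convolutions f n x.
Proof.
elim: n f => [|n IH] f f0 x /=; first by rewrite lee_fin.
by apply: convolution_ge0 => [y|]; [rewrite lee_fin|exact: IH].
Qed.

Lemma measurable_convolutions (f : nat -> E -> R) n : (forall i x, 0 <= f i x)%R ->
  (forall i, measurable_fun setT (f i)) -> measurable_fun setT (convolutions f n).
Proof.
elim: n f => [|n IH] f f0 mf /=; first exact/measurable_EFinP.
apply: measurable_convolution => //.
- exact/measurable_EFinP.
- by move=> x; rewrite lee_fin.
- exact: IH.
- exact: convolutions_ge0.
Qed.

(** A pointwise inequality between sums of products of functions of separate
    points is inherited by the corresponding convolutions. *)
Lemma le_convolutions n m (a : R) (f : nat -> E -> R) (w : 'I_m -> R)
    (h : 'I_m -> nat -> E -> R) :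
  (0 <= a)%R -> (forall i, 0 <= w i)%R ->
  (forall l x, 0 <= f l x)%R -> (forall l, measurable_fun setT (f l)) ->
  (forall i l x, 0 <= h i l x)%R -> (forall i l, measurable_fun setT (h i l)) ->
  (forall z : nat -> E, a * \prod_(l < n.+1) f l (z l) <=
     \sum_(i < m) w i * \prod_(l < n.+1) h i l (z l))%R ->
  forall x, a%:E * convolutions f n x <=
    \sum_(i < m) (w i)%:E * convolutions (h i) n x.
Proof.
elim: n a f w h => [|n IH] a f w h a0 w0 f0 mf h0 mh fh x /=.
  have := fh (fun=> x); rewrite big_ord_recl big_ord0 mulr1 => afh.
  rewrite -EFinM; under eq_bigr do rewrite -EFinM.
  rewrite sumEFin lee_fin (le_trans afh)//; apply: ler_sum => i _.
  by rewrite big_ord_recl big_ord0 mulr1.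
have mconv (k : nat -> E -> R) : (forall i x, 0 <= k i x)%R ->
    (forall i, measurable_fun setT (k i)) ->
    measurable_fun setT (fun y => (k 0%N (esub x y))%:E *
      convolutions (fun i => k i.+1) n y).
  move=> k0 mk; apply: (measurable_convolution_section (f := EFin \o k 0%N)).
    exact/measurable_EFinP.
  exact: measurable_convolutions.
have conv0 (k : nat -> E -> R) y : (forall i x, 0 <= k i x)%R ->
    0 <= (k 0%N (esub x y))%:E * convolutions (fun i => k i.+1) n y.
  by move=> k0; rewrite mule_ge0 ?lee_fin// convolutions_ge0.
rewrite /convolution -ge0_integralZl//; last 2 first.
- exact: mconv.
- by move=> y _; exact: conv0.
rewrite (eq_bigr (fun i => \int[mu]_y ((w i)%:E * ((h i 0%N (esub x y))%:E *
    convolutions (fun l => h i l.+1) n y)))); last first.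
  move=> i _; rewrite -ge0_integralZl ?lee_fin//; first exact: mconv.
  by move=> y _; exact: conv0.
rewrite -ge0_integral_sum//; last 2 first.
- by move=> i; apply: measurable_funeM; exact: mconv.
- by move=> i y _; rewrite mule_ge0 ?lee_fin//; exact: conv0.
apply: ge0_le_integral => //.
- by move=> y _; rewrite mule_ge0 ?lee_fin//; exact: conv0.
- by apply: measurable_funeM; exact: mconv.
- by apply: emeasurable_sum => i; apply: measurable_funeM; exact: mconv.
move=> y _.
have := IH (a * f 0%N (esub x y))%R (fun l => f l.+1)
  (fun i => w i * h i 0%N (esub x y))%R (fun i l => h i l.+1).
rewrite EFinM => H; rewrite muleA.
apply: le_trans (H _ _ _ _ _ _ _ y) _ => //.
- by rewrite mulr_ge0.
- by move=> i; rewrite mulr_ge0.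
- move=> z; have := fh (fun l => if l is l'.+1 then z l' else esub x y).
  rewrite big_ord_recl /= mulrA => /le_trans; apply.
  by apply: ler_sum => i _; rewrite big_ord_recl /= mulrA.
by apply: lee_sum => i _; rewrite EFinM muleA.
Qed.

Lemma integral_convolutions (u : E -> R) (S : R) n :
  (forall x, 0 <= u x)%R -> measurable_fun setT u ->
  \int[mu]_x (u x)%:E = S%:E ->
  \int[mu]_x convolutions (fun=> u) n x = (S ^+ n.+1)%:E.
Proof.
move=> u0 mu_ uS; elim: n => [|n IH]; first by rewrite expr1.
rewrite [LHS]integral_convolution1//.
- by rewrite uS IH (exprSr _ n.+1) EFinM.
- exact/measurable_EFinP.
- exact: measurable_convolutions.
- exact: convolutions_ge0.
Qed.

(** Replacing one factor by [1] decouples the base point [x]: the convolution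
    becomes the product of the masses of the remaining factors. *)
Lemma convolutions_skip (u : E -> R) (S : R) n i :
  (forall x, 0 <= u x)%R -> measurable_fun setT u ->
  \int[mu]_x (u x)%:E = S%:E -> (i <= n)%N ->
  forall x, convolutions (fun l => if l == i then (fun=> 1%R) else u) n x = (S ^+ n)%:E.
Proof.
move=> u0 mu_ uS; elim: n i => [|n IH] [|i] //= in_ x.
  rewrite /convolution; under eq_integral do rewrite mul1e.
  exact: integral_convolutions.
rewrite /convolution.
under eq_integral => y _.
  rewrite (_ : (fun l => _) = (fun l => if l == i then (fun=> 1%R) else u))//.
  rewrite IH//; over.
have S0 : (0 <= S)%R.
  by rewrite -lee_fin -uS; apply: integral_ge0 => y _; rewrite lee_fin.
have mEu : measurable_fun setT (EFin \o u) by exact/measurable_EFinP.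
rewrite ge0_integralZr ?lee_fin ?exprn_ge0//; last 2 first.
- by apply: (measurableT_comp mEu); exact: measurable_esub.
- by move=> y _; rewrite lee_fin.
by rewrite (ge0_integral_esub x mEu) ?uS ?exprS ?EFinM// => y; rewrite lee_fin.
Qed.

(** AM-GM: the product of [k.+1] values of [g] is the geometric mean of the
    [k.+1] products of [k] values of [u]. *)
Lemma prod_le_skip k (g u : E -> R) (z : nat -> E) :
  (forall x, 0 <= g x)%R -> (forall x, 0 <= u x)%R ->
  (forall x, u x ^+ k = g x ^+ k.+1)%R ->
  (\prod_(l < k.+1) g (z l) <= \sum_(i < k.+1) k.+1%:R^-1 *
    \prod_(l < k.+1) (if l == i :> nat then (fun=> 1) else u) (z l))%R.
Proof.
move=> g0 u0 ug.
pose P (i : 'I_k.+1) : R := (\prod_(l < k.+1) (if l == i :> nat then (fun=> 1) else u) (z l))%R.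
have P0 i : (0 <= P i)%R by apply: prodr_ge0 => l _; case: ifP.
rewrite -/(P _).
have [+ _] := @leif_AGM _ _ 'I_k.+1 P (fun i _ => P0 i).
rewrite card_ord -mulr_sumr => AGM.
have prod0 : (0 <= \prod_(l < k.+1) g (z l))%R by apply: prodr_ge0.
rewrite -(ler_pXn2r (ltn0Sn k)) ?nnegrE//; last first.
  by apply: mulr_ge0; [rewrite invr_ge0 | apply: sumr_ge0 => i _; exact: P0].
rewrite [X in (_ <= X ^+ _)%R]mulrC; apply: le_trans AGM.
rewrite /P exchange_big/= -prodrXl le_eqVlt; apply/orP; left; apply/eqP.
apply: eq_bigr => l _; rewrite -ug (bigD1 l)//= eqxx mul1r.
rewrite (eq_bigr (fun=> u (z l))); last first.
  by move=> i; rewrite -val_eqE eq_sym => /negbTE ->.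
by rewrite prodr_const; congr (_ ^+ _)%R; rewrite cardC1 card_ord.
Qed.

(** Raising the integrability exponent of [g] slightly above [1] makes a
    sufficiently high convolution power bounded everywhere. *)
Lemma convolution_power_le k (g u : E -> R) (S : R) :
  (forall x, 0 <= g x)%R -> measurable_fun setT g ->
  (forall x, 0 <= u x)%R -> measurable_fun setT u ->
  (forall x, u x ^+ k = g x ^+ k.+1)%R ->
  \int[mu]_x (u x)%:E = S%:E ->
  forall x, convolution_power g k.+1 x <= (S ^+ k)%:E.
Proof.
move=> g0 mg u0 mu_ ug uS x.
have := @le_convolutions k k.+1 1 (fun=> g) (fun=> k.+1%:R^-1)%R
  (fun i l => if l == i :> nat then (fun=> 1) else u)%R ler01.
move=> /(_ _ _ _ _ _ _ x); rewrite mul1e convolutionsE => H.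
apply: le_trans (H _ _ _ _ _ _) _ => //.
- by move=> i l y; case: ifP.
- by move=> i l; case: ifP.
- by move=> z; rewrite mul1r; exact: prod_le_skip.
rewrite (eq_bigr (fun=> (k.+1%:R^-1 * S ^+ k)%:E)); last first.
  by move=> i _; rewrite (convolutions_skip u0 mu_ uS)// -ltnS.
by rewrite sumEFin sumr_const card_ord lee_fin -mulrnAl -[(_^-1 *+ _)%R]mulr_natr mulVf ?mul1r.
Qed.

End convolution_theory.

(** * Boxes in Euclidean space *)

Section boxes.
Context (R : realType) (D : nat).
Local Notation E := (euclid R D).
Local Notation mu := (lebesgue R D).

Definition box (a b : E) : set E :=
  [set x | forall i, coord a i < coord x i < coord b i].

Definition boxes : set (set E) := [set B | exists a b, B = box a b].

Lemma measurable_box a b : measurable (box a b).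
Proof.
rewrite (_ : box a b = \bigcap_(i in [set: 'I_D])
    ((fun x : E => coord x i) @^-1` `](coord a i), (coord b i)[)); last first.
  apply/seteqP; split => x /= h i; first by move=> _ /=; rewrite in_itv/=; exact: h.
  by have := h i I; rewrite /= in_itv.
apply: fin_bigcap_measurable => [|i _]; first exact: finite_finset.
rewrite -[X in measurable X]setTI.
have mi : measurable_fun setT (fun x : E => coord x i) by exact: (@measurable_coord _ _ R D id).
by apply: mi => //; exact: measurable_itv.
Qed.

Lemma box_setI_closed : setI_closed boxes.
Proof.
move=> _ _ [a [b ->]] [c [e ->]].
exists [tuple Num.max (coord a i) (coord c i) | i < D],
  [tuple Num.min (coord b i) (coord e i) | i < D].
apply/seteqP; split => x /=.
  move=> [ab ce] i; rewrite !coord_tuple gt_max lt_min.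
  by have /andP[-> ->] := ab i; have /andP[-> ->] := ce i.
move=> h; split => i; have := h i; rewrite !coord_tuple gt_max lt_min;
  by move=> /andP[/andP[h1 h2] /andP[h3 h4]]; rewrite ?h1 ?h2 ?h3 ?h4.
Qed.

Lemma measurable_boxesE : @measurable _ E = <<s boxes >>.
Proof.
apply/seteqP; split; last first.
  apply: smallest_sub; first exact: sigma_algebra_measurable.
  by move=> _ [a [b ->]]; exact: measurable_box.
pose T := g_sigma_algebraType boxes.
suff mid : measurable_fun [set: T] (fun x : T => (x : E)).
  by move=> A mA; have := mid measurableT A mA; rewrite setTI.
apply: measurable_euclid => i.
apply: (measurability _ (RGenOInfty.measurableE R)) => //.
move=> /= _ [_ [c ->] <-]; rewrite setTI.
pose a (n : nat) : E := [tuple if j == i then c else - n%:R | j < D].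
pose b (n : nat) : E := [tuple n%:R | j < D].
rewrite (_ : _ @^-1` _ = \bigcup_n (box (a n) (b n))); last first.
  apply/seteqP; split => x /=.
    rewrite in_itv/= andbT => cx.
    exists (Num.trunc (enorm x)).+1 => // j.
    have xj : `|coord x j| < (Num.trunc (enorm x)).+1%:R.
      exact: le_lt_trans (abs_coord_le x j) (truncnS_gt _).
    move: xj; rewrite ltr_norml => /andP[xj1 xj2].
    rewrite !coord_tuple xj2 andbT.
    by case: eqVneq => [->|].
  move=> [n _ /(_ i)/andP[+ _]]; rewrite in_itv/= andbT.
  by rewrite coord_tuple eqxx.
apply: bigcupT_measurable => n; apply: sub_sigma_algebra.
by exists (a n), (b n).
Qed.

Lemma lebesgue_box_lty a b : (mu (box a b) < +oo)%E.
Proof.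
have mi i : measurable `](coord a i : measurableTypeR R), (coord b i)[%classic by [].
have := measure_power_box (@lebesgue_measure R) mi.
rewrite (_ : [set x | _] = box a b); last first.
  by apply/seteqP; split => x /= h i; have := h i; rewrite in_itv.
rewrite /lebesgue => ->; rewrite ltey_eq; apply/orP; left.
elim/big_ind : _ => // [x y|i _]; first exact: fin_numM.
suff : lebesgue_measure `](coord a i), (coord b i)[%classic \is a fin_num by [].
by rewrite lebesgue_measure_itv/=; case: ifP.
Qed.

End boxes.

(** * Double integrals *)

Section double_integrals.
Context (R : realType) (D : nat).
Local Notation E := (euclid R D).
Local Notation mu := (lebesgue R D).
Local Open Scope ereal_scope.
Implicit Types f h : E * E -> R.

Lemma measurable_EFin_section f z : measurable_fun setT f ->
  measurable_fun setT (fun u => (f (z, u))%:E).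
Proof.
move=> mf; apply/measurable_EFinP; apply: (measurableT_comp mf).
exact: measurable_pair1.
Qed.

Lemma measurable_EFin_integral f : measurable_fun setT f ->
  (forall p, 0 <= f p)%R ->
  measurable_fun setT (fun z => \int[mu]_u (f (z, u))%:E).
Proof.
move=> mf f0; apply: (@measurable_fun_fubini_tonelli_F _ _ _ _ R mu (fun p => (f p)%:E)).
  exact/measurable_EFinP.
by move=> p; rewrite lee_fin.
Qed.

Lemma EFin_tonelli f : measurable_fun setT f -> (forall p, 0 <= f p)%R ->
  \int[mu]_z \int[mu]_u (f (z, u))%:E = \int[mu]_u \int[mu]_z (f (z, u))%:E.
Proof.
move=> mf f0; apply: (@fubini_tonelli _ _ _ _ R mu mu (fun p => (f p)%:E)).
  exact/measurable_EFinP.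
by move=> p; rewrite lee_fin.
Qed.

Lemma le_double_integral f h : measurable_fun setT f -> measurable_fun setT h ->
  (forall p, 0 <= f p)%R -> (forall p, f p <= h p)%R ->
  \int[mu]_z \int[mu]_u (f (z, u))%:E <= \int[mu]_z \int[mu]_u (h (z, u))%:E.
Proof.
move=> mf mh f0 fh; have h0 p : (0 <= h p)%R by exact: le_trans (fh p).
apply: ge0_le_integral => //.
- by move=> z _; apply: integral_ge0 => u _; rewrite lee_fin.
- exact: measurable_EFin_integral.
- exact: measurable_EFin_integral.
- move=> z _; apply: ge0_le_integral => //.
  + by move=> u _; rewrite lee_fin.
  + exact: measurable_EFin_section.
  + exact: measurable_EFin_section.
  + by move=> u _; rewrite lee_fin.
Qed.

Lemma double_integralD f h : measurable_fun setT f -> measurable_fun setT h ->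
  (forall p, 0 <= f p)%R -> (forall p, 0 <= h p)%R ->
  \int[mu]_z \int[mu]_u (f (z, u) + h (z, u))%:E =
  \int[mu]_z \int[mu]_u (f (z, u))%:E + \int[mu]_z \int[mu]_u (h (z, u))%:E.
Proof.
move=> mf mh f0 h0; rewrite -ge0_integralD//.
- apply: eq_integral => z _; under eq_integral do rewrite EFinD.
  rewrite ge0_integralD//.
  + by move=> u _; rewrite lee_fin.
  + exact: measurable_EFin_section.
  + by move=> u _; rewrite lee_fin.
  + exact: measurable_EFin_section.
- by move=> z _; apply: integral_ge0 => u _; rewrite lee_fin.
- exact: measurable_EFin_integral.
- by move=> z _; apply: integral_ge0 => u _; rewrite lee_fin.
- exact: measurable_EFin_integral.
Qed.

Lemma double_integralZl (c : R) f : measurable_fun setT f ->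
  (forall p, 0 <= f p)%R -> (0 <= c)%R ->
  \int[mu]_z \int[mu]_u (c * f (z, u))%:E =
  c%:E * \int[mu]_z \int[mu]_u (f (z, u))%:E.
Proof.
move=> mf f0 c0; rewrite -ge0_integralZl//.
- apply: eq_integral => z _; under eq_integral do rewrite EFinM.
  rewrite ge0_integralZl//; first exact: measurable_EFin_section.
  by move=> u _; rewrite lee_fin.
- exact: measurable_EFin_integral.
- by move=> z _; apply: integral_ge0 => u _; rewrite lee_fin.
Qed.

Lemma EFin_integralZl (c : R) (f : E -> R) : measurable_fun setT f ->
  (forall x, 0 <= f x)%R -> (0 <= c)%R ->
  \int[mu]_x (c * f x)%:E = c%:E * \int[mu]_x (f x)%:E.
Proof.
move=> mf f0 c0; under eq_integral do rewrite EFinM.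
rewrite ge0_integralZl//; first exact/measurable_EFinP.
by move=> x _; rewrite lee_fin.
Qed.

Lemma EFin_integralD (f h : E -> R) : measurable_fun setT f ->
  measurable_fun setT h -> (forall x, 0 <= f x)%R -> (forall x, 0 <= h x)%R ->
  \int[mu]_x (f x + h x)%:E = \int[mu]_x (f x)%:E + \int[mu]_x (h x)%:E.
Proof.
move=> mf mh f0 h0; under eq_integral do rewrite EFinD.
rewrite ge0_integralD//.
- by move=> x _; rewrite lee_fin.
- exact/measurable_EFinP.
- by move=> x _; rewrite lee_fin.
- exact/measurable_EFinP.
Qed.

Lemma EFin_le_integral (f h : E -> R) : measurable_fun setT f ->
  measurable_fun setT h -> (forall x, 0 <= f x)%R -> (forall x, f x <= h x)%R ->
  \int[mu]_x (f x)%:E <= \int[mu]_x (h x)%:E.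
Proof.
move=> mf mh f0 fh; apply: ge0_le_integral => //.
- by move=> x _; rewrite lee_fin.
- exact/measurable_EFinP.
- exact/measurable_EFinP.
- by move=> x _; rewrite lee_fin.
Qed.

End double_integrals.

(** * Gaussian shifts of bounded sets *)

Section vanishing_sequences.
Context (R : realType).
Local Open Scope ereal_scope.

(** Convergence to [0] of nonnegative extended reals, through upper bounds only,
    so that it passes to smaller sequences. *)
Definition vanishing (u : nat -> \bar R) :=
  forall e : R, (0 < e)%R -> \forall n \near \oo, u n <= e%:E.

Lemma le_vanishing (u v : nat -> \bar R) : (forall n, u n <= v n) ->
  vanishing v -> vanishing u.
Proof.
move=> uv v0 e /v0; apply: filterS => n; exact: le_trans.
Qed.

Lemma vanishingD (u v : nat -> \bar R) :
  vanishing u -> vanishing v -> vanishing (fun n => u n + v n).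
Proof.
move=> u0 v0 e e0; have e2 : (0 < e / 2)%R by rewrite divr_gt0.
move: (u0 _ e2) (v0 _ e2); apply: filterS2 => n un vn.
by rewrite (splitr e) EFinD leeD.
Qed.

Lemma cvg_vanishing (u : nat -> \bar R) :
  u @ \oo --> (0 : \bar R) -> vanishing u.
Proof.
move=> /fine_cvgP[fu cu] e e0.
move/cvgr0Pnorm_le : cu => /(_ _ e0).
move: fu; apply: filterS2 => n fn /=.
by move=> /(le_trans (ler_norm _)) ule; rewrite -(fineK fn) lee_fin.
Qed.

End vanishing_sequences.

Section gaussian_shifts.
Context (R : realType) (D : nat).
Local Notation E := (euclid R D).
Local Notation mu := (lebesgue R D).
Implicit Types (A B Q : set E).

(** The Gaussian weight is left unnormalized; its mass is [bell_mass]. *)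
Definition bell (z : E) : R := expR (- (dot z z / 2)).

Definition bell_mass : R := Num.sqrt (2 * pi) ^+ D.

Lemma bell_ge0 z : 0 <= bell z. Proof. exact: expR_ge0. Qed.

Lemma bell_mass_gt0 : 0 < bell_mass.
Proof. by rewrite exprn_gt0// sqrtr_gt0 mulr_gt0// pi_gt0. Qed.

Lemma measurable_bell : measurable_fun setT bell.
Proof.
apply: measurable_expR_comp; apply: measurable_opp_comp.
by apply: measurable_funM => //; exact: measurable_dot.
Qed.

Lemma integral_bell : (\int[mu]_z (bell z)%:E = bell_mass%:E)%E.
Proof.
have := @integral_gauss R D 1 ltr01; rewrite divr1 => <-.
by apply: eq_integral => z _; rewrite mul1r.
Qed.

Definition osc B (x y : E) : R := `|\1_B x - \1_B y|.

Lemma osc_ge0 B x y : 0 <= osc B x y. Proof. exact: normr_ge0. Qed.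

(** [L^1] distance between the indicator function of [B] and its shifts by
    [e z], averaged over a Gaussian vector [z]. *)
Definition shift_osc (e : R) B : \bar R :=
  (\int[mu]_z \int[mu]_u (bell z * osc B (esub u (escale e z)) u)%:E)%E.

Let measurable_shift (e : R) :
  measurable_fun setT (fun p : E * E => esub p.2 (escale e p.1)).
Proof. by apply: measurable_esub => //; exact: measurable_escale. Qed.

Let measurable_indic_shift (e : R) B : measurable B ->
  measurable_fun setT (fun p : E * E => \1_B (esub p.2 (escale e p.1)) : R).
Proof. by move=> mB; exact: (measurableT_comp (measurable_indic mB) (measurable_shift e)). Qed.

Let measurable_bell1 : measurable_fun setT (fun p : E * E => bell p.1).
Proof. exact: (measurableT_comp measurable_bell). Qed.

Let measurable_indic2 B : measurable B ->
  measurable_fun setT (fun p : E * E => \1_B p.2 : R).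
Proof. by move=> mB; exact: (measurableT_comp (measurable_indic mB)). Qed.

Lemma measurable_osc (e : R) B : measurable B -> measurable_fun setT
  (fun p : E * E => bell p.1 * osc B (esub p.2 (escale e p.1)) p.2).
Proof.
move=> mB; apply: measurable_funM => //.
apply: (measurableT_comp (f := @Num.norm R R)) => //.
by apply: measurable_funB; [exact: measurable_indic_shift|exact: measurable_indic2].
Qed.

Let bell_osc_ge0 (e : R) B (p : E * E) :
  0 <= bell p.1 * osc B (esub p.2 (escale e p.1)) p.2.
Proof. by apply: mulr_ge0; [exact: bell_ge0|exact: osc_ge0]. Qed.

Local Open Scope ereal_scope.

Lemma shift_osc_le2 (e : R) B B1 B2 :
  measurable B -> measurable B1 -> measurable B2 ->
  (forall x y, osc B x y <= osc B1 x y + osc B2 x y)%R ->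
  shift_osc e B <= shift_osc e B1 + shift_osc e B2.
Proof.
move=> mB mB1 mB2 h.
have m1 := measurable_osc e mB1; have m2 := measurable_osc e mB2.
rewrite /shift_osc -(double_integralD m1 m2)//.
apply: (le_double_integral (measurable_osc e mB)
  (measurable_funD m1 m2) (bell_osc_ge0 e B)).
by move=> p; rewrite /= -mulrDr ler_wpM2l ?bell_ge0.
Qed.

Lemma integral_indic_esub B (v : E) : measurable B ->
  \int[mu]_u (\1_B (esub u v))%:E = mu B.
Proof.
move=> mB; have mi : measurable_fun setT (fun u => (\1_B u)%:E : \bar R).
  exact/measurable_EFinP.
rewrite (@ge0_integral_esubl _ _ v (fun u => (\1_B u)%:E))//.
by rewrite integral_indic// setIT.
Qed.

Lemma integral_bell_shift (e : R) B : measurable B ->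
  \int[mu]_z \int[mu]_u (bell z * \1_B (esub u (escale e z)))%:E =
  bell_mass%:E * mu B.
Proof.
move=> mB; rewrite -integral_bell -ge0_integralZr//; last 2 first.
- by apply/measurable_EFinP; exact: measurable_bell.
- by move=> z _; rewrite lee_fin bell_ge0.
apply: eq_integral => z _; rewrite -(integral_indic_esub (escale e z) mB).
under eq_integral do rewrite EFinM.
rewrite ge0_integralZl ?lee_fin ?bell_ge0//.
by apply/measurable_EFinP; apply: (measurableT_comp (measurable_indic mB)); exact: measurable_esub.
Qed.

(** This uniform bound disposes of sets of small measure in limiting arguments. *)
Lemma shift_osc_le_measure (e : R) B : measurable B ->
  shift_osc e B <= (2 * bell_mass)%:E * mu B.
Proof.
move=> mB.
pose f (d : R) (p : E * E) : R := (bell p.1 * \1_B (esub p.2 (escale d p.1)))%R.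
have mf d : measurable_fun setT (f d).
  by apply: measurable_funM => //; exact: measurable_indic_shift.
have f0 d p : (0 <= f d p)%R by apply: mulr_ge0 => //; exact: bell_ge0.
have -> : (2 * bell_mass)%:E * mu B = \int[mu]_z \int[mu]_u (f e (z, u) + f 0%R (z, u))%:E.
  rewrite double_integralD// !integral_bell_shift//.
  rewrite -ge0_muleDl ?lee_fin ?(ltW bell_mass_gt0)//.
  by rewrite -EFinD; congr (_%:E * _); ring.
apply: (le_double_integral (measurable_osc e mB)
  (measurable_funD (mf e) (mf 0%R)) (bell_osc_ge0 e B)) => p.
rewrite /= -mulrDr ler_wpM2l ?bell_ge0//.
have -> : esub p.2 (escale 0 p.1) = p.2.
  by apply: euclidP => i; rewrite coord_esub coord_escale mul0r subr0.
by rewrite /osc (le_trans (ler_normB _ _))// !ger0_norm.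
Qed.

(** Weight of the shifts that move a point of [Q] out of [Q]. Unlike the integrand
    of [shift_osc], it vanishes when its second variable is outside [Q], whatever
    the size of the shift; this is what makes dominated convergence applicable. *)
Let exit_fun (e : R) Q (p : E * E) : R :=
  (bell p.1 * (\1_Q p.2 * (1 - \1_Q (esub p.2 (escale e p.1)))))%R.

Let exit_fun_ge0 (e : R) Q p : (0 <= exit_fun e Q p)%R.
Proof.
by rewrite mulr_ge0 ?bell_ge0// mulr_ge0 ?subr_ge0//.
Qed.

Let measurable_exit_fun (e : R) Q : measurable Q ->
  measurable_fun setT (exit_fun e Q).
Proof.
move=> mQ; apply: measurable_funM => //.
apply: measurable_funM; first exact: measurable_indic2.
by apply: measurable_funB => //; exact: measurable_indic_shift.
Qed.

(** Entering [Q] under a shift is leaving it under the opposite shift, and the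
    Gaussian weight is even. *)
Let integral_entry (e : R) Q : measurable Q ->
  \int[mu]_z \int[mu]_u (bell z *
    (\1_Q (esub u (escale e z)) * (1 - \1_Q u)))%:E =
  \int[mu]_z \int[mu]_u (exit_fun e Q (z, u))%:E.
Proof.
move=> mQ.
pose H z := \int[mu]_u (exit_fun e Q (z, u))%:E.
pose o : E := [tuple 0%R | i < D].
have mH : measurable_fun setT H.
  by apply: (measurable_EFin_integral (f := exit_fun e Q)) => //; exact: measurable_exit_fun.
transitivity (\int[mu]_z H (esub o z)); last first.
  by rewrite ge0_integral_esub// => z; apply: integral_ge0 => u _; rewrite lee_fin.
apply: eq_integral => z _.
have bellN : bell (esub o z) = bell z.
  congr (expR (- (_ / 2))); apply: eq_bigr => i _.
  by rewrite coord_esub coord_tuple sub0r mulrNN.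
pose k u : \bar R := (exit_fun e Q (esub o z, u))%:E.
have mk : measurable_fun setT k by by apply: (measurable_EFin_section (f := exit_fun e Q)); exact: measurable_exit_fun.
rewrite /H -(ge0_integral_esubl (escale e z) mk); last by move=> u; rewrite lee_fin.
apply: eq_integral => u _; rewrite /k /exit_fun /= bellN.
rewrite (_ : esub (esub u _) _ = u)//.
by apply: euclidP => i; rewrite !(coord_esub, coord_escale, coord_tuple); ring.
Qed.

Let shift_osc_le_exit (e : R) Q : measurable Q ->
  shift_osc e Q <= 2%:E * \int[mu \x mu]_p (exit_fun e Q p)%:E.
Proof.
move=> mQ; have mx := measurable_exit_fun e mQ.
have mEx : measurable_fun setT (fun p => (exit_fun e Q p)%:E) by exact/measurable_EFinP.
have x0 p : 0 <= (exit_fun e Q p)%:E by rewrite lee_fin.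
rewrite (fubini_tonelli1 _ mEx x0) /fubini_F.
rewrite mule_natl mule2n -[X in X + _]integral_entry//.
pose f (p : E * E) : R := (bell p.1 * (\1_Q (esub p.2 (escale e p.1)) * (1 - \1_Q p.2)))%R.
have mf : measurable_fun setT f.
  apply: measurable_funM => //.
  apply: measurable_funM; first exact: measurable_indic_shift.
  by apply: measurable_funB => //; exact: measurable_indic2.
have f0 p : (0 <= f p)%R by rewrite mulr_ge0 ?bell_ge0// mulr_ge0 ?subr_ge0.
rewrite -(double_integralD mf mx f0)//.
apply: (le_double_integral (measurable_osc e mQ) (measurable_funD mf mx) (bell_osc_ge0 e Q)).
move=> p; rewrite /= -mulrDr ler_wpM2l ?bell_ge0// /osc !indicE.
by do 2 case: (_ \in Q) => /=; rewrite ?subrr ?subr0 ?sub0r ?normrN ?normr1 ?normr0 ?mulr0 ?mul0r ?mulr1 ?addr0 ?add0r.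
Qed.

(** Boxes are open, so a point of a box stays in it under small enough shifts. *)
Lemma vanishing_shift_osc_box a b :
  vanishing (fun n => shift_osc n.+1%:R^-1 (box a b)).
Proof.
pose Q := box a b; have mQ : measurable Q by exact: measurable_box.
have mbQ : measurable_fun setT (fun p : E * E => (bell p.1 * \1_Q p.2)%:E).
  by apply/measurable_EFinP; apply: measurable_funM => //; exact: measurable_indic2.
have ibQ : (mu \x mu).-integrable setT (fun p : E * E => (bell p.1 * \1_Q p.2)%:E).
  apply/integrableP; split => //.
  under eq_integral do rewrite gee0_abs ?lee_fin ?mulr_ge0 ?bell_ge0//.
  rewrite (fubini_tonelli1 _ mbQ)/fubini_F; last first.
    by move=> p; rewrite lee_fin mulr_ge0 ?bell_ge0.
  have -> : \int[mu]_x \int[mu]_y (bell x * \1_Q y)%:E =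
      \int[mu]_z \int[mu]_u (bell z * \1_Q (esub u (escale 0 z)))%:E.
    apply: eq_integral => z _; apply: eq_integral => u _; do 2 congr (_ _).
    by congr (\1_Q _); apply: euclidP => i; rewrite coord_esub coord_escale mul0r subr0.
  rewrite integral_bell_shift// lte_mul_pinfty ?lee_fin ?(ltW bell_mass_gt0)//.
  exact: lebesgue_box_lty.
have c0 p : (exit_fun n.+1%:R^-1 Q p)%:E @[n --> \oo] --> (0%R)%:E.
  case: p => z u; apply: cvg_near_cst.
  have [uQ|uQ] := boolP (u \in Q); last first.
    by near=> n; rewrite /exit_fun/= !indicE (negbTE uQ) mul0r mulr0.
  have : \forall n \near \oo, forall i, (coord a i < coord u i - n.+1%:R^-1 * coord z i < coord b i)%R.
    apply: filter_forall => i.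
    have ci : (coord u i - n.+1%:R^-1 * coord z i)%R @[n --> \oo] --> coord u i.
      rewrite -[X in _ --> X](subr0 (coord u i)); apply: cvgB; first exact: cvg_cst.
      rewrite -(mul0r (coord z i)); apply: cvgM; last exact: cvg_cst.
      exact: cvg_harmonic.
    move: uQ; rewrite inE => /(_ i)/andP[au ub].
    near=> n; apply/andP; split; near: n.
    - exact: (cvgr_gt (coord u i) ci).
    - exact: (cvgr_lt (coord u i) ci).
  apply: filterS => n nQ; rewrite /exit_fun/= !indicE uQ mem_set ?subrr ?mulr0//.
  by move=> i; rewrite coord_esub coord_escale; exact: nQ.
have : vanishing (fun n => \int[mu \x mu]_p (exit_fun n.+1%:R^-1 Q p)%:E).
  apply: cvg_vanishing.
  have [] := @dominated_convergence _ _ R (mu \x mu) setT measurableT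
    (fun n p => (exit_fun n.+1%:R^-1 Q p)%:E) (cst 0) (fun p => (bell p.1 * \1_Q p.2)%:E).
  - by move=> n; apply/measurable_EFinP; exact: measurable_exit_fun.
  - exact: measurable_cst.
  - by apply: aeW => p _; exact: c0.
  - exact: ibQ.
  - apply: aeW => p n _; rewrite gee0_abs ?lee_fin// ler_wpM2l ?bell_ge0//.
    by rewrite ler_piMr// lerBlDr lerDl.
  - by rewrite integral0.
move=> v; apply: le_vanishing (vanishingD v v) => n.
by rewrite -mule2n -mule_natl; exact: shift_osc_le_exit.
Unshelve. all: by end_near.
Qed.

End gaussian_shifts.

Section shift_osc_all.
Context (R : realType) (D : nat).
Local Notation E := (euclid R D).
Local Notation mu := (lebesgue R D).
Implicit Types (A B Q : set E).

Lemma oscE B (x y : E) : osc B x y = ((x \in B) (+) (y \in B))%:R.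
Proof.
rewrite /osc !indicE; case: (x \in B); case: (y \in B) => /=;
  by rewrite ?subrr ?subr0 ?sub0r ?normrN ?normr1 ?normr0.
Qed.

Lemma osc_setU A B x y : osc (A `|` B) x y <= osc A x y + osc B x y.
Proof.
rewrite !oscE !in_setU -natrD ler_nat.
by case: (x \in A); case: (y \in A); case: (x \in B); case: (y \in B).
Qed.

Lemma osc_setD A B x y : osc (A `\` B) x y <= osc A x y + osc B x y.
Proof.
rewrite !oscE !in_setD -natrD ler_nat.
by case: (x \in A); case: (y \in A); case: (x \in B); case: (y \in B).
Qed.

Local Open Scope ereal_scope.
Local Notation vanishes B := (vanishing (fun n => shift_osc (n.+1%:R^-1 : R) B)).

(** A countable union in a set of finite measure is a finite union up to a set
    of small measure. *)
Let vanishes_bigcup Q (F : nat -> set E) : measurable Q -> mu Q < +oo ->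
  (forall n, measurable (F n)) -> (forall n, F n `<=` Q) ->
  (forall n, vanishes (F n)) -> vanishes (\bigcup_k F k).
Proof.
move=> mQ Qoo mF FQ vF.
pose U n := \big[setU/set0]_(k < n) F k.
have mU n : measurable (U n) by exact: bigsetU_measurable.
have mT : measurable (\bigcup_k F k) by exact: bigcup_measurable.
have vU n : vanishes (U n).
  elim: n => [|n IH].
    rewrite /U big_ord0 => e e0; near=> n.
    apply: (le_trans (shift_osc_le_measure _ _)) => //.
    by rewrite measure0 mule0 lee_fin ltW.
  rewrite /U big_ord_recr/=; apply: le_vanishing (vanishingD IH (vF n)) => k.
  apply: shift_osc_le2 => //; last by move=> x y; exact: osc_setU.
  by apply: measurableU => //; exact: mU.
have tail0 : vanishing (fun n => mu (\bigcup_k F k `\` U n)).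
  apply: cvg_vanishing.
  have -> : (0 : \bar R) = mu (\bigcap_n (\bigcup_k F k `\` U n)).
    rewrite (_ : \bigcap_n _ = set0) ?measure0//.
    apply/seteqP; split => x //= h.
    have [[k _ Fk] _] := h 0%N I.
    have [_] := h k.+1 I; apply.
    by rewrite /U big_ord_recr/=; right.
  apply: nonincreasing_cvg_mu.
  - apply: le_lt_trans Qoo; apply: le_measure; rewrite ?inE//.
      exact: measurableD.
    by move=> x [[k _ Fk] _]; exact: (FQ k).
  - by move=> n; exact: measurableD.
  - by apply: bigcap_measurable => // k _; exact: measurableD.
  - move=> n m nm; apply/subsetPset; apply: setDS.
    by apply: subset_bigsetU.
move=> e e0.
have e2 : (0 < e / 2)%R by rewrite divr_gt0.
have e4 : (0 < e / 2 / (2 * bell_mass R D))%R.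
  by rewrite divr_gt0// mulr_gt0// bell_mass_gt0.
have [N _ HN] := tail0 _ e4.
have := vU N _ e2; apply: filterS => n Un.
apply: (@le_trans _ _ (shift_osc n.+1%:R^-1 (U N) +
   shift_osc n.+1%:R^-1 (\bigcup_k F k `\` U N))).
  apply: shift_osc_le2 => //; first exact: measurableD.
  have {1}-> : \bigcup_k F k = U N `|` (\bigcup_k F k `\` U N).
    rewrite setDUK// /U => x; rewrite -bigcup_mkord => -[k _ Fk].
    by exists k.
  by move=> x y; exact: osc_setU.
rewrite (splitr e) EFinD leeD//.
apply: (le_trans (shift_osc_le_measure _ _)); first exact: measurableD.
have := HN N (leqnn N) => /= h.
apply: le_trans (lee_wpmul2l _ h) _.
  by rewrite lee_fin mulr_ge0// ltW// bell_mass_gt0.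
rewrite -EFinM lee_fin mulrC divfK// gt_eqF// mulr_gt0// bell_mass_gt0.
Unshelve. all: by end_near.
Qed.

(** The sets with this property form a Dynkin system that contains the boxes,
    which are stable under intersection and generate the sigma-algebra. *)
Lemma vanishing_shift_osc (a b : E) A : measurable A -> vanishes (A `&` box a b).
Proof.
move=> mA; move: A mA a b; rewrite measurable_boxesE => A.
pose P (A : set E) := forall a b, vanishes (A `&` box a b).
move: A; apply: (dynkin_induction (P := P)).
- exact: measurable_boxesE.
- exact: box_setI_closed.
- by move=> a b; rewrite setTI; exact: vanishing_shift_osc_box.
- move=> _ [c [e ->]] a b.
  have [x [y ->]] : boxes (box c e `&` box a b).
    by apply: box_setI_closed; [exists c, e|exists a, b].
  exact: vanishing_shift_osc_box.
- move=> S mS PS a b.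
  have -> : ~` S `&` box a b = box a b `\` (S `&` box a b).
    by rewrite setDIr setDv setU0 setDE setIC.
  have vQ := @vanishing_shift_osc_box R D a b.
  apply: le_vanishing (vanishingD vQ (PS a b)) => n.
  have mQ := measurable_box a b.
  have mSQ : measurable (S `&` box a b) by exact: measurableI.
  apply: shift_osc_le2 => //; first exact: measurableD.
  by move=> x y; exact: osc_setD.
- move=> F mF tF PF a b; rewrite setI_bigcupl.
  apply: (@vanishes_bigcup (box a b)).
  + exact: measurable_box.
  + exact: lebesgue_box_lty.
  + by move=> n; apply: measurableI => //; exact: measurable_box.
  + by move=> n; exact: subIsetr.
  + by move=> n; exact: PF.
Qed.

End shift_osc_all.

(** * Comparison of densities through their characteristic functions *)

Section gaussian_smoothing.
Context (R : realType) (D : nat).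
Local Notation E := (euclid R D).
Local Notation mu := (lebesgue R D).
Local Open Scope ereal_scope.

(** For a density, [1] plus the real part of the characteristic function turned by
    the phase [th]: the integrand is nonnegative, which is all that Tonelli's
    theorem asks for. *)
Definition one_plus_cf (G : E -> R) (xi : E) (th : R) : \bar R :=
  \int[mu]_y (G y * (1 + cos (dot xi y + th)))%:E.

(** The heat kernel at time [c] and its Fourier transform [freq_gauss], both
    without normalization. *)
Definition heat (c : R) (x : E) : R := expR (- (dot x x / (2 * c))).

Lemma heat_ge0 c x : (0 <= heat c x)%R. Proof. exact: expR_ge0. Qed.

Lemma measurable_heat c : measurable_fun setT (heat c).
Proof.
apply: measurable_expR_comp; apply: measurable_opp_comp.
by apply: measurable_funM => //; exact: measurable_dot.
Qed.

Lemma one_plus_cos_ge0 (x : R) : (0 <= 1 + cos x)%R.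
Proof. by have := cos_geN1 x; lra. Qed.

Lemma one_plus_cf_ge0 (F : E -> R) xi th : (forall x, 0 <= F x)%R ->
  0 <= one_plus_cf F xi th.
Proof.
move=> F0; apply: integral_ge0 => y _.
by rewrite lee_fin mulr_ge0// one_plus_cos_ge0.
Qed.

Lemma measurable_one_plus_cf (F phase : E -> R) : (forall x, 0 <= F x)%R ->
  measurable_fun setT F -> measurable_fun setT phase ->
  measurable_fun setT (fun xi => one_plus_cf F xi (phase xi)).
Proof.
move=> F0 mF mph.
apply: (@measurable_EFin_integral R D (fun p => F p.2 * (1 + cos (dot p.1 p.2 + phase p.1)))%R).
  apply: measurable_funM; first exact: (measurableT_comp mF).
  apply: measurable_funD => //; apply: measurable_cos_comp.
  by apply: measurable_funD; [exact: measurable_dot|exact: (measurableT_comp mph)].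
by move=> p; rewrite mulr_ge0// one_plus_cos_ge0.
Qed.

Lemma esubxx_heat c (x y : E) : heat c (esub x y) = heat c (esub y x).
Proof.
rewrite /heat (_ : dot (esub x y) (esub x y) = dot (esub y x) (esub y x))//.
by apply: eq_bigr => i _; rewrite !coord_esub -[RHS]mulrNN !opprB.
Qed.

Definition freq_gauss (c : R) (xi : E) : R := expR (- (c * dot xi xi / 2)).

Lemma measurable_freq_gauss c : measurable_fun setT (freq_gauss c).
Proof.
apply: measurable_expR_comp; apply: measurable_opp_comp.
by do 2 apply: measurable_funM => //; exact: measurable_dot.
Qed.

Lemma freq_gauss_ge0 c xi : (0 <= freq_gauss c xi)%R. Proof. exact: expR_ge0. Qed.

Lemma freq_gauss_le1 c xi : (0 < c)%R -> (freq_gauss c xi <= 1)%R.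
Proof.
by move=> c0; rewrite -expR0 ler_expR oppr_le0 divr_ge0// mulr_ge0 ?dotxx_ge0 ?ltW.
Qed.

(** Tonelli's theorem and the Fourier transform of the Gaussian: averaging the
    phases [- xi . x] against a Gaussian evaluates a smoothing of [F] at [x]. *)
Lemma heat_representation (F : E -> R) c x : (forall x, (0 <= F x)%R) ->
  measurable_fun setT F -> (0 < c)%R ->
  \int[mu]_xi ((freq_gauss c xi)%:E * one_plus_cf F xi (- dot xi x)%R) =
  (Num.sqrt (2 * pi / c) ^+ D)%:E * (\int[mu]_y (F y)%:E + \int[mu]_y (F y * heat c (esub x y))%:E).
Proof.
move=> F0 mF c0.
pose f (p : E * E) : R := (freq_gauss c p.1 * (F p.2 * (1 + cos (dot p.1 p.2 - dot p.1 x))))%R.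
have mf : measurable_fun setT f.
  apply: measurable_funM; first exact: (measurableT_comp (measurable_freq_gauss c)).
  apply: measurable_funM; first exact: (measurableT_comp mF).
  apply: measurable_funD => //; apply: measurable_cos_comp.
  by apply: measurable_funB; exact: measurable_dot.
have f0 p : (0 <= f p)%R by rewrite !mulr_ge0 ?freq_gauss_ge0// one_plus_cos_ge0.
transitivity (\int[mu]_xi \int[mu]_y (f (xi, y))%:E).
  apply: eq_integral => xi _; rewrite /one_plus_cf /f /= EFin_integralZl ?freq_gauss_ge0//.
  - apply: measurable_funM => //; apply: measurable_funD => //.
    apply: measurable_cos_comp; apply: measurable_funB => //.
    exact: measurable_dot.
  - by move=> y; rewrite mulr_ge0// one_plus_cos_ge0.
rewrite EFin_tonelli//.
have mh : measurable_fun setT (fun y => F y * heat c (esub x y))%R.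
  apply: measurable_funM => //; apply: (measurableT_comp (measurable_heat c)).
  exact: measurable_esub.
rewrite -EFin_integralD//; last by move=> y; rewrite mulr_ge0 ?heat_ge0.
rewrite -EFin_integralZl//; last 2 first.
- exact: measurable_funD.
- by move=> y; rewrite addr_ge0// mulr_ge0 ?heat_ge0.
apply: eq_integral => y _.
transitivity (\int[mu]_xi (F y * (expR (- (c * dot xi xi / 2)) * (1 + 1 * cos (dot (esub y x) xi + 0))))%:E).
  apply: eq_integral => xi _; rewrite /f /freq_gauss /= addr0 mul1r.
  by rewrite [dot (esub _ _) _]dotC dotBr; congr EFin; ring.
rewrite EFin_integralZl//.
- rewrite integral_gauss_1cos ?ler01 ?lexx// cos0 mulr1 mul1r -EFinM.
  by rewrite esubxx_heat /heat; congr EFin; ring.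
- by apply/measurable_EFinP; exact: measurable_gauss_1cos.
Qed.

Variables (G H : E -> R) (M : R).
Hypotheses (G0 : forall x, (0 <= G x)%R) (mG : measurable_fun setT G).
Hypotheses (H0 : forall x, (0 <= H x)%R) (mH : measurable_fun setT H).
Hypotheses (G1 : \int[mu]_x (G x)%:E = 1) (H1 : \int[mu]_x (H x)%:E = 1).
Variables (r : E -> R) (I : R).
Hypotheses (r0 : forall x, (0 <= r x)%R) (mr : measurable_fun setT r).
Hypothesis rI : \int[mu]_x (r x)%:E <= I%:E.
Hypothesis GH : forall xi th, one_plus_cf G xi th <= one_plus_cf H xi th + (r xi)%:E.

Let I_ge0 : (0 <= I)%R.
Proof.
by rewrite -lee_fin (le_trans _ rI)// integral_ge0// => x _; rewrite lee_fin.
Qed.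

(** The mass terms of [heat_representation] for [G] and [H] cancel, and the
    weight [freq_gauss] is at most [1]. *)
Let le_heat c x : (0 < c)%R ->
  \int[mu]_y (G y * heat c (esub x y))%:E <=
  \int[mu]_y (H y * heat c (esub x y))%:E + (I / Num.sqrt (2 * pi / c) ^+ D)%R%:E.
Proof.
move=> c0; pose A : R := (Num.sqrt (2 * pi / c) ^+ D)%R.
have A0 : (0 < A)%R by rewrite exprn_gt0// sqrtr_gt0 divr_gt0// mulr_gt0// pi_gt0.
have GE := heat_representation x G0 mG c0.
have HE := heat_representation x H0 mH c0.
have mcf (F : E -> R) : (forall x, (0 <= F x)%R) -> measurable_fun setT F ->
    measurable_fun setT (fun xi => one_plus_cf F xi (- dot xi x)%R).
  move=> F0 mF; apply: measurable_one_plus_cf => //.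
  by apply: measurable_opp_comp; exact: measurable_dot.
have mEw : measurable_fun setT (fun xi => (freq_gauss c xi)%:E).
  by apply/measurable_EFinP; exact: measurable_freq_gauss.
have mEr : measurable_fun setT (fun xi => (r xi)%:E) by exact/measurable_EFinP.
have : \int[mu]_xi ((freq_gauss c xi)%:E * one_plus_cf G xi (- dot xi x)%R) <=
    \int[mu]_xi ((freq_gauss c xi)%:E * one_plus_cf H xi (- dot xi x)%R) + I%:E.
  apply: (@le_trans _ _ (\int[mu]_xi ((freq_gauss c xi)%:E * one_plus_cf H xi (- dot xi x)%R + (r xi)%:E))).
    apply: ge0_le_integral => //.
    - by move=> xi _; rewrite mule_ge0 ?lee_fin ?freq_gauss_ge0 ?one_plus_cf_ge0.
    - by apply: emeasurable_funM => //; exact: mcf.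
    - by apply: emeasurable_funD => //; apply: emeasurable_funM => //; exact: mcf.
    - move=> xi _; apply: le_trans (lee_wpmul2l _ (GH xi _)) _; first by rewrite lee_fin freq_gauss_ge0.
      rewrite ge0_muleDr ?one_plus_cf_ge0 ?lee_fin// leeD2l//.
      by rewrite -EFinM lee_fin ler_piMl// freq_gauss_le1.
  rewrite ge0_integralD//.
  - exact: leeD2l.
  - by move=> xi _; rewrite mule_ge0 ?lee_fin ?freq_gauss_ge0 ?one_plus_cf_ge0.
  - by apply: emeasurable_funM => //; exact: mcf.
  - by move=> xi _; rewrite lee_fin.
rewrite GE HE G1 H1 -/A.
set X := \int[mu]_y (G y * heat c (esub x y))%:E.
have : 0 <= \int[mu]_y (H y * heat c (esub x y))%:E.
  by apply: integral_ge0 => y _; rewrite lee_fin mulr_ge0 ?heat_ge0.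
move: X (\int[mu]_y (H y * heat c (esub x y))%:E) => X Y Y0 h.
have {}h : A%:E * (1 + X) <= A%:E * (1 + (Y + (I / A)%R%:E)).
  apply: (le_trans h); rewrite addeA (@ge0_muleDr _ A%:E (1 + Y)) ?adde_ge0//.
    by rewrite -EFinM [(A * _)%R]mulrC divfK ?gt_eqF.
  by rewrite lee_fin divr_ge0 ?I_ge0// ltW.
by move: h; rewrite lee_pmul2l ?lte_fin// leeD2lE.
Qed.

Implicit Types (B : set E) (F : E -> R).

(** Integral of [F] against the smoothed indicator function of [B]; shifting [B]
    rather than [F] is what lets [shift_osc] measure the effect of smoothing. *)
Let smooth_fun (e : R) B F (p : E * E) : R :=
  (bell p.1 * \1_B (esub p.2 (escale e p.1)) * F p.2)%R.

Let smooth (e : R) B F : \bar R := \int[mu]_z \int[mu]_u (smooth_fun e B F (z, u))%:E.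

Let smooth_fun_ge0 e B F p : (forall x, (0 <= F x)%R) -> (0 <= smooth_fun e B F p)%R.
Proof. by move=> F0; rewrite !mulr_ge0 ?bell_ge0. Qed.

Let measurable_smooth_fun e B F : measurable B -> measurable_fun setT F ->
  measurable_fun setT (smooth_fun e B F).
Proof.
move=> mB mF; apply: measurable_funM; last exact: (measurableT_comp mF).
apply: measurable_funM; first exact: (measurableT_comp (@measurable_bell R D)).
apply: (measurableT_comp (measurable_indic mB)).
by apply: measurable_esub => //; exact: measurable_escale.
Qed.

(** The change of variable [x = u - e z] turns the shifts of [B] into a smoothing
    of [F]. *)
Let smoothE (e : R) B F : (0 < e)%R -> measurable B -> measurable_fun setT F ->
  (forall x, (0 <= F x)%R) ->
  smooth e B F = (e^-1 ^+ D)%R%:E *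
    \int[mu]_x ((\1_B x)%:E * \int[mu]_u (F u * heat (e ^+ 2) (esub x u))%:E).
Proof.
move=> e0 mB mF F0; have ne0 : (- e != 0)%R by rewrite oppr_eq0 gt_eqF.
pose k (p : E * E) : R := (\1_B p.2 * (F p.1 * heat (e ^+ 2) (esub p.2 p.1)))%R.
have k0 p : (0 <= k p)%R by rewrite !mulr_ge0 ?heat_ge0.
have mk : measurable_fun setT k.
  apply: measurable_funM; first exact: (measurableT_comp (measurable_indic mB)).
  apply: measurable_funM; first exact: (measurableT_comp mF).
  by apply: (measurableT_comp (measurable_heat _)); exact: measurable_esub.
rewrite /smooth EFin_tonelli; last 2 first.
- exact: measurable_smooth_fun.
- by move=> p; exact: smooth_fun_ge0.
transitivity (\int[mu]_u ((e^-1 ^+ D)%R%:E * \int[mu]_x (k (u, x))%:E)).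
  apply: eq_integral => u _.
  have := @ge0_integral_eaffine R D (- e) u (fun x => (k (u, x))%:E) ne0.
  rewrite normrN gtr0_norm// => <-.
  - apply: eq_integral => z _; rewrite /smooth_fun /k /=.
    have -> : eaffine (- e) u z = esub u (escale e z).
      by apply: euclidP => i; rewrite coord_eaffine coord_esub coord_escale; ring.
    have -> : heat (e ^+ 2) (esub (esub u (escale e z)) u) = bell z.
      have -> : esub (esub u (escale e z)) u = escale (- e) z.
        by apply: euclidP => i; rewrite !coord_esub !coord_escale; ring.
      rewrite /heat /bell dot_escale; congr (expR (- _)); field.
      by rewrite gt_eqF.
    by congr EFin; ring.
  - exact: measurable_EFin_section.
  - by move=> x; rewrite lee_fin.
rewrite ge0_integralZl//; last 3 first.
- exact: measurable_EFin_integral.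
- by move=> u _; apply: integral_ge0 => x _; rewrite lee_fin.
- by rewrite lee_fin exprn_ge0// invr_ge0 ltW.
congr (_ * _); rewrite EFin_tonelli//; apply: eq_integral => x _.
rewrite /k /= EFin_integralZl//.
- apply: measurable_funM => //; apply: (measurableT_comp (measurable_heat _)).
  exact: measurable_esub.
- by move=> u; rewrite mulr_ge0 ?heat_ge0.
Qed.

(** The factor [e^-D] of [smoothE] compensates the normalization in [le_heat]:
    the error does not depend on the scale [e]. *)
Let le_smooth (e : R) B : (0 < e)%R -> measurable B ->
  smooth e B G <= smooth e B H + (I / bell_mass R D)%R%:E * mu B.
Proof.
move=> e0 mB; have e20 : (0 < e ^+ 2)%R by rewrite exprn_gt0.
pose q := (I / Num.sqrt (2 * pi / e ^+ 2) ^+ D)%R.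
have q0 : (0 <= q)%R by rewrite divr_ge0 ?I_ge0// exprn_ge0 ?sqrtr_ge0.
have eD0 : (0 <= e^-1 ^+ D)%R by rewrite exprn_ge0// invr_ge0 ltW.
have qE : (e^-1 ^+ D * q = I / bell_mass R D)%R.
  have -> : q = (I / (bell_mass R D * e^-1 ^+ D))%R.
    rewrite /q /bell_mass -exprMn sqrtrM ?mulr_ge0 ?pi_ge0// sqrtrV ?(ltW e20)//.
    by rewrite sqrtr_sqr gtr0_norm.
  have a0 : (e^-1 ^+ D != 0)%R by rewrite expf_neq0// invr_eq0 gt_eqF.
  have b0 : bell_mass R D != 0%R by rewrite gt_eqF// bell_mass_gt0.
  by move: (e^-1 ^+ D)%R (bell_mass R D) a0 b0 => a b a0 b0; field; rewrite a0 b0.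
have mhe (F : E -> R) : measurable_fun setT F -> (forall x, (0 <= F x)%R) ->
    measurable_fun setT (fun x => (\1_B x)%:E * \int[mu]_u (F u * heat (e ^+ 2) (esub x u))%:E).
  move=> mF F0; apply: emeasurable_funM; first exact/measurable_EFinP.
  apply: (@measurable_EFin_integral R D (fun p => F p.2 * heat (e ^+ 2) (esub p.1 p.2))%R).
    apply: measurable_funM; first exact: (measurableT_comp mF).
    by apply: (measurableT_comp (measurable_heat _)); exact: measurable_esub.
  by move=> p; rewrite mulr_ge0 ?heat_ge0.
have he0 (F : E -> R) x : (forall x, (0 <= F x)%R) ->
    0 <= \int[mu]_u (F u * heat (e ^+ 2) (esub x u))%:E.
  by move=> F0; apply: integral_ge0 => u _; rewrite lee_fin mulr_ge0 ?heat_ge0.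
rewrite !smoothE// -qE EFinM -muleA -ge0_muleDr; last 2 first.
- by apply: integral_ge0 => x _; rewrite mule_ge0 ?lee_fin ?he0.
- by rewrite mule_ge0 ?lee_fin.
apply: lee_wpmul2l; first by rewrite lee_fin.
have mqB : measurable_fun setT (fun x => q%:E * (\1_B x)%:E).
  by apply: measurable_funeM; exact/measurable_EFinP.
have -> : q%:E * mu B = \int[mu]_x (q%:E * (\1_B x)%:E).
  rewrite ge0_integralZl ?lee_fin//; first by rewrite integral_indic// setIT.
  exact/measurable_EFinP.
rewrite -ge0_integralD//; last 3 first.
- by move=> x _; rewrite mule_ge0 ?lee_fin ?he0.
- exact: mhe.
- by move=> x _; rewrite mule_ge0 ?lee_fin.
apply: ge0_le_integral => //.
- by move=> x _; rewrite mule_ge0 ?lee_fin ?he0.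
- exact: mhe.
- by apply: emeasurable_funD => //; exact: mhe.
move=> x _; apply: le_trans (lee_wpmul2l _ (le_heat x e20)) _; first by rewrite lee_fin.
by rewrite ge0_muleDr ?he0 ?lee_fin// leeD2l// -/q muleC.
Qed.

Hypothesis GM : forall x, (G x <= M)%R.
Hypothesis HM : forall x, (H x <= M)%R.

Let M_ge0 : (0 <= M)%R.
Proof. exact: le_trans (G0 [tuple 0%R | i < D]) (GM _). Qed.

Let bell_integral B F : measurable B -> measurable_fun setT F ->
  (forall x, (0 <= F x)%R) ->
  \int[mu]_z \int[mu]_u (bell z * (\1_B u * F u))%:E =
  (bell_mass R D)%:E * \int[mu]_u (\1_B u * F u)%:E.
Proof.
move=> mB mF F0.
have mBF : measurable_fun setT (fun u => (\1_B u * F u)%R).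
  by apply: measurable_funM => //; exact: measurable_indic.
have BF0 u : (0 <= \1_B u * F u :> R)%R by rewrite mulr_ge0.
rewrite -integral_bell -ge0_integralZr//; last 3 first.
- by apply/measurable_EFinP; exact: measurable_bell.
- by move=> z _; rewrite lee_fin bell_ge0.
- by apply: integral_ge0 => u _; rewrite lee_fin.
by apply: eq_integral => z _; rewrite EFin_integralZl ?bell_ge0.
Qed.

Let measurable_still_fun B F : measurable B -> measurable_fun setT F ->
  measurable_fun setT (fun p : E * E => bell p.1 * (\1_B p.2 * F p.2))%R.
Proof.
move=> mB mF; apply: measurable_funM; first exact: (measurableT_comp (@measurable_bell R D)).
apply: measurable_funM; first exact: (measurableT_comp (measurable_indic mB)).
exact: (measurableT_comp mF).
Qed.

Let le_double_osc e B (f h : E * E -> R) : measurable B ->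
  measurable_fun setT f -> measurable_fun setT h ->
  (forall p, 0 <= f p)%R -> (forall p, 0 <= h p)%R ->
  (forall p, f p <= h p + M * (bell p.1 * osc B (esub p.2 (escale e p.1)) p.2))%R ->
  \int[mu]_z \int[mu]_u (f (z, u))%:E <=
  \int[mu]_z \int[mu]_u (h (z, u))%:E + M%:E * shift_osc e B.
Proof.
move=> mB mf mh f0 h0 fh.
have mk := @measurable_osc R D e B mB.
have k0 p : (0 <= bell p.1 * osc B (esub p.2 (escale e p.1)) p.2 :> R)%R.
  by rewrite mulr_ge0 ?bell_ge0 ?osc_ge0.
have mMk := measurable_funM (measurable_cst M) mk.
have Mk0 p : (0 <= M * (bell p.1 * osc B (esub p.2 (escale e p.1)) p.2))%R.
  exact: mulr_ge0.
rewrite -(double_integralZl mk k0 M_ge0) -(double_integralD mh mMk h0 Mk0).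
by apply: le_double_integral mf _ f0 fh; exact: measurable_funD.
Qed.

Let le_still_smooth e B F : measurable B -> measurable_fun setT F ->
  (forall x, (0 <= F x)%R) -> (forall x, (F x <= M)%R) ->
  (bell_mass R D)%:E * \int[mu]_u (\1_B u * F u)%:E <=
  smooth e B F + M%:E * shift_osc e B.
Proof.
move=> mB mF F0 FM; rewrite -bell_integral//.
apply: (@le_double_osc e B (fun p => bell p.1 * (\1_B p.2 * F p.2))%R (smooth_fun e B F) mB) => [|||p|p].
- exact: measurable_still_fun.
- exact: measurable_smooth_fun.
- by move=> p; rewrite !mulr_ge0 ?bell_ge0.
- exact: smooth_fun_ge0.
rewrite /smooth_fun [leRHS](_ : _ = bell p.1 * (\1_B (esub p.2 (escale e p.1)) * F p.2 +
  M * osc B (esub p.2 (escale e p.1)) p.2))%R; last by ring.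
rewrite ler_wpM2l ?bell_ge0//.
rewrite oscE !indicE; move: (F0 p.2) (FM p.2) M_ge0 => h1 h2 h3.
by do 2 case: (_ \in B) => /=; lra.
Qed.

Let le_smooth_still e B F : measurable B -> measurable_fun setT F ->
  (forall x, (0 <= F x)%R) -> (forall x, (F x <= M)%R) ->
  smooth e B F <=
  (bell_mass R D)%:E * \int[mu]_u (\1_B u * F u)%:E + M%:E * shift_osc e B.
Proof.
move=> mB mF F0 FM; rewrite -bell_integral//.
apply: (@le_double_osc e B (smooth_fun e B F) (fun p => bell p.1 * (\1_B p.2 * F p.2))%R mB) => [|||p|p].
- exact: measurable_smooth_fun.
- exact: measurable_still_fun.
- by move=> p; exact: smooth_fun_ge0.
- by rewrite !mulr_ge0 ?bell_ge0.
rewrite /smooth_fun -[leLHS]mulrA.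
rewrite [leRHS](_ : _ = bell p.1 * (\1_B p.2 * F p.2 +
  M * osc B (esub p.2 (escale e p.1)) p.2))%R; last by ring.
rewrite ler_wpM2l ?bell_ge0//.
rewrite oscE !indicE; move: (F0 p.2) (FM p.2) M_ge0 => h1 h2 h3.
by do 2 case: (_ \in B) => /=; lra.
Qed.

(** Letting the scale of the smoothing tend to zero; boundedness of [G] and [H]
    makes the cost of removing it proportional to [shift_osc]. *)
Let le_integral_box (a b : E) A : measurable A ->
  \int[mu]_u (\1_(A `&` box a b) u * G u)%:E <=
  \int[mu]_u (\1_(A `&` box a b) u * H u)%:E +
  (I / (2 * pi) ^+ D)%R%:E * mu (A `&` box a b).
Proof.
move=> mA; pose B := A `&` box a b.
have mB : measurable B by apply: measurableI => //; exact: measurable_box.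
have m0 := bell_mass_gt0 R D.
have -> : (I / (2 * pi) ^+ D = (bell_mass R D)^-1 * (I / bell_mass R D))%R.
  have -> : ((2 * pi) ^+ D = bell_mass R D * bell_mass R D)%R.
    by rewrite /bell_mass -exprMn -expr2 sqr_sqrtr// mulr_ge0 ?pi_ge0.
  by field; rewrite gt_eqF.
rewrite -/B.
suff : (bell_mass R D)%:E * \int[mu]_u (\1_B u * G u)%:E <=
    (bell_mass R D)%:E * \int[mu]_u (\1_B u * H u)%:E + (I / bell_mass R D)%R%:E * mu B.
  set X := \int[mu]_u (\1_B u * G u)%:E.
  have Y0 : 0 <= \int[mu]_u (\1_B u * H u)%:E.
    by apply: integral_ge0 => u _; rewrite lee_fin mulr_ge0.
  have Z0 : 0 <= mu B by [].
  move: X (\int[mu]_u (\1_B u * H u)%:E) (mu B) Y0 Z0 => X Y Z Y0 Z0.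
  have E1 : (I / bell_mass R D)%R%:E * Z =
      (bell_mass R D)%:E * (((bell_mass R D)^-1 * (I / bell_mass R D))%R%:E * Z).
    by rewrite muleA -EFinM; congr (_%:E * _); field; rewrite gt_eqF.
  rewrite E1 -ge0_muleDr//; last first.
    by rewrite mule_ge0// lee_fin mulr_ge0 ?invr_ge0 ?divr_ge0 ?I_ge0 ?ltW.
  by rewrite lee_pmul2l ?lte_fin.
apply/lee_addgt0Pr => e e0.
have e1 : (0 < e / (2 * (M + 1)))%R by rewrite divr_gt0// mulr_gt0// ltr_wpDl.
have [N _ /(_ N (leqnn N)) /= oscN] := @vanishing_shift_osc R D a b A mA _ e1.
have d0 : (0 < N.+1%:R^-1 :> R)%R by rewrite invr_gt0.
have Mosc : M%:E * shift_osc N.+1%:R^-1 B <= (e / 2)%R%:E.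
  apply: le_trans (lee_wpmul2l _ oscN) _; first by rewrite lee_fin.
  rewrite -EFinM lee_fin mulrA ler_pdivrMr ?mulr_gt0 ?ltr_wpDl//.
  by rewrite [leRHS](_ : _ = e * M + e)%R; [rewrite mulrC lerDl ltW|field].
apply: le_trans (le_still_smooth N.+1%:R^-1 mB mG G0 GM) _.
apply: le_trans (leeD (le_smooth d0 mB) Mosc) _.
rewrite addeAC; apply: le_trans (leeD2r _ (leeD2r _ (le_smooth_still _ mB mH H0 HM))) _.
rewrite [leRHS](_ : _ = (bell_mass R D)%:E * \int[mu]_u (\1_B u * H u)%:E +
  (e / 2)%R%:E + (e / 2)%R%:E + (I / bell_mass R D)%R%:E * mu B).
  by apply: leeD2r; apply: leeD2r; apply: leeD2l.
by rewrite [in LHS](splitr e) EFinD addeAC addeA.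
Qed.

(** The set where the inequality fails meets every box in a null set: there the
    integral of the positive excess of [G] would contradict [le_integral_box]. *)
Lemma ae_le_density :
  {ae mu, forall x, (G x <= H x + I / (2 * pi) ^+ D)%R}.
Proof.
pose q := (I / (2 * pi) ^+ D)%R.
have q0 : (0 <= q)%R by rewrite divr_ge0 ?I_ge0// exprn_ge0// mulr_ge0 ?pi_ge0.
pose Hq x := (H x + q)%R.
have mHq : measurable_fun setT Hq by exact: measurable_funD.
have Hq0 x : (0 <= Hq x)%R by rewrite addr_ge0.
pose A := [set x | (Hq x < G x)%R].
have mA : measurable A.
  rewrite (_ : A = setT `&` (fun x => (Hq x < G x)%R) @^-1` [set true]); last first.
    by rewrite setTI.
  exact: (measurable_fun_ltr mHq mG).
pose Q (n : nat) : set E := box [tuple (- n%:R)%R | i < D] [tuple n%:R%R | i < D].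
have AQ n : {ae mu, forall x, ~ (A `&` Q n) x}.
  pose B := A `&` Q n.
  have mB : measurable B by apply: measurableI => //; exact: measurable_box.
  have mBi : measurable_fun setT (\1_B : E -> R) by exact: measurable_indic.
  pose f x := (\1_B x * (G x - Hq x))%R.
  have mf : measurable_fun setT f.
    by apply: measurable_funM => //; apply: measurable_funB.
  have f0 x : (0 <= f x)%R.
    rewrite /f indicE; have [|] := boolP (x \in B); last by rewrite mul0r.
    by rewrite inE => -[/ltW xA _]; rewrite mul1r subr_ge0.
  have mBHq : measurable_fun setT (fun x => \1_B x * Hq x)%R by exact: measurable_funM.
  have BHq0 x : (0 <= \1_B x * Hq x :> R)%R by rewrite mulr_ge0.
  have le1 : \int[mu]_u (\1_B u * G u)%:E <= \int[mu]_u (\1_B u * Hq u)%:E.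
    apply: (le_trans (le_integral_box _ _ mA)).
    rewrite -/(Q n) -/B -/q.
    have -> : q%:E * mu B = \int[mu]_u (q * \1_B u)%:E.
      by rewrite EFin_integralZl// integral_indic// setIT.
    rewrite -EFin_integralD//.
    - apply: EFin_le_integral => //.
      + by apply: measurable_funD; exact: measurable_funM.
      + by move=> x; rewrite addr_ge0// mulr_ge0.
      + by move=> x; rewrite /Hq [(q * _)%R]mulrC -mulrDr.
    - exact: measurable_funM.
    - exact: measurable_funM.
    - by move=> x; rewrite mulr_ge0.
    - by move=> x; rewrite mulr_ge0.
  have fin : \int[mu]_u (\1_B u * Hq u)%:E \is a fin_num.
    rewrite ge0_fin_numE; last by apply: integral_ge0 => u _; rewrite lee_fin.
    apply: (@le_lt_trans _ _ (\int[mu]_u ((M + q) * \1_B u)%:E)).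
      apply: EFin_le_integral => //; first exact: measurable_funM.
      by move=> u; rewrite [leRHS]mulrC ler_wpM2l// lerD2r.
    rewrite EFin_integralZl ?addr_ge0// integral_indic// setIT.
    apply: lte_mul_pinfty => //; first by rewrite lee_fin addr_ge0.
    apply: le_lt_trans (lebesgue_box_lty [tuple (- n%:R)%R | i < D] [tuple n%:R%R | i < D]).
    by apply: le_measure; rewrite ?inE//; [exact: measurable_box|exact: subIsetr].
  have : \int[mu]_u (\1_B u * G u)%:E = \int[mu]_u (f u)%:E + \int[mu]_u (\1_B u * Hq u)%:E.
    by rewrite -EFin_integralD//; apply: eq_integral => u _; congr EFin; rewrite /f; ring.
  move=> E1; move: le1; rewrite E1 -[leRHS]add0e leeD2rE// => f_le0.
  have mEf : measurable_fun setT (EFin \o f) by exact/measurable_EFinP.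
  have /(ae_eq_integral_abs _ measurableT mEf) : \int[mu]_x `|(EFin \o f) x| = 0.
    under eq_integral do rewrite gee0_abs ?lee_fin//.
    by apply/eqP; rewrite eq_le f_le0/= integral_ge0// => x _; rewrite lee_fin.
  apply: filterS => x /(_ Logic.I) /= [fx0] Bx; move: fx0.
  rewrite /f indicE mem_set// mul1r; apply/eqP; rewrite subr_eq0 gt_eqF//.
  by case: Bx.
move/ae_foralln: AQ; apply: filterS => x xAQ.
rewrite leNgt; apply/negP => Ax.
apply: (xAQ (Num.trunc (enorm x)).+1); split => // i.
by rewrite !coord_tuple -ltr_norml (le_lt_trans (abs_coord_le x i))// truncnS_gt.
Qed.

End gaussian_smoothing.

(** * Characteristic functions of convolution powers *)

Section characteristic_function.
Context (R : realType) (D : nat).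
Local Notation E := (euclid R D).
Local Notation mu := (lebesgue R D).

Record density (g : E -> R) : Prop := Density {
  density_ge0 : forall x, 0 <= g x ;
  density_measurable : measurable_fun setT g ;
  density_mass : (\int[mu]_x (g x)%:E = 1)%E }.

Definition cf_cos (g : E -> R) (xi : E) : R := \int[mu]_x (g x * cos (dot xi x)).
Definition cf_sin (g : E -> R) (xi : E) : R := \int[mu]_x (g x * sin (dot xi x)).

Lemma density_integrable (g : E -> R) : density g -> mu.-integrable setT (EFin \o g).
Proof.
move=> [g0 mg g1]; apply/integrableP; split; first exact/measurable_EFinP.
under eq_integral do rewrite gee0_abs ?lee_fin//.
by rewrite g1 ltry.
Qed.

Lemma density_bounded_integrable g (h : E -> R) : density g -> measurable_fun setT h ->
  (forall x, `|h x| <= 1) -> mu.-integrable setT (EFin \o (fun x => g x * h x)).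
Proof.
move=> dg mh h1; have ig := density_integrable dg; case: dg => [g0 mg _].
apply: (le_integrable measurableT _ _ ig).
  by apply/measurable_EFinP; exact: measurable_funM.
by move=> x _; rewrite /= lee_fin normrM ler_piMr.
Qed.

Lemma abs_cos_le1 (x : R) : `|cos x| <= 1.
Proof. by rewrite ler_norml cos_geN1 cos_le1. Qed.

Lemma abs_sin_le1 (x : R) : `|sin x| <= 1.
Proof. by rewrite ler_norml sin_geN1 sin_le1. Qed.

Lemma integral_trig_density g (xi : E) (al be : R) : density g ->
  (\int[mu]_x (g x * (1 + al * cos (dot xi x) + be * sin (dot xi x)))%:E =
  (1 + al * cf_cos g xi + be * cf_sin g xi)%:E)%E.
Proof.
move=> dg; have md : measurable_fun setT (fun x : E => dot xi x) by exact: measurable_dot.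
have ic := density_bounded_integrable dg (measurable_cos_comp md) (fun x => abs_cos_le1 _).
have is_ := density_bounded_integrable dg (measurable_sin_comp md) (fun x => abs_sin_le1 _).
have ig := density_integrable dg.
have ic' := integrableZl measurableT al ic.
have is' := integrableZl measurableT be is_.
transitivity (\int[mu]_x (((EFin \o g) x + al%:E * (g x * cos (dot xi x))%:E) + be%:E * (g x * sin (dot xi x))%:E))%E.
  by apply: eq_integral => x _; rewrite /= -!EFinM -!EFinD; congr EFin; ring.
rewrite integralD//; last exact: integrableD.
rewrite integralD// !integralZl// (density_mass dg) !EFinD !EFinM.
by congr (_ + _ * _ + _ * _)%E; rewrite /cf_cos /cf_sin /Rintegral fineK//; exact: integrable_fin_num.
Qed.

Lemma one_plus_cfE g xi th : density g ->
  one_plus_cf g xi th = (1 + cf_cos g xi * cos th - cf_sin g xi * sin th)%:E.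
Proof.
move=> dg; rewrite /one_plus_cf.
transitivity (\int[mu]_x (g x * (1 + cos th * cos (dot xi x) + (- sin th) * sin (dot xi x)))%:E)%E.
  by apply: eq_integral => x _; rewrite cosD; congr EFin; ring.
by rewrite integral_trig_density//; congr EFin; ring.
Qed.

Lemma one_plus_cfN g xi t : density g ->
  one_plus_cf g xi (- t) = (1 + cf_cos g xi * cos t + cf_sin g xi * sin t)%:E.
Proof. by move=> dg; rewrite one_plus_cfE// cosN sinN; congr EFin; ring. Qed.

Lemma trig_cf_ge0 g xi t : density g ->
  0 <= 1 + cf_cos g xi * cos t + cf_sin g xi * sin t.
Proof.
by move=> dg; rewrite -lee_fin -one_plus_cfN// one_plus_cf_ge0//; exact: density_ge0 dg.
Qed.

Lemma measurable_trig (xi : E) (al be : R) :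
  measurable_fun setT (fun x => 1 + al * cos (dot xi x) + be * sin (dot xi x)).
Proof.
have md : measurable_fun setT (fun x : E => dot xi x) by exact: measurable_dot.
apply: measurable_funD; first apply: measurable_funD => //.
  by apply: measurable_funM => //; exact: measurable_cos_comp.
by apply: measurable_funM => //; exact: measurable_sin_comp.
Qed.

(** The phases [0] and [pi / 2] recover the real and imaginary parts. *)
Lemma cf_unique g xi (a b : R) : density g ->
  (forall th, one_plus_cf g xi th = (1 + a * cos th - b * sin th)%:E) ->
  cf_cos g xi = a /\ cf_sin g xi = b.
Proof.
move=> dg h; split.
  have := h 0; rewrite one_plus_cfE// cos0 sin0 => -[]; lra.
have := h (pi / 2); rewrite one_plus_cfE// cos_pihalf sin_pihalf => -[]; lra.
Qed.

(** Powers of the complex number [c + i s]. *)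
Fixpoint cpow (c s : R) (n : nat) : R * R :=
  if n is m.+1 then let z := cpow c s m in (c * z.1 - s * z.2, s * z.1 + c * z.2)
  else (1, 0).

Lemma cpow_norm c s n :
  (cpow c s n).1 ^+ 2 + (cpow c s n).2 ^+ 2 = (c ^+ 2 + s ^+ 2) ^+ n.
Proof.
elim: n => [|n IH] /=; first by rewrite expr0 expr1n expr0n addr0.
by rewrite (exprS _ n) -IH; ring.
Qed.

(** Multiplicativity of characteristic functions under convolution: the inner
    integral is the same statement at phase [th + xi . u]. *)
Lemma one_plus_cf_convolution_power g n xi th : density g ->
  (\int[mu]_y (convolution_power g n.+1 y * (1 + cos (dot xi y + th))%:E) =
  (1 + (cpow (cf_cos g xi) (cf_sin g xi) n.+1).1 * cos th -
   (cpow (cf_cos g xi) (cf_sin g xi) n.+1).2 * sin th)%:E)%E.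
Proof.
move=> dg; have [g0 mg g1] := dg.
elim: n th => [|n IH] th.
  transitivity (one_plus_cf g xi th).
    by rewrite /one_plus_cf; apply: eq_integral => y _; rewrite EFinM.
  by rewrite one_plus_cfE//=; congr EFin; ring.
have mEg : measurable_fun setT (EFin \o g) by exact/measurable_EFinP.
have Eg0 x : (0 <= (EFin \o g) x)%E by rewrite lee_fin.
have mh := measurable_convolutions n (fun=> g0) (fun=> mg).
have h0 := convolutions_ge0 n (fun _ : nat => g0).
rewrite convolutionsE in mh h0.
have mt d' (T' : measurableType d') (f : T' -> E) : measurable_fun setT f ->
    measurable_fun setT (fun x => (1 + cos (dot xi (f x) + th))%:E).
  move=> mf; apply/measurable_EFinP; apply: measurable_funD => //.
  apply: measurable_cos_comp; apply: measurable_funD => //.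
  exact: measurable_dot.
have t0 x : (0 <= (1 + cos (dot xi x + th))%:E)%E by rewrite lee_fin one_plus_cos_ge0.
rewrite [LHS](integral_convolution mEg Eg0 mh h0 (mt _ _ id _) t0)//.
pose k (p : E * E) : \bar R := ((g p.2)%:E * (convolution_power g n.+1 p.1 *
  (1 + cos (dot xi (eadd p.2 p.1) + th))%:E))%E.
have mk : measurable_fun setT k.
  apply: emeasurable_funM; first by apply: (measurableT_comp mEg).
  apply: emeasurable_funM; first by apply: (measurableT_comp mh).
  by apply: (mt _ _ (fun p : E * E => eadd p.2 p.1)); exact: measurable_eadd.
have k0 p : (0 <= k p)%E by rewrite !mule_ge0 ?lee_fin ?one_plus_cos_ge0.
transitivity (\int[mu]_y \int[mu]_u k (y, u))%E.
  apply: eq_integral => y _; rewrite -ge0_integralZl//.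
  - by apply: eq_integral => u _; rewrite /k muleCA.
  - apply: emeasurable_funM => //; apply: (mt _ _ (fun u => eadd u y)).
    exact: measurable_eadd.
  - by move=> u _; rewrite mule_ge0.
rewrite (fubini_tonelli k)//.
transitivity (\int[mu]_u (g u * (1 +
   (cpow (cf_cos g xi) (cf_sin g xi) n.+1).1 * cos (dot xi u + th) -
   (cpow (cf_cos g xi) (cf_sin g xi) n.+1).2 * sin (dot xi u + th)))%:E)%E.
  apply: eq_integral => u _; rewrite EFinM -IH /k /= ge0_integralZl ?lee_fin//.
  - congr (_ * _)%E; apply: eq_integral => y _; rewrite dotDr.
    by congr (_ * (1 + cos _)%:E)%E; ring.
  - apply: emeasurable_funM => //; apply: (mt _ _ (fun y => eadd u y)).
    exact: measurable_eadd.
  - by move=> y _; rewrite mule_ge0.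
set a := (cpow _ _ n.+1).1; set b := (cpow _ _ n.+1).2.
transitivity (\int[mu]_u (g u * (1 + (a * cos th - b * sin th) * cos (dot xi u) +
   (- a * sin th - b * cos th) * sin (dot xi u)))%:E)%E.
  by apply: eq_integral => u _; rewrite cosD sinD; congr EFin; ring.
rewrite integral_trig_density//; congr EFin.
have -> : (cpow (cf_cos g xi) (cf_sin g xi) n.+2).1 = cf_cos g xi * a - cf_sin g xi * b by [].
have -> : (cpow (cf_cos g xi) (cf_sin g xi) n.+2).2 = cf_sin g xi * a + cf_cos g xi * b by [].
by ring.
Qed.

Lemma measurable_cf_cos g : density g -> measurable_fun setT (cf_cos g).
Proof.
move=> dg; rewrite (_ : cf_cos g = fun xi => fine (one_plus_cf g xi 0) - 1).
  apply: measurable_funB => //; apply: (measurableT_comp (f := fine)) => //.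
  apply: (measurable_one_plus_cf (phase := fun=> 0)) => //.
    exact: density_ge0 dg.
  exact: density_measurable dg.
by apply/funext => xi; rewrite one_plus_cfE// cos0 sin0 /=; ring.
Qed.

Lemma measurable_cf_sin g : density g -> measurable_fun setT (cf_sin g).
Proof.
move=> dg; rewrite (_ : cf_sin g = fun xi => 1 - fine (one_plus_cf g xi (pi / 2))).
  apply: measurable_funB => //; apply: (measurableT_comp (f := fine)) => //.
  apply: (measurable_one_plus_cf (phase := fun=> pi / 2)) => //.
    exact: density_ge0 dg.
  exact: density_measurable dg.
by apply/funext => xi; rewrite one_plus_cfE// cos_pihalf sin_pihalf /=; ring.
Qed.

Definition cf_sqr (g : E -> R) (xi : E) : R := cf_cos g xi ^+ 2 + cf_sin g xi ^+ 2.

Lemma cf_sqr_ge0 g xi : 0 <= cf_sqr g xi.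
Proof. by rewrite addr_ge0 ?sqr_ge0. Qed.

Lemma measurable_cf_sqr g : density g -> measurable_fun setT (cf_sqr g).
Proof.
move=> dg; apply: measurable_funD; apply: measurable_funX.
  exact: measurable_cf_cos.
exact: measurable_cf_sin.
Qed.

Lemma integral_heat c (y : E) : 0 < c ->
  (\int[mu]_u (heat c (esub y u))%:E = (Num.sqrt (2 * pi * c) ^+ D)%:E)%E.
Proof.
move=> c0; have mh : measurable_fun setT (fun u : E => (heat c u)%:E).
  by apply/measurable_EFinP; exact: measurable_heat.
rewrite (@ge0_integral_esub _ _ _ (fun u => (heat c u)%:E))//; last first.
  by move=> u; rewrite lee_fin heat_ge0.
have ci0 : 0 < c^-1 by rewrite invr_gt0.
have := @integral_gauss R D _ ci0; rewrite invrK => <-.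
apply: eq_integral => u _; congr (expR (- _))%:E.
by field; rewrite gt_eqF.
Qed.

(** Plancherel's inequality with a Gaussian weight: the average over [y], with
    density [g], of [heat_representation] at [y] contains the weighted integral
    of [|phi|^2], and the smoothing of [g] is at most [B] times the mass of the
    heat kernel. *)
Let integral_freq_gauss_cf_sqr g (B c : R) : density g -> (forall x, g x <= B) -> 0 < c ->
  (\int[mu]_xi (freq_gauss c xi * cf_sqr g xi)%:E <= (B * (2 * pi) ^+ D)%:E)%E.
Proof.
move=> dg gB c0; have [g0 mg g1] := dg.
have B0 : 0 <= B by exact: le_trans (g0 [tuple 0 | i < D]) (gB _).
pose f (p : E * E) : R := g p.1 * (freq_gauss c p.2 *
  (1 + cf_cos g p.2 * cos (dot p.2 p.1) + cf_sin g p.2 * sin (dot p.2 p.1))).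
have opc0 xi y := trig_cf_ge0 xi (dot xi y) dg.
have f0 p : 0 <= f p by rewrite !mulr_ge0// freq_gauss_ge0.
have mdot : measurable_fun setT (fun p : E * E => dot p.2 p.1) by exact: measurable_dot.
have mf : measurable_fun setT f.
  apply: measurable_funM; first exact: (measurableT_comp mg).
  apply: measurable_funM; first exact: (measurableT_comp (measurable_freq_gauss c)).
  apply: measurable_funD; first apply: measurable_funD => //.
    apply: measurable_funM; first exact: (measurableT_comp (measurable_cf_cos dg)).
    exact: measurable_cos_comp.
  apply: measurable_funM; first exact: (measurableT_comp (measurable_cf_sin dg)).
  exact: measurable_sin_comp.
pose A := Num.sqrt (2 * pi / c) ^+ D; pose A' := Num.sqrt (2 * pi * c) ^+ D.
have A0 : 0 <= A by rewrite exprn_ge0// sqrtr_ge0.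
have A'0 : 0 <= A' by rewrite exprn_ge0// sqrtr_ge0.
have AA' : A * A' = (2 * pi) ^+ D.
  rewrite /A /A' -exprMn -sqrtrM ?divr_ge0 ?mulr_ge0 ?pi_ge0 ?(ltW c0)//.
  have -> : 2 * pi / c * (2 * pi * c) = (2 * pi) ^+ 2 by field; rewrite gt_eqF.
  by rewrite sqrtr_sqr ger0_norm// mulr_ge0 ?pi_ge0.
have mhe (y : E) : measurable_fun setT (fun u => heat c (esub y u)).
  by apply: (measurableT_comp (measurable_heat c)); exact: measurable_esub.
have le1 : (\int[mu]_y \int[mu]_xi (f (y, xi))%:E <= (A + B * (2 * pi) ^+ D)%:E)%E.
  apply: (@le_trans _ _ (\int[mu]_y ((A * (1 + B * A')) * g y)%:E)%E); last first.
    rewrite EFin_integralZl ?mulr_ge0 ?addr_ge0 ?mulr_ge0// g1 mule1 lee_fin -AA'.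
    by rewrite le_eqVlt; apply/orP; left; apply/eqP; ring.
  apply: ge0_le_integral => //.
  - by move=> y _; apply: integral_ge0 => xi _; rewrite lee_fin.
  - exact: measurable_EFin_integral.
  - by apply/measurable_EFinP; exact: measurable_funM.
  move=> y _; rewrite /f /=.
  have -> : (\int[mu]_xi (g y * (freq_gauss c xi * (1 + cf_cos g xi * cos (dot xi y) +
      cf_sin g xi * sin (dot xi y))))%:E =
      (g y)%:E * \int[mu]_xi ((freq_gauss c xi)%:E * one_plus_cf g xi (- dot xi y)))%E.
    rewrite EFin_integralZl//.
    - congr (_ * _)%E; apply: eq_integral => xi _.
      by rewrite one_plus_cfN// EFinM.
    - apply: measurable_funM; first exact: measurable_freq_gauss.
      apply: measurable_funD; first apply: measurable_funD => //.
        apply: measurable_funM; first exact: measurable_cf_cos.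
        by apply: measurable_cos_comp; exact: measurable_dot.
      apply: measurable_funM; first exact: measurable_cf_sin.
      by apply: measurable_sin_comp; exact: measurable_dot.
    - by move=> xi; rewrite mulr_ge0 ?freq_gauss_ge0.
  rewrite heat_representation// -/A g1 [leRHS]EFinM [leRHS]muleC.
  apply: lee_wpmul2l; first by rewrite lee_fin.
  rewrite EFinM; apply: lee_wpmul2l; first by rewrite lee_fin.
  rewrite (EFinD 1 (B * A')); apply: leeD2l.
  rewrite EFinM -[A'%:E](integral_heat y c0) -EFin_integralZl//; last first.
    by move=> u; exact: heat_ge0.
  apply: EFin_le_integral.
  - exact: measurable_funM.
  - exact: measurable_funM.
  - by move=> u; rewrite mulr_ge0 ?heat_ge0.
  - by move=> u; rewrite ler_wpM2r ?heat_ge0.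
have mw : measurable_fun setT (freq_gauss c : E -> R) by exact: measurable_freq_gauss.
have mwP : measurable_fun setT (fun xi => freq_gauss c xi * cf_sqr g xi).
  by apply: measurable_funM => //; exact: measurable_cf_sqr.
have E2 : (\int[mu]_y \int[mu]_xi (f (y, xi))%:E =
    A%:E + \int[mu]_xi (freq_gauss c xi * cf_sqr g xi)%:E)%E.
  rewrite EFin_tonelli//.
  have <- : (\int[mu]_xi (freq_gauss c xi)%:E = A%:E)%E by exact: integral_gauss.
  rewrite -EFin_integralD//; last 2 first.
  - exact: freq_gauss_ge0.
  - by move=> xi; rewrite mulr_ge0 ?freq_gauss_ge0 ?cf_sqr_ge0.
  apply: eq_integral => xi _; rewrite /f /=.
  transitivity (\int[mu]_y (freq_gauss c xi *
    (g y * (1 + cf_cos g xi * cos (dot xi y) + cf_sin g xi * sin (dot xi y))))%:E)%E.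
    by apply: eq_integral => y _; congr EFin; ring.
  rewrite EFin_integralZl ?freq_gauss_ge0//.
  - by rewrite integral_trig_density// -EFinM /cf_sqr; congr EFin; ring.
  - by apply: measurable_funM => //; exact: measurable_trig.
  - by move=> y; rewrite mulr_ge0.
by move: le1; rewrite E2 EFinD leeD2lE.
Qed.

(** The weighted bound is uniform in the weight, which increases to [1]:
    monotone convergence concludes. *)
Lemma integral_cf_sqr_le g (B : R) : density g -> (forall x, g x <= B) ->
  (\int[mu]_xi (cf_sqr g xi)%:E <= (B * (2 * pi) ^+ D)%:E)%E.
Proof.
move=> dg gB.
pose h (n : nat) xi := (freq_gauss n.+1%:R^-1 xi * cf_sqr g xi)%:E.
have hcvg xi : h n xi @[n --> \oo] --> (cf_sqr g xi)%:E.
  apply: cvg_EFin; first exact: nearW.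
  rewrite -[X in _ --> X]mul1r; apply: cvgM; last exact: cvg_cst.
  rewrite -[X in _ --> X]expR0; apply: continuous_cvg; first exact: continuous_expR.
  rewrite -[X in _ --> X]oppr0; apply: cvgN.
  rewrite -[X in _ --> X](mul0r 2^-1); apply: cvgM; last exact: cvg_cst.
  rewrite -[X in _ --> X](mul0r (dot xi xi)); apply: cvgM; last exact: cvg_cst.
  exact: cvg_harmonic.
have mh n : measurable_fun setT (h n).
  apply/measurable_EFinP; apply: measurable_funM; first exact: measurable_freq_gauss.
  exact: measurable_cf_sqr.
have h0 n xi : (0 <= h n xi)%E.
  by rewrite lee_fin mulr_ge0 ?freq_gauss_ge0 ?cf_sqr_ge0.
have hnd xi : nondecreasing_seq (h ^~ xi).
  move=> m n mn; rewrite lee_fin ler_wpM2r ?cf_sqr_ge0// ler_expR lerN2.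
  rewrite ler_wpM2r// ler_wpM2r ?dotxx_ge0// lef_pV2 ?posrE//.
  by rewrite ler_nat.
have := @monotone_convergence _ _ R mu setT measurableT h mh (fun n x _ => h0 n x) (fun x _ => hnd x).
under eq_integral => xi _ do rewrite (cvg_lim _ (hcvg xi))//.
move=> ->; apply: lime_le.
  apply: ereal_nondecreasing_is_cvgn => m n mn; apply: ge0_le_integral => //.
  by move=> x _; exact: hnd.
by apply: nearW => n; apply: integral_freq_gauss_cf_sqr; rewrite ?invr_gt0.
Qed.

End characteristic_function.

(** * Inequalities for scalars *)

Section scalar_bounds.
Context (R : realType).

Lemma expr_le_expR (m : nat) (y : R) : 0 <= y -> y ^+ m <= m.+1%:R ^+ m * expR y.
Proof.
move=> y0; have m0 : (0 : R) < m.+1%:R by [].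
have h : y / m.+1%:R <= expR (y / m.+1%:R).
  by apply: le_trans (expR_ge1Dx _); rewrite lerDr.
have -> : y ^+ m = m.+1%:R ^+ m * (y / m.+1%:R) ^+ m.
  by rewrite -exprMn mulrC divfK// gt_eqF.
apply: ler_wpM2l; first exact: exprn_ge0.
apply: (@le_trans _ _ (expR (y / m.+1%:R) ^+ m)).
  by apply: lerXn2r => //; rewrite nnegrE ?expR_ge0// divr_ge0.
rewrite -expRM_natl ler_expR mulrC mulrAC ler_pdivrMr// ler_wpM2l//.
by rewrite ler_nat.
Qed.

(** The mean value theorem, in the form that integrates one Taylor bound into the
    next. *)
Lemma le_derive_bound (f df : R -> R) (K : R -> R) (v : R) :
  (forall x : R, is_derive x (1 : R) f (df x)) -> f 0 = 0 ->
  (forall x, `|x| <= `|v| -> `|df x| <= K v) -> `|f v| <= `|v| * K v.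
Proof.
move=> hd f0 hK.
have cf : continuous f.
  by move=> x; apply/differentiable_continuous/derivable1_diffP; case: (hd x).
have [v0|v0|v0] := ltgtP 0 v; last by rewrite -v0 f0 normr0 mul0r.
- have [c /andP[c0 cv]] := @MVT_segment R f df 0 v (ltW v0) (fun x _ => hd x) (continuous_subspaceT cf).
  rewrite f0 !subr0 => ->; rewrite normrM mulrC ler_wpM2l//; apply: hK.
  by rewrite (ger0_norm c0) ger0_norm// ltW.
- have [c /andP[cv c0]] := @MVT_segment R f df v 0 (ltW v0) (fun x _ => hd x) (continuous_subspaceT cf).
  rewrite f0 !sub0r => /eqP; rewrite eqr_oppLR => /eqP ->.
  rewrite normrN normrM normrN mulrC ler_wpM2l//; apply: hK.
  by rewrite (ler0_norm c0) ltr0_norm// lerN2.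
Qed.

Lemma abs_sin_le (v : R) : `|sin v| <= `|v|.
Proof.
rewrite -[leRHS]mulr1; apply: (le_derive_bound (df := @cos R) (K := fun=> 1)).
- by rewrite sin0.
- by move=> x _; rewrite ler_norml cos_geN1 cos_le1.
Qed.

Lemma one_sub_cosE (v : R) : 1 - cos v = 2 * sin (v / 2) ^+ 2.
Proof.
have {1}-> : v = v / 2 + v / 2 by rewrite -splitr.
by rewrite cosD -!expr2; have := cos2Dsin2 (v / 2); lra.
Qed.

Lemma one_sub_cos_le_abs (v : R) : `|1 - cos v| <= `|v|.
Proof.
rewrite -[leRHS]mulr1.
apply: (le_derive_bound (f := fun v => 1 - cos v) (df := @sin R) (K := fun=> 1)).
- by move=> x; apply: is_derive_eq; rewrite /GRing.scale/=; ring.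
- by rewrite cos0 subrr.
- by move=> x _; rewrite ler_norml sin_geN1 sin_le1.
Qed.

Lemma one_sub_cos_le_sqr (v : R) : `|1 - cos v| <= `|v| ^+ 2.
Proof.
rewrite expr2; apply: (le_derive_bound (f := fun v => 1 - cos v) (df := @sin R) (K := fun v => `|v|)).
- by move=> x; apply: is_derive_eq; rewrite /GRing.scale/=; ring.
- by rewrite cos0 subrr.
- by move=> x xv; apply: le_trans xv; exact: abs_sin_le.
Qed.

Lemma sub_sin_le_cube (v : R) : `|v - sin v| <= `|v| ^+ 3.
Proof.
rewrite exprS; apply: (le_derive_bound (f := fun v => v - sin v) (df := fun v => 1 - cos v) (K := fun v => `|v| ^+ 2)).
- by rewrite sin0 subrr.
- by move=> x xv; apply: (le_trans (one_sub_cos_le_sqr x)); apply: lerXn2r.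
Qed.

Lemma sub_sin_le_sqr (v : R) : `|v - sin v| <= `|v| ^+ 2.
Proof.
rewrite expr2; apply: (le_derive_bound (f := fun v => v - sin v) (df := fun v => 1 - cos v) (K := fun v => `|v|)).
- by rewrite sin0 subrr.
- by move=> x xv; apply: le_trans xv; exact: one_sub_cos_le_abs.
Qed.

Lemma cos_taylor_le_cube (v : R) : `|cos v - 1 + v ^+ 2 / 2| <= `|v| ^+ 3.
Proof.
rewrite exprS; apply: (le_derive_bound (f := fun v => cos v - 1 + v ^+ 2 / 2)
  (df := fun v => v - sin v) (K := fun v => `|v| ^+ 2)).
- by move=> x; apply: is_derive_eq; rewrite /GRing.scale/=; field.
- by rewrite cos0 subrr expr0n mul0r addr0.
- by move=> x xv; apply: (le_trans (sub_sin_le_sqr x)); apply: lerXn2r.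
Qed.

Lemma expRN_taylor (t : R) : 0 <= t -> `|expR (- t) - 1 + t| <= t ^+ 2.
Proof.
move=> t0; rewrite ger0_norm; last by have := expR_ge1Dx (- t); lra.
have : expR (- t) <= (1 + t)^-1.
  by rewrite expRN lef_pV2 ?posrE ?expR_gt0 ?expR_ge1Dx// ltr_wpDr.
have : (1 + t)^-1 <= 1 - t + t ^+ 2.
  rewrite -[leLHS]div1r ler_pdivrMr ?ltr_wpDr//.
  have := exprn_ge0 3 t0; lra.
lra.
Qed.

Lemma abs_sin_natmul_le (m : nat) (v : R) : `|sin (m%:R * v)| <= m%:R * `|sin v|.
Proof.
elim: m => [|m IH]; first by rewrite !mul0r sin0 normr0.
rewrite -natr1 !mulrDl !mul1r sinD (le_trans (ler_normD _ _))// lerD//.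
  by rewrite normrM (le_trans _ IH)// ler_piMr// ler_norml cos_geN1 cos_le1.
by rewrite normrM ler_piMl// ler_norml cos_geN1 cos_le1.
Qed.

(** [1 - cos v = 2 sin (v/2)^2], and [|sin (m v)| <= m |sin v|]. *)
Lemma one_sub_cos_natmul_le (m : nat) (u : R) :
  1 - cos (m%:R * u) <= m%:R ^+ 2 * (1 - cos u).
Proof.
rewrite !one_sub_cosE [leRHS]mulrCA ler_pM2l// -[(_ * u / 2)]mulrA -exprMn.
rewrite -[leLHS]real_normK ?num_real// -[leRHS]real_normK ?num_real//.
by apply: lerXn2r; rewrite ?nnegrE// normrM normr_nat abs_sin_natmul_le.
Qed.

(** The triangle inequality in the plane, without square roots. *)
Lemma triangle_sqr (u1 u2 v1 v2 U V : R) : 0 <= U -> 0 <= V ->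
  u1 ^+ 2 + u2 ^+ 2 <= U ^+ 2 -> v1 ^+ 2 + v2 ^+ 2 <= V ^+ 2 ->
  (u1 + v1) ^+ 2 + (u2 + v2) ^+ 2 <= (U + V) ^+ 2.
Proof.
move=> U0 V0 uU vV.
have cs : (u1 * v1 + u2 * v2) ^+ 2 <= (U * V) ^+ 2.
  apply: (@le_trans _ _ ((u1 ^+ 2 + u2 ^+ 2) * (v1 ^+ 2 + v2 ^+ 2))).
    by have := sqr_ge0 (u1 * v2 - u2 * v1); lra.
  by rewrite exprMn; apply: ler_pM => //; rewrite addr_ge0 ?sqr_ge0.
have : u1 * v1 + u2 * v2 <= U * V.
  apply: (le_trans (ler_norm _)).
  by rewrite -(ler_pXn2r (n:=2))// ?nnegrE ?mulr_ge0// real_normK ?num_real.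
lra.
Qed.

Lemma cauchy_schwarz_unit (a b c s t : R) : 0 <= t -> c ^+ 2 + s ^+ 2 = 1 ->
  a ^+ 2 + b ^+ 2 <= t ^+ 2 -> a * c + b * s <= t.
Proof.
move=> t0 cs ab; apply: (le_trans (ler_norm _)).
rewrite -(ler_pXn2r (n:=2))// ?nnegrE// real_normK ?num_real// (le_trans _ ab)//.
rewrite -[leRHS]mulr1 -cs.
by have := sqr_ge0 (a * s - b * c); lra.
Qed.

End scalar_bounds.

(** * Taylor expansion of the characteristic function *)

Section telescoping.
Context (R : realType).

(** [z^(n+1) - w^(n+1) = z (z^n - w^n) + (z - w) w^n] for [z = c + i s]. *)
Lemma cpow_sub_le (c s w delta rho : R) (n : nat) :
  0 <= delta -> 0 <= w <= rho ->
  (c - w) ^+ 2 + s ^+ 2 <= delta ^+ 2 -> c ^+ 2 + s ^+ 2 <= rho ^+ 2 ->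
  ((cpow c s n.+1).1 - w ^+ n.+1) ^+ 2 + (cpow c s n.+1).2 ^+ 2 <=
  (n.+1%:R * delta * rho ^+ n) ^+ 2.
Proof.
move=> d0 /andP[w0 wr] hd hr; have r0 : 0 <= rho by exact: le_trans wr.
elim: n => [|n IH].
  by rewrite /= !(mulr0, mulr1, subr0, addr0, expr1, mul1r, expr0).
set a := (cpow c s n.+1).1 in IH *; set b := (cpow c s n.+1).2 in IH *.
have -> : (cpow c s n.+2).1 = c * a - s * b by [].
have -> : (cpow c s n.+2).2 = s * a + c * b by [].
have -> : c * a - s * b - w ^+ n.+2 =
    (c * (a - w ^+ n.+1) - s * b) + (c - w) * w ^+ n.+1 by rewrite (exprS w n.+1); ring.
have -> : s * a + c * b = (s * (a - w ^+ n.+1) + c * b) + s * w ^+ n.+1 by ring.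
have -> : n.+2%:R * delta * rho ^+ n.+1 =
    rho * (n.+1%:R * delta * rho ^+ n) + delta * rho ^+ n.+1.
  by rewrite (exprS rho n) -[n.+2%:R]natr1; ring.
apply: triangle_sqr.
- by rewrite !mulr_ge0 ?exprn_ge0.
- by rewrite mulr_ge0 ?exprn_ge0.
- have -> : (c * (a - w ^+ n.+1) - s * b) ^+ 2 + (s * (a - w ^+ n.+1) + c * b) ^+ 2 =
    (c ^+ 2 + s ^+ 2) * ((a - w ^+ n.+1) ^+ 2 + b ^+ 2) by ring.
  by rewrite exprMn ler_pM// addr_ge0 ?sqr_ge0.
- have -> : ((c - w) * w ^+ n.+1) ^+ 2 + (s * w ^+ n.+1) ^+ 2 =
    ((c - w) ^+ 2 + s ^+ 2) * (w ^+ n.+1) ^+ 2 by ring.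
  rewrite exprMn ler_pM ?addr_ge0 ?sqr_ge0//.
  by apply: lerXn2r; rewrite ?nnegrE ?exprn_ge0//; apply: lerXn2r.
Qed.

End telescoping.

Section moments.
Context (R : realType) (D : nat).
Local Notation E := (euclid R D).
Local Notation mu := (lebesgue R D).
Variables (g : E -> R) (M : R).
Hypothesis dg : density g.
Hypothesis g3 : (\int[mu]_x (enorm x ^+ 3 * g x)%:E = M%:E)%E.

Implicit Types h k : E -> R.

Definition expectation (h : E -> R) : R := \int[mu]_x (g x * h x).

(** The functions against which [g] can be integrated termwise, thanks to its
    finite third moment. *)
Definition cubic_growth (h : E -> R) :=
  measurable_fun setT h /\ exists C : R, forall x, `|h x| <= C * (1 + enorm x ^+ 3).

Let mnorm : measurable_fun setT (fun x : E => enorm x).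
Proof. exact: measurable_enorm. Qed.

Lemma cubic_growth_integrable h : cubic_growth h ->
  mu.-integrable setT (EFin \o (fun x => g x * h x)).
Proof.
move=> [mh [C hC]]; have [g0 mg _] := dg.
have i3 : mu.-integrable setT (EFin \o (fun x => enorm x ^+ 3 * g x)).
  apply/integrableP; split.
    apply/measurable_EFinP; apply: measurable_funM => //.
    by apply: measurable_funX.
  under eq_integral do rewrite gee0_abs ?lee_fin ?mulr_ge0 ?exprn_ge0 ?enorm_ge0//.
  by rewrite g3 ltry.
have iC := integrableZl measurableT C (integrableD measurableT (density_integrable dg) i3).
apply: (le_integrable measurableT _ _ iC).
  by apply/measurable_EFinP; exact: measurable_funM.
move=> x _; rewrite /= lee_fin normrM (ger0_norm (g0 x)) (le_trans _ (ler_norm _))//.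
apply: (le_trans (ler_wpM2l (g0 x) (hC x))).
by rewrite le_eqVlt; apply/orP; left; apply/eqP; ring.
Qed.

Lemma cubic_growthD h k : cubic_growth h -> cubic_growth k ->
  cubic_growth (fun x => h x + k x).
Proof.
move=> [mh [C hC]] [mk [C' kC]]; split; first exact: measurable_funD.
exists (C + C') => x; rewrite mulrDl (le_trans (ler_normD _ _))// lerD//.
Qed.

Lemma cubic_growthZ a h : cubic_growth h -> cubic_growth (fun x => a * h x).
Proof.
move=> [mh [C hC]]; split; first exact: measurable_funM.
by exists (`|a| * C) => x; rewrite normrM -mulrA ler_wpM2l.
Qed.

Lemma cubic_growth_le h : measurable_fun setT h ->
  (forall x, `|h x| <= 1 + enorm x ^+ 3) -> cubic_growth h.
Proof. by move=> mh hle; split => //; exists 1 => x; rewrite mul1r. Qed.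

Lemma cubic_growth_sum (I : Type) (s : seq I) (h : I -> E -> R) :
  (forall i, cubic_growth (h i)) -> cubic_growth (fun x => \sum_(i <- s) h i x).
Proof.
move=> hc; elim: s => [|i s IH].
  apply: cubic_growth_le; first by under eq_fun do rewrite big_nil; exact: measurable_cst.
  by move=> x; rewrite big_nil normr0 addr_ge0 ?exprn_ge0 ?enorm_ge0.
by under eq_fun do rewrite big_cons; exact: cubic_growthD.
Qed.

Lemma expectationD h k : cubic_growth h -> cubic_growth k ->
  expectation (fun x => h x + k x) = expectation h + expectation k.
Proof.
move=> ch ck; rewrite /expectation -RintegralD//; last 2 first.
- exact: cubic_growth_integrable.
- exact: cubic_growth_integrable.
by apply: eq_Rintegral => x _; rewrite mulrDr.
Qed.

Lemma expectationZ a h : cubic_growth h ->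
  expectation (fun x => a * h x) = a * expectation h.
Proof.
move=> ch; rewrite /expectation -RintegralZl//; last exact: cubic_growth_integrable.
by apply: eq_Rintegral => x _; rewrite mulrCA.
Qed.

Lemma expectation_sum (I : Type) (s : seq I) (h : I -> E -> R) :
  (forall i, cubic_growth (h i)) ->
  expectation (fun x => \sum_(i <- s) h i x) = \sum_(i <- s) expectation (h i).
Proof.
move=> hc; elim: s => [|i s IH].
  rewrite big_nil /expectation; under eq_Rintegral do rewrite big_nil mulr0.
  by rewrite Rintegral_cst// mul0r.
rewrite big_cons -IH -expectationD//; last exact: cubic_growth_sum.
by apply: eq_Rintegral => x _; rewrite big_cons.
Qed.

Lemma abs_expectation_le h k : cubic_growth h -> cubic_growth k ->
  (forall x, `|h x| <= k x) -> `|expectation h| <= expectation k.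
Proof.
move=> ch ck hk; have [g0 _ _] := dg.
have ih := cubic_growth_integrable ch; have ik := cubic_growth_integrable ck.
apply: (le_trans (le_normr_Rintegral measurableT ih)).
apply: le_Rintegral => //.
  exact: integrable_norm.
by move=> x _; rewrite normrM (ger0_norm (g0 x)) ler_wpM2l.
Qed.

Let enorm_le (x : E) : enorm x <= 1 + enorm x ^+ 3.
Proof.
have := enorm_ge0 x; move: (enorm x) => t t0.
have [t1|t1] := leP t 1; first by rewrite (le_trans t1)// lerDl exprn_ge0.
by rewrite (@le_trans _ _ (t ^+ 3))// ?lerDr// -[leLHS]expr1 ler_weXn2l// ltW.
Qed.

Let enorm2_le (x : E) : enorm x ^+ 2 <= 1 + enorm x ^+ 3.
Proof.
have := enorm_ge0 x; move: (enorm x) => t t0.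
have [t1|t1] := leP t 1; first by rewrite (@le_trans _ _ 1) ?exprn_ile1// lerDl exprn_ge0.
by rewrite (@le_trans _ _ (t ^+ 3))// ?lerDr// ler_weXn2l// ltW.
Qed.

Let mcoord i : measurable_fun setT (fun x : E => coord x i).
Proof. exact: (@measurable_coord _ _ R D id). Qed.

Lemma cubic_growth_coord i : cubic_growth (fun x => coord x i).
Proof.
apply: cubic_growth_le => // x.
exact: le_trans (abs_coord_le x i) (enorm_le x).
Qed.

Lemma cubic_growth_coord2 i j : cubic_growth (fun x => coord x i * coord x j).
Proof.
apply: cubic_growth_le => [|x]; first exact: measurable_funM.
rewrite (le_trans _ (enorm2_le x))// normrM expr2.
by rewrite ler_pM ?normr_ge0 ?abs_coord_le.
Qed.

Lemma cubic_growth_enorm3 : cubic_growth (fun x => enorm x ^+ 3).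
Proof.
apply: cubic_growth_le => [|x]; first exact: measurable_funX.
by rewrite ger0_norm ?exprn_ge0 ?enorm_ge0// lerDr.
Qed.

Lemma cubic_growth_bounded h : measurable_fun setT h ->
  (forall x, `|h x| <= 1) -> cubic_growth h.
Proof.
move=> mh h1; apply: cubic_growth_le => // x.
by rewrite (le_trans (h1 x))// lerDl exprn_ge0// enorm_ge0.
Qed.

Hypothesis gcent : forall i, (\int[mu]_x (coord x i * g x)%:E = 0)%E.
Hypothesis gcov : forall i j, (\int[mu]_x (coord x i * coord x j * g x)%:E =
    ((i == j)%:R)%:E)%E.

Lemma expectation_coord i : expectation (fun x => coord x i) = 0.
Proof.
transitivity (fine (\int[mu]_x (coord x i * g x)%:E)); last by rewrite gcent.
by congr fine; apply: eq_integral => x _; rewrite mulrC.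
Qed.

Lemma expectation_coord2 i j :
  expectation (fun x => coord x i * coord x j) = (i == j)%:R.
Proof.
transitivity (fine (\int[mu]_x (coord x i * coord x j * g x)%:E)); last by rewrite gcov.
by congr fine; apply: eq_integral => x _; rewrite mulrC.
Qed.

Lemma expectation_enorm3 : expectation (fun x => enorm x ^+ 3) = M.
Proof.
transitivity (fine (\int[mu]_x (enorm x ^+ 3 * g x)%:E)); last by rewrite g3.
by congr fine; apply: eq_integral => x _; rewrite mulrC.
Qed.

Lemma expectation1 : expectation (fun=> 1) = 1.
Proof.
transitivity (fine (\int[mu]_x (g x)%:E)); last by rewrite (density_mass dg).
by congr fine; apply: eq_integral => x _; rewrite mulr1.
Qed.

Lemma cubic_growth_dot xi : cubic_growth (dot xi).
Proof.
by apply: cubic_growth_sum => i; apply: cubic_growthZ; exact: cubic_growth_coord.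
Qed.

Lemma expectation_dot xi : expectation (dot xi) = 0.
Proof.
rewrite expectation_sum; last by move=> i; apply: cubic_growthZ; exact: cubic_growth_coord.
rewrite big1// => i _; rewrite expectationZ ?expectation_coord ?mulr0//.
exact: cubic_growth_coord.
Qed.

Let dot_sqrE (xi x : E) : dot xi x ^+ 2 =
  \sum_i \sum_j (coord xi i * coord xi j) * (coord x i * coord x j).
Proof.
rewrite expr2 /dot mulr_suml; apply: eq_bigr => i _.
by rewrite mulr_sumr; apply: eq_bigr => j _; ring.
Qed.

Lemma cubic_growth_dot2 (xi : E) : cubic_growth (fun x => dot xi x ^+ 2).
Proof.
under eq_fun do rewrite dot_sqrE.
apply: cubic_growth_sum => i; apply: cubic_growth_sum => j.
by apply: cubic_growthZ; exact: cubic_growth_coord2.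
Qed.

Lemma expectation_dot2 (xi : E) : expectation (fun x => dot xi x ^+ 2) = dot xi xi.
Proof.
under [X in expectation X]eq_fun do rewrite dot_sqrE.
have c2 i j : cubic_growth (fun x => (coord xi i * coord xi j) * (coord x i * coord x j)).
  by apply: cubic_growthZ; exact: cubic_growth_coord2.
rewrite expectation_sum; last by move=> i; exact: cubic_growth_sum.
apply: eq_bigr => i _; rewrite expectation_sum// (bigD1 i)//= big1 ?addr0.
  rewrite expectationZ; last exact: cubic_growth_coord2.
  by rewrite expectation_coord2 eqxx mulr1.
move=> j ji; rewrite expectationZ; last exact: cubic_growth_coord2.
by rewrite expectation_coord2 eq_sym (negbTE ji) mulr0.
Qed.

Lemma cubic_growth_enorm2 : cubic_growth (fun x => enorm x ^+ 2).
Proof.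
apply: cubic_growth_le => [|x]; first exact: measurable_funX.
by rewrite ger0_norm ?exprn_ge0 ?enorm_ge0// enorm2_le.
Qed.

Lemma expectation_enorm2 : expectation (fun x => enorm x ^+ 2) = D%:R.
Proof.
under [X in expectation X]eq_fun do rewrite enorm_sqr /dot.
rewrite expectation_sum; last by move=> i; exact: cubic_growth_coord2.
under eq_bigr do rewrite expectation_coord2 eqxx.
by rewrite sumr_const card_ord.
Qed.

Lemma moment3_ge0 : 0 <= M.
Proof.
have [g0 _ _] := dg.
rewrite -lee_fin -g3; apply: integral_ge0 => x _.
by rewrite lee_fin mulr_ge0 ?exprn_ge0 ?enorm_ge0.
Qed.

Let dot3_le (xi x : E) : `|dot xi x| ^+ 3 <= enorm xi ^+ 3 * enorm x ^+ 3.
Proof. by rewrite -exprMn; apply: lerXn2r; rewrite ?nnegrE ?mulr_ge0 ?enorm_ge0 ?abs_dot_le. Qed.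

Let mdot xi : measurable_fun setT (fun x : E => dot xi x).
Proof. exact: measurable_dot. Qed.

Lemma cubic_growth_cos xi : cubic_growth (fun x => cos (dot xi x)).
Proof.
apply: cubic_growth_bounded; first exact: measurable_cos_comp.
by move=> x; exact: abs_cos_le1.
Qed.

Lemma cubic_growth_sin xi : cubic_growth (fun x => sin (dot xi x)).
Proof.
apply: cubic_growth_bounded; first exact: measurable_sin_comp.
by move=> x; exact: abs_sin_le1.
Qed.

Lemma cubic_growth_cst a : cubic_growth (fun=> a).
Proof.
split; first exact: measurable_cst.
by exists `|a| => x; rewrite ler_peMr// lerDl exprn_ge0// enorm_ge0.
Qed.

(** The Taylor polynomial of [cos] integrates to [1 - |xi|^2 / 2] because the
    covariance is the identity; the remainder is at most [|xi . x|^3]. *)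
Lemma cf_cos_taylor xi :
  `|cf_cos g xi - (1 - dot xi xi / 2)| <= M * enorm xi ^+ 3.
Proof.
have cc := cubic_growth_cos xi; have c1 := cubic_growth_cst (-1).
have c2 := cubic_growthZ 2^-1 (cubic_growth_dot2 xi).
have -> : cf_cos g xi - (1 - dot xi xi / 2) =
    expectation (fun x => cos (dot xi x) + (-1) + 2^-1 * dot xi x ^+ 2).
  rewrite expectationD//; last exact: cubic_growthD.
  rewrite expectationD// expectationZ; last exact: cubic_growth_dot2.
  rewrite expectation_dot2 -[X in expectation X + _ + _]/(fun x => cos (dot xi x)).
  have -> : expectation (fun=> -1) = -1.
    transitivity (-1 * expectation (fun=> 1)); last by rewrite expectation1 mulr1.
    rewrite -expectationZ; last exact: cubic_growth_cst.
    by apply: eq_Rintegral => x _; rewrite mulr1.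
  by rewrite /cf_cos /expectation; ring.
rewrite mulrC -expectation_enorm3 -expectationZ; last exact: cubic_growth_enorm3.
apply: abs_expectation_le.
- by apply: cubic_growthD => //; exact: cubic_growthD.
- by apply: cubic_growthZ; exact: cubic_growth_enorm3.
- move=> x; apply: le_trans (dot3_le xi x); apply: le_trans (cos_taylor_le_cube _).
  by rewrite [2^-1 * _]mulrC.
Qed.

(** The linear term integrates to zero because [g] is centered. *)
Lemma cf_sin_taylor xi : `|cf_sin g xi| <= M * enorm xi ^+ 3.
Proof.
have cs := cubic_growth_sin xi; have cd := cubic_growthZ (-1) (cubic_growth_dot xi).
have -> : cf_sin g xi = expectation (fun x => sin (dot xi x) + (-1) * dot xi x).
  rewrite expectationD// expectationZ; last exact: cubic_growth_dot.
  by rewrite expectation_dot mulr0 addr0.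
rewrite mulrC -expectation_enorm3 -expectationZ; last exact: cubic_growth_enorm3.
apply: abs_expectation_le.
- exact: cubic_growthD.
- by apply: cubic_growthZ; exact: cubic_growth_enorm3.
- move=> x; apply: le_trans (dot3_le xi x); apply: le_trans (sub_sin_le_cube _).
  by rewrite mulN1r distrC.
Qed.

End moments.

(** * The characteristic function away from the origin *)

Section fejer.
Context (R : realType).

(** [|sum_(j < n) e^(i j u)|^2], the Fejer kernel without normalization. *)
Definition fejer (n : nat) (u : R) : R :=
  \sum_(j < n) \sum_(l < n) cos ((j%:R - l%:R) * u).

Lemma fejerE n u : fejer n u =
  (\sum_(j < n) cos (j%:R * u)) ^+ 2 + (\sum_(j < n) sin (j%:R * u)) ^+ 2.
Proof.
rewrite !expr2 !mulr_suml -big_split/=; apply: eq_bigr => j _.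
rewrite !mulr_sumr -big_split/=; apply: eq_bigr => l _.
by rewrite mulrBl cosB.
Qed.

Lemma fejer_ge0 n u : 0 <= fejer n u.
Proof. by rewrite fejerE addr_ge0 ?sqr_ge0. Qed.

Lemma sum2_const n (a : R) : \sum_(j < n) \sum_(l < n) a = n%:R ^+ 2 * a.
Proof.
under eq_bigr do rewrite sumr_const card_ord.
by rewrite sumr_const card_ord -(mulr_natl (a *+ n)) -(mulr_natl a) mulrA expr2.
Qed.

Lemma fejer_le n u : fejer n u <= n%:R ^+ 2.
Proof.
rewrite -[leRHS]mulr1 -sum2_const; apply: ler_sum => j _; apply: ler_sum => l _.
exact: cos_le1.
Qed.

(** Each of the [n^2] terms falls short of [1] by [1 - cos (m u)] with [m < n]. *)
Lemma fejer_defect n u : n%:R ^+ 2 - fejer n u <= n%:R ^+ 4 * (1 - cos u).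
Proof.
have -> : n%:R ^+ 4 * (1 - cos u) = n%:R ^+ 2 * (n%:R ^+ 2 * (1 - cos u)) by ring.
rewrite -[X in X - _]mulr1 -[X in X - _]sum2_const -[leRHS]sum2_const -sumrB.
apply: ler_sum => j _.
rewrite -sumrB; apply: ler_sum => l _.
have c0 : 0 <= 1 - cos u by rewrite subr_ge0 cos_le1.
have main (a b : nat) : (b <= a)%N -> (a < n)%N ->
    1 - cos ((a%:R - b%:R) * u) <= n%:R ^+ 2 * (1 - cos u).
  move=> ba an; rewrite -natrB// (le_trans (one_sub_cos_natmul_le _ _))//.
  rewrite ler_wpM2r//; apply: lerXn2r; rewrite ?nnegrE// ler_nat.
  by rewrite (leq_trans (leq_subr _ _))// ltnW.
have [lj|jl] := leqP l j; first exact: main.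
rewrite -cosN -mulNr opprB; apply: main => //; exact: ltnW.
Qed.

End fejer.

Section separation.
Context (R : realType) (D : nat).
Local Notation E := (euclid R D).
Local Notation mu := (lebesgue R D).

Let measurable_fejer n th (xi : E) :
  measurable_fun setT (fun x => fejer n (dot xi x + th)).
Proof.
apply: measurable_sum => j; apply: measurable_sum => l.
apply: measurable_cos_comp; apply: measurable_funM => //.
by apply: measurable_funD => //; exact: measurable_dot.
Qed.

(** Only the [n] diagonal terms of the kernel keep a contribution of order one
    under the Gaussian; the others have a frequency of norm at least [|xi|]. *)
Let gauss_fejer n (c q th : R) (xi : E) : 0 < c -> 0 <= q -> q <= dot xi xi ->
  (\int[mu]_x (expR (- (c * dot x x / 2)) * fejer n (dot xi x + th))%:E <=
  (Num.sqrt (2 * pi / c) ^+ D * (n%:R + n%:R ^+ 2 * expR (- (q / (2 * c)))))%:E)%E.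
Proof.
move=> c0 q0 qxi; pose w x : R := expR (- (c * dot (x : E) x / 2)).
pose A := Num.sqrt (2 * pi / c) ^+ D.
have A0 : 0 <= A by rewrite exprn_ge0// sqrtr_ge0.
have mw : measurable_fun setT w by exact: measurable_freq_gauss.
have w0 x : 0 <= w x by exact: expR_ge0.
have mF := measurable_fejer n th xi.
pose t (j l : 'I_n) (x : E) : R :=
  w x * (1 + 1 * cos (dot (escale (j%:R - l%:R) xi) x + (j%:R - l%:R) * th)).
have mt j l : measurable_fun setT (fun x => (t j l x)%:E).
  exact: measurable_gauss_1cos.
have t0 j l x : (0 <= (t j l x)%:E)%E.
  by rewrite lee_fin mulr_ge0// one_cos_ge0// lexx ler01.
have E1 : (\int[mu]_x ((n%:R ^+ 2 * w x)%:E + (w x * fejer n (dot xi x + th))%:E) =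
    \sum_(j < n) \sum_(l < n) \int[mu]_x (t j l x)%:E)%E.
  transitivity (\int[mu]_x (\sum_(j < n) \sum_(l < n) (t j l x)%:E))%E.
    apply: eq_integral => x _; rewrite -EFinD -sum2_const.
    rewrite [RHS](eq_bigr (fun j => (\sum_(l < n) t j l x)%:E)); last first.
      by move=> j _; rewrite sumEFin.
    rewrite sumEFin; congr EFin.
    rewrite /fejer mulr_sumr -big_split/=; apply: eq_bigr => j _.
    rewrite mulr_sumr -big_split/=; apply: eq_bigr => l _.
    by rewrite /t dotZl mul1r -[_ * dot xi x + _]mulrDr [RHS]mulrDr mulr1.
  rewrite ge0_integral_sum//; last 2 first.
  - by move=> j; apply: emeasurable_sum => l.
  - by move=> j x _; exact: sume_ge0.
  by apply: eq_bigr => j _; rewrite ge0_integral_sum.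
have wE : (\int[mu]_x (n%:R ^+ 2 * w x)%:E = (n%:R ^+ 2 * A)%:E)%E.
  by rewrite EFin_integralZl ?exprn_ge0// integral_gauss.
have : ((n%:R ^+ 2 * A)%:E + \int[mu]_x (w x * fejer n (dot xi x + th))%:E <=
    (n%:R ^+ 2 * A + A * (n%:R + n%:R ^+ 2 * expR (- (q / (2 * c)))))%:E)%E.
  rewrite -wE -ge0_integralD//; last 4 first.
  - by move=> x _; rewrite lee_fin mulr_ge0 ?exprn_ge0.
  - by apply/measurable_EFinP; exact: measurable_funM.
  - by move=> x _; rewrite lee_fin mulr_ge0 ?fejer_ge0.
  - by apply/measurable_EFinP; exact: measurable_funM.
  rewrite E1; under eq_bigr => j _.
    under eq_bigr => l _ do rewrite integral_gauss_1cos ?lexx ?ler01//.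
    rewrite sumEFin; over.
  rewrite sumEFin lee_fin -/A.
  apply: (@le_trans _ _ (\sum_(j < n) \sum_(l < n)
      (A * (1 + expR (- (q / (2 * c)))) + A * (j == l)%:R))).
    apply: ler_sum => j _; apply: ler_sum => l _; rewrite -mulrDr ler_wpM2l//.
    rewrite mul1r -addrA lerD2l.
    apply: (@le_trans _ _ (expR (- (dot (escale (j%:R - l%:R) xi) (escale (j%:R - l%:R) xi) / (2 * c))))).
      by rewrite ler_piMr ?expR_ge0// cos_le1.
    have [jl|jl] := eqVneq j l.
      rewrite addrC ler_wpDr ?expR_ge0// -[leRHS]expR0 ler_expR oppr_le0.
      by rewrite divr_ge0 ?dotxx_ge0// mulr_ge0// ltW.
    rewrite addr0 ler_expR lerN2 dot_escale ler_wpM2r ?invr_ge0 ?mulr_ge0 ?(ltW c0)//.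
    apply: (le_trans qxi); rewrite ler_peMl ?dotxx_ge0//.
    wlog lj : j l jl / (l < j)%N.
      move=> wl; case: (ltngtP l j) => [|lj|/val_inj lj]; first exact: wl.
        by rewrite -sqrrN opprB; apply: wl; rewrite // eq_sym.
      by rewrite lj eqxx in jl.
    by rewrite -natrB ?(ltnW lj)// exprn_ege1// ler1n subn_gt0.
  under eq_bigr do rewrite big_split/=.
  rewrite big_split/= sum2_const.
  have -> : \sum_(j < n) \sum_(l < n) A * (j == l)%:R = n%:R * A.
    under eq_bigr => j _.
      rewrite (bigD1 j)//= eqxx mulr1 big1 ?addr0; last first.
        by move=> l lj; rewrite eq_sym (negbTE lj) mulr0.
      over.
    by rewrite sumr_const card_ord mulr_natl.
  by rewrite le_eqVlt; apply/orP; left; apply/eqP; ring.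
by rewrite [X in (_ <= X)%E]EFinD leeD2lE.
Qed.

Variables (g u : E -> R) (k : nat) (S : R).
Hypothesis dg : density g.
Hypothesis u0 : forall x, 0 <= u x.
Hypothesis mu_u : measurable_fun setT u.
Hypothesis ug : forall x, u x ^+ k = g x ^+ k.+1.
Hypothesis uS : (\int[mu]_x (u x)%:E <= S%:E)%E.
Hypothesis g2 : (\int[mu]_x (enorm x ^+ 2 * g x)%:E = D%:R%:E)%E.
Hypothesis k0 : (0 < k)%N.

(** Where [g > L^k], one has [u = g * g^(1/k) >= g L]. *)
Let g_le_truncation (L : R) x : 0 < L -> g x <= L ^+ k + u x / L.
Proof.
move=> L0; have [g0 _ _] := dg.
have [gL|gL] := leP (g x) (L ^+ k).
  by rewrite (le_trans gL)// lerDl divr_ge0// ltW.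
rewrite -[leLHS]add0r lerD ?exprn_ge0 ?(ltW L0)// ler_pdivlMr//.
rewrite -(ler_pXn2r k0) ?nnegrE ?mulr_ge0 ?(ltW L0)//.
by rewrite ug exprMn exprSr ler_wpM2l ?exprn_ge0// ltW.
Qed.

(** If [|phi (xi)|] were close to [1], the measure [g] would concentrate near the
    hyperplanes where [xi . x + th] is a multiple of [2 pi], for some phase [th].
    The Fejer kernel is close to its maximum [n^2] near these hyperplanes, but its
    integral against [g] is at most [n^2 / 2]: the part of [g] outside the ball of
    radius [sqrt rho] is controlled by the second moment, the part above the
    height [L^k] by [u], and the rest is dominated by a Gaussian, for which
    [gauss_fejer] applies. The three terms of the hypothesis are these three
    contributions. *)
Lemma cf_sqr_le_of_separated (n : nat) (L rho q : R) (xi : E) :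
  (0 < n)%N -> 0 < L -> 0 < rho -> 0 <= q -> q <= dot xi xi ->
  D%:R / rho + S / L + L ^+ k * expR 2^-1 * Num.sqrt (2 * pi * rho) ^+ D *
    (n%:R^-1 + expR (- (q * rho / 2))) <= 2^-1 ->
  cf_sqr g xi <= 1 - (2 * n%:R ^+ 2)^-1.
Proof.
move=> n0 L0 rho0 q0 qxi small; have [g0 mg g1] := dg.
have nn0 : 0 < n%:R :> R by rewrite ltr0n.
pose v th x := dot xi (x : E) + th.
pose w x : R := expR (- (rho^-1 * dot (x : E) x / 2)).
have c0 : 0 < rho^-1 by rewrite invr_gt0.
have mv th : measurable_fun setT (v th) by apply: measurable_funD => //; exact: measurable_dot.
have mF th : measurable_fun setT (fun x => fejer n (v th x)).
  exact: measurable_fejer.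
have mw : measurable_fun setT w by exact: measurable_freq_gauss.
have w0 x : 0 <= w x by exact: expR_ge0.
have mn2 : measurable_fun setT (fun x : E => enorm x ^+ 2 * g x).
  by apply: measurable_funM => //; apply: measurable_funX; exact: measurable_enorm.
have n2_0 x : 0 <= enorm x ^+ 2 * g x by rewrite mulr_ge0 ?exprn_ge0 ?enorm_ge0.
have wF0 th x : 0 <= w x * fejer n (v th x) by rewrite mulr_ge0 ?fejer_ge0.
have mwF th : measurable_fun setT (fun x => w x * fejer n (v th x)) by exact: measurable_funM.
have gF0 th x : 0 <= g x * fejer n (v th x) by rewrite mulr_ge0 ?fejer_ge0.
have mgF th : measurable_fun setT (fun x => g x * fejer n (v th x)) by exact: measurable_funM.
(* On the ball of radius [sqrt rho] the Gaussian [w] is at least [expR (- 1/2)]. *)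
pose a1 : R := n%:R ^+ 2 / rho; pose a2 : R := L ^+ k * expR 2^-1; pose a3 : R := n%:R ^+ 2 / L.
have a10 : 0 <= a1 by rewrite divr_ge0 ?exprn_ge0 ?ltW.
have a20 : 0 <= a2 by rewrite mulr_ge0 ?exprn_ge0 ?expR_ge0// ltW.
have a30 : 0 <= a3 by rewrite divr_ge0 ?exprn_ge0 ?ltW.
have pointwise th x : g x * fejer n (v th x) <=
    a1 * (enorm x ^+ 2 * g x) + (a2 * (w x * fejer n (v th x)) + a3 * u x).
  have F0 := fejer_ge0 n (v th x); have Fn := fejer_le n (v th x).
  have [far|near] := leP rho (enorm x ^+ 2).
    rewrite (@le_trans _ _ (a1 * (enorm x ^+ 2 * g x)))//; last first.
      by rewrite lerDl addr_ge0//; apply: mulr_ge0.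
    rewrite mulrC mulrA ler_wpM2r// (le_trans Fn)// /a1 mulrAC ler_pdivlMr//.
    by rewrite ler_wpM2l ?exprn_ge0.
  apply: ler_wpDl; first exact: mulr_ge0.
  apply: (le_trans (ler_wpM2r F0 (g_le_truncation x L0))); rewrite mulrDl lerD//.
    rewrite mulrA ler_wpM2r// /a2 -mulrA ler_peMr ?exprn_ge0 ?(ltW L0)//.
    rewrite -expRD -[leLHS]expR0 ler_expR -enorm_sqr.
    suff : rho^-1 * enorm x ^+ 2 <= 1 by lra.
    by rewrite mulrC ler_pdivrMr// mul1r ltW.
  by rewrite /a3 mulrC mulrA ler_pdivrMr// mulrAC divfK ?gt_eqF// ler_wpM2r.
have intF th : (\int[mu]_x (g x * fejer n (v th x))%:E <= (n%:R ^+ 2 / 2)%:E)%E.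
  apply: (@le_trans _ _ (\int[mu]_x (a1 * (enorm x ^+ 2 * g x) +
      (a2 * (w x * fejer n (v th x)) + a3 * u x))%:E)%E).
    apply: EFin_le_integral => //.
    by apply: measurable_funD; [exact: measurable_funM|
      by apply: measurable_funD; exact: measurable_funM].
  rewrite EFin_integralD//; last 4 first.
  - exact: measurable_funM.
  - by apply: measurable_funD; exact: measurable_funM.
  - by move=> x; rewrite mulr_ge0.
  - by move=> x; rewrite addr_ge0// mulr_ge0.
  rewrite EFin_integralD//; last 4 first.
  - exact: measurable_funM.
  - exact: measurable_funM.
  - by move=> x; rewrite mulr_ge0.
  - by move=> x; rewrite mulr_ge0.
  rewrite !EFin_integralZl// g2.
  apply: (@le_trans _ _ (a1%:E * D%:R%:E + (a2%:E * (Num.sqrt (2 * pi / rho^-1) ^+ D *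
      (n%:R + n%:R ^+ 2 * expR (- (q / (2 * rho^-1)))))%:E + a3%:E * S%:E))%E).
    apply: leeD2l; apply: leeD; apply: lee_wpmul2l; rewrite ?lee_fin//.
    exact: gauss_fejer.
  rewrite -!EFinM -!EFinD lee_fin.
  apply: le_trans (ler_wpM2l (exprn_ge0 2 (ltW nn0)) small).
  have -> : q / (2 * rho^-1) = q * rho / 2 by field; rewrite gt_eqF.
  rewrite invrK /a1 /a2 /a3.
  move: (Num.sqrt _ ^+ D) (expR (- _)) (expR _) => A e1 e2.
  by rewrite le_eqVlt; apply/orP; left; apply/eqP; field; rewrite !gt_eqF.
pose kap : R := (2 * n%:R ^+ 2)^-1.
(* Integrating [fejer_defect] against [g] bounds [Re (e^(i th) phi)] for every
   phase [th]. *)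
have phase th : cf_cos g xi * cos th - cf_sin g xi * sin th <= 1 - kap.
  have mc : measurable_fun setT (fun x => g x * (1 + cos (v th x))).
    apply: measurable_funM => //; apply: measurable_funD => //.
    exact: measurable_cos_comp.
  have gc0 x : 0 <= g x * (1 + cos (v th x)) by rewrite mulr_ge0 ?one_plus_cos_ge0.
  have n40 : 0 <= n%:R ^+ 4 :> R by rewrite exprn_ge0.
  have n20 : 0 <= n%:R ^+ 2 :> R by rewrite exprn_ge0.
  have n240 : 0 <= 2 * n%:R ^+ 4 :> R by rewrite mulr_ge0.
  have m1 : measurable_fun setT (fun x => n%:R ^+ 4 * (g x * (1 + cos (v th x)))) by exact: measurable_funM.
  have m2 : measurable_fun setT (fun x => n%:R ^+ 2 * g x) by exact: measurable_funM.
  have m3 : measurable_fun setT (fun x => 2 * n%:R ^+ 4 * g x) by exact: measurable_funM.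
  have p1 x : 0 <= n%:R ^+ 4 * (g x * (1 + cos (v th x))) by rewrite mulr_ge0.
  have p2 x : 0 <= n%:R ^+ 2 * g x by rewrite mulr_ge0.
  have p3 x : 0 <= 2 * n%:R ^+ 4 * g x by rewrite mulr_ge0.
  have : (\int[mu]_x (n%:R ^+ 4 * (g x * (1 + cos (v th x))) + n%:R ^+ 2 * g x)%:E <=
      \int[mu]_x (2 * n%:R ^+ 4 * g x + g x * fejer n (v th x))%:E)%E.
    apply: EFin_le_integral.
    - exact: measurable_funD.
    - exact: measurable_funD.
    - by move=> x; rewrite addr_ge0.
    - move=> x; have := ler_wpM2l (g0 x) (fejer_defect n (v th x)).
      by move: (fejer _ _) (cos _) (g x) => f c g'; lra.
  rewrite (EFin_integralD m1 m2)// (EFin_integralD m3 (mgF th))// !EFin_integralZl// g1 !mule1.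
  have := one_plus_cfE xi th dg; rewrite /one_plus_cf => -> h.
  have := le_trans h (leeD2l _ (intF th)).
  rewrite -EFinM -!EFinD lee_fin => {}h.
  have n4 : 0 < n%:R ^+ 4 :> R by rewrite exprn_gt0.
  rewrite -subr_le0 -(pmulr_rle0 _ n4).
  have -> : n%:R ^+ 4 * (cf_cos g xi * cos th - cf_sin g xi * sin th - (1 - kap)) =
    n%:R ^+ 4 * (1 + cf_cos g xi * cos th - cf_sin g xi * sin th) + n%:R ^+ 2 -
    (2 * n%:R ^+ 4 + n%:R ^+ 2 / 2).
    by rewrite /kap; field; rewrite gt_eqF.
  by rewrite subr_le0.
have kap1 : 0 <= 2 - kap.
  have : kap <= 2^-1.
    by rewrite /kap lef_pV2 ?posrE ?mulr_gt0 ?exprn_gt0// ler_peMr// exprn_ege1// ler1n.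
  lra.
have tr x := trig_cf_ge0 xi (dot xi x) dg.
(* Averaging the bound at the phases [- xi . x] against [g] replaces the real
   part of [e^(i th) phi] by [|phi|^2]. *)
have : (\int[mu]_x (g x * (1 + cf_cos g xi * cos (dot xi x) + cf_sin g xi * sin (dot xi x)))%:E
    <= \int[mu]_x ((2 - kap) * g x)%:E)%E.
  apply: EFin_le_integral.
  - by apply: measurable_funM => //; exact: measurable_trig.
  - exact: measurable_funM.
  - by move=> x; rewrite mulr_ge0.
  - move=> x; rewrite mulrC ler_wpM2r//.
    by have := phase (- dot xi x); rewrite cosN sinN; lra.
rewrite integral_trig_density// EFin_integralZl// g1 mule1 lee_fin /cf_sqr -/kap !expr2.
lra.
Qed.

End separation.

Section separation_constants.
Context (R : realType).

(** The constants are chosen in the order [L], [rho], [n]: each term is made at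
    most [1/8] once the previous parameters are fixed. *)
Lemma separation_constants (D k : nat) (S q : R) : 0 <= S -> 0 < q ->
  exists (n : nat) (L rho : R), [/\ (0 < n)%N, 0 < L, 0 < rho &
  D%:R / rho + S / L + L ^+ k * expR 2^-1 * Num.sqrt (2 * pi * rho) ^+ D *
    (n%:R^-1 + expR (- (q * rho / 2))) <= 2^-1].
Proof.
move=> S0 q0.
pose L : R := 8 * (S + 1).
have L0 : 0 < L by rewrite mulr_gt0// ltr_wpDl.
have SL : S / L <= 8^-1.
  by rewrite ler_pdivrMr// /L mulrA mulVf// mul1r lerDl.
pose K := L ^+ k * expR 2^-1.
have K0 : 0 < K by rewrite mulr_gt0 ?expR_gt0// exprn_gt0.
pose C : R := K * (2 * pi) ^+ D * (D.+2%:R ^+ D.+1 * (2 / q) ^+ D.+1).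
have tp0 : 0 <= 2 * pi :> R by rewrite mulr_ge0 ?pi_ge0.
have qD0 : 0 <= D.+2%:R ^+ D.+1 * (2 / q) ^+ D.+1.
  by apply: mulr_ge0; apply: exprn_ge0 => //; rewrite divr_ge0// ltW.
have C0 : 0 <= C by apply: mulr_ge0 => //; apply: mulr_ge0; [exact: ltW|exact: exprn_ge0].
pose rho : R := 1 + 8 * D%:R + 8 * C.
have D0 : (0 : R) <= D%:R by [].
have rho1 : 1 <= rho by rewrite /rho; lra.
have rho0 : 0 < rho by exact: lt_le_trans rho1.
have Drho : D%:R / rho <= 8^-1.
  by rewrite ler_pdivrMr// /rho; lra.
pose A := Num.sqrt (2 * pi * rho) ^+ D.
have A0 : 0 <= A by rewrite exprn_ge0// sqrtr_ge0.
have tp1 : 1 <= 2 * pi * rho.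
  by have := pi_ge2 R => p2; rewrite (@le_trans _ _ (2 * pi))//; [lra|rewrite ler_peMr// mulr_ge0 ?pi_ge0].
have AE : A <= (2 * pi) ^+ D * rho ^+ D.
  have tpr0 : 0 <= 2 * pi * rho by exact: le_trans tp1.
  rewrite -exprMn; apply: lerXn2r; rewrite ?nnegrE ?sqrtr_ge0//.
  rewrite -[leRHS]sqr_sqrtr// expr2 ler_peMr ?sqrtr_ge0//.
  by rewrite -[leLHS]sqrtr1 ler_wsqrtr.
have e8 : K * A * expR (- (q * rho / 2)) <= 8^-1.
  have y0 : 0 <= q * rho / 2 by rewrite divr_ge0// mulr_ge0 ?ltW.
  have := expr_le_expR D.+1 y0.
  set e := expR (q * rho / 2) => ye.
  have e0 : 0 < e by exact: expR_gt0.
  rewrite expRN -/e ler_pdivrMr//.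
  apply: (@le_trans _ _ (K * ((2 * pi) ^+ D * rho ^+ D))).
    by rewrite ler_wpM2l// ltW.
  have re : rho ^+ D.+1 <= (D.+2%:R ^+ D.+1 * (2 / q) ^+ D.+1) * e.
    have -> : rho ^+ D.+1 = (2 / q) ^+ D.+1 * (q * rho / 2) ^+ D.+1.
      by rewrite -exprMn; congr (_ ^+ _); field; rewrite gt_eqF.
    rewrite [leRHS]mulrAC mulrC; apply: le_trans (ler_wpM2r _ ye) _ => //.
    by rewrite exprn_ge0// divr_ge0 ?ltW.
  have : K * (2 * pi) ^+ D * rho ^+ D.+1 <= C * e.
    by rewrite /C -[leRHS]mulrA ler_wpM2l//; apply: mulr_ge0; [exact: ltW|exact: exprn_ge0].
  rewrite exprSr mulrA => h.
  have Crho : C <= 8^-1 * rho by rewrite /rho; lra.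
  have {}h := le_trans h (ler_wpM2r (ltW e0) Crho).
  rewrite -(ler_pM2r rho0) [leRHS]mulrAC; apply: (le_trans _ h).
  by rewrite !mulrA.
have [n [n0 hn]] : exists n : nat, (0 < n)%N /\ K * A / n%:R <= 8^-1.
  exists (Num.trunc (8 * (K * A))).+1; split => //.
  rewrite ler_pdivrMr//.
  have := truncnS_gt (8 * (K * A)); lra.
exists n, L, rho; split => //.
rewrite -/K -/A mulrDr.
lra.
Qed.

End separation_constants.

(** * Local limit theorem *)

Section near_the_origin.
Context (R : realType).

(** With [z = sqrt N t], this is [z^3 <= 64 exp (z^2 / 16)]. *)
Lemma cube_gauss_le (N t : R) : 1 <= N -> 0 <= t ->
  N * t ^+ 3 * expR (- (N * t ^+ 2 / 8)) <=
  64 / Num.sqrt N * expR (- (N * t ^+ 2 / 16)).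
Proof.
move=> N1 t0; have N0 : 0 < N by exact: lt_le_trans N1.
have s0 : 0 < Num.sqrt N by rewrite sqrtr_gt0.
have s2 : Num.sqrt N ^+ 2 = N by rewrite sqr_sqrtr ?ltW.
pose z := Num.sqrt N * t.
have z0 : 0 <= z by rewrite mulr_ge0// ltW.
have z2 : z ^+ 2 = N * t ^+ 2 by rewrite exprMn s2.
have zle : z ^+ 3 <= 64 * expR (z ^+ 2 / 16).
  have -> : z ^+ 3 = 64 * (z / 4) ^+ 3 by rewrite expr_div_n; field.
  rewrite ler_pM2l//.
  have h : z / 4 <= expR ((z / 4) ^+ 2 / 4).
    by apply: le_trans (abs_le_expR_sqr _); exact: ler_norm.
  apply: (@le_trans _ _ (expR ((z / 4) ^+ 2 / 4) ^+ 3)).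
    by apply: lerXn2r; rewrite ?nnegrE ?expR_ge0// divr_ge0.
  rewrite -expRM_natl ler_expR; have := sqr_ge0 z; lra.
have -> : N * t ^+ 3 * expR (- (N * t ^+ 2 / 8)) =
    z ^+ 3 / Num.sqrt N * expR (- (N * t ^+ 2 / 8)).
  by rewrite -{1}s2 /z; field; rewrite gt_eqF.
have -> : expR (- (N * t ^+ 2 / 16)) = expR (z ^+ 2 / 16) * expR (- (N * t ^+ 2 / 8)).
  by rewrite -expRD z2; congr expR; field.
by rewrite [leRHS]mulrA ler_pM2r ?expR_gt0// [leRHS]mulrAC ler_pM2r ?invr_gt0.
Qed.

(** For small [t], both [|c + i s|] and [exp (- t^2 / 2)] are at most
    [exp (- t^2 / 4)], and they differ by [O (t^3)]; the bound on [t] makes the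
    cubic error at most [t^2 / 8]. *)
Lemma cpow_near_gauss (c s t M : R) (n : nat) : 0 <= M -> 0 <= t ->
  t <= (8 * (M + 1))^-1 ->
  `|c - (1 - t ^+ 2 / 2)| <= M * t ^+ 3 -> `|s| <= M * t ^+ 3 ->
  ((cpow c s n.+2).1 - expR (- (n.+2%:R * t ^+ 2 / 2))) ^+ 2 + (cpow c s n.+2).2 ^+ 2 <=
  (128 * (M + 1) / Num.sqrt n.+2%:R * expR (- (n.+2%:R * t ^+ 2 / 16))) ^+ 2.
Proof.
move=> M0 t0 tM hc hs.
have M1 : 0 < M + 1 by rewrite ltr_wpDl.
have t3 : (M + 1) * t ^+ 3 <= t ^+ 2 / 8.
  have : (M + 1) * t <= 8^-1.
    rewrite (le_trans (ler_wpM2l (ltW M1) tM))// invfM mulrCA divff ?gt_eqF//.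
    by rewrite mulr1.
  move=> /(ler_wpM2l (sqr_ge0 t)); rewrite (_ : t ^+ 2 * ((M + 1) * t) = (M + 1) * t ^+ 3)//.
  by ring.
have t3' : M * t ^+ 3 <= t ^+ 2 / 8.
  by apply: le_trans t3; rewrite ler_wpM2r ?exprn_ge0// lerDl.
have t1 : t <= 1.
  rewrite (le_trans tM)// invf_le1 ?mulr_gt0//; lra.
have t21 : t ^+ 2 <= 1 by rewrite exprn_ile1.
have t2 : 0 <= t ^+ 2 by exact: sqr_ge0.
have t30 : 0 <= t ^+ 3 by exact: exprn_ge0.
have t4 : t ^+ 4 <= t ^+ 3 by rewrite exprSr ler_piMr.
pose w := expR (- (t ^+ 2 / 2)); pose rho := expR (- (t ^+ 2 / 4)).
have wtay : `|w - 1 + t ^+ 2 / 2| <= t ^+ 3.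
  apply: le_trans (expRN_taylor (divr_ge0 t2 _)) _ => //.
  rewrite expr_div_n -exprM; have := exprn_ge0 4 t0; lra.
have rho1 : 1 - t ^+ 2 / 4 <= rho by have := expR_ge1Dx (- (t ^+ 2 / 4)).
have sqr_sum (a b r : R) : `|a| + `|b| <= r -> a ^+ 2 + b ^+ 2 <= r ^+ 2.
  move=> abr; have a0 := normr_ge0 a; have b0 := normr_ge0 b.
  apply: (@le_trans _ _ ((`|a| + `|b|) ^+ 2)); last first.
    by apply: lerXn2r; rewrite ?nnegrE ?addr_ge0// (le_trans _ abr) ?addr_ge0.
  rewrite -(real_normK (num_real a)) -(real_normK (num_real b)).
  by have := mulr_ge0 a0 b0; lra.
have hd : (c - w) ^+ 2 + s ^+ 2 <= (2 * (M + 1) * t ^+ 3) ^+ 2.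
  apply: sqr_sum.
  have -> : c - w = (c - (1 - t ^+ 2 / 2)) + - (w - 1 + t ^+ 2 / 2) by ring.
  have := ler_normD (c - (1 - t ^+ 2 / 2)) (- (w - 1 + t ^+ 2 / 2)).
  by rewrite normrN; lra.
have hr : c ^+ 2 + s ^+ 2 <= rho ^+ 2.
  apply: sqr_sum; apply: le_trans rho1.
  have -> : c = (c - (1 - t ^+ 2 / 2)) + (1 - t ^+ 2 / 2) by ring.
  have := ler_normD (c - (1 - t ^+ 2 / 2)) (1 - t ^+ 2 / 2).
  by rewrite (ger0_norm (_ : 0 <= 1 - t ^+ 2 / 2)); lra.
have wr : 0 <= w <= rho.
  by rewrite expR_ge0/= ler_expR; lra.
have d0 : 0 <= 2 * (M + 1) * t ^+ 3 by rewrite !mulr_ge0// ltW.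
have := cpow_sub_le n.+1 d0 wr hd hr.
have -> : w ^+ n.+2 = expR (- (n.+2%:R * t ^+ 2 / 2)).
  by rewrite -expRM_natl; congr expR; field.
move=> /le_trans; apply.
have pA : 0 <= n.+2%:R * (2 * (M + 1) * t ^+ 3) * rho ^+ n.+1.
  by rewrite mulr_ge0 ?exprn_ge0 ?expR_ge0// mulr_ge0.
have pB : 0 <= 128 * (M + 1) / Num.sqrt n.+2%:R * expR (- (n.+2%:R * t ^+ 2 / 16)).
  by rewrite mulr_ge0 ?expR_ge0// divr_ge0 ?sqrtr_ge0// mulr_ge0// ltW.
apply: lerXn2r => //.
have n1 : 1 <= n.+2%:R :> R by rewrite ler1n.
apply: (@le_trans _ _ (2 * (M + 1) * (n.+2%:R * t ^+ 3 * expR (- (n.+2%:R * t ^+ 2 / 8))))).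
  rewrite [leLHS](_ : _ = 2 * (M + 1) * (n.+2%:R * t ^+ 3 * rho ^+ n.+1)); last first.
    by move: (n.+2%:R : R) (rho ^+ n.+1) => a b; ring.
  rewrite !ler_wpM2l ?mulr_ge0 ?(ltW M1)// /rho -expRM_natl ler_expR.
  have -> : n.+2%:R = n.+1%:R + 1 :> R by rewrite natr1.
  have : 1 <= n.+1%:R :> R by rewrite ler1n.
  move=> /(ler_wpM2r t2); lra.
have := ler_wpM2l (mulr_ge0 (ltW (ltr0n R 2)) (ltW M1)) (cube_gauss_le n1 t0).
move=> /le_trans; apply.
by rewrite le_eqVlt; apply/orP; left; apply/eqP; ring.
Qed.

End near_the_origin.

Section gauss_density.
Context (R : realType) (D : nat).
Local Notation E := (euclid R D).
Local Notation mu := (lebesgue R D).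

Definition gauss_density (N : R) (x : E) : R := heat N x / Num.sqrt (2 * pi * N) ^+ D.

Let A_gt0 (N : R) : 0 < N -> 0 < Num.sqrt (2 * pi * N) ^+ D.
Proof. by move=> N0; rewrite exprn_gt0// sqrtr_gt0 !mulr_gt0// pi_gt0. Qed.

Lemma gauss_density_ge0 (N : R) x : 0 < N -> 0 <= gauss_density N x.
Proof. by move=> N0; rewrite divr_ge0 ?heat_ge0// ltW// A_gt0. Qed.

Lemma measurable_gauss_density (N : R) : measurable_fun setT (gauss_density N).
Proof. by apply: measurable_funM => //; exact: measurable_heat. Qed.

Lemma one_plus_cf_gauss_density (N : R) xi th : 0 < N ->
  one_plus_cf (gauss_density N) xi th =
  (1 + expR (- (N * dot xi xi / 2)) * cos th)%:E.
Proof.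
move=> N0; have Ni : 0 < N^-1 by rewrite invr_gt0.
have A0 := A_gt0 N0; set A := Num.sqrt _ ^+ D in A0 *.
pose f (x : E) : R := expR (- (N^-1 * dot x x / 2)) * (1 + 1 * cos (dot xi x + th)).
transitivity (\int[mu]_x (A^-1 * f x)%:E)%E.
  rewrite /one_plus_cf; apply: eq_integral => x _; congr EFin.
  have -> : gauss_density N x = expR (- (N^-1 * dot x x / 2)) / A.
    by congr (expR (- _) / _); field; rewrite gt_eqF.
  by rewrite /f; ring.
rewrite EFin_integralZl//.
- rewrite /f integral_gauss_1cos ?lexx ?ler01// invrK -EFinM; congr EFin.
  rewrite -/A mulKf ?gt_eqF// mul1r; congr (1 + expR _ * _).
  by field; rewrite gt_eqF.
- by apply/measurable_EFinP; exact: measurable_gauss_1cos.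
- by move=> x; rewrite mulr_ge0 ?expR_ge0// one_cos_ge0// lexx ler01.
- by rewrite invr_ge0 ltW.
Qed.

Lemma density_gauss_density (N : R) : 0 < N -> density (gauss_density N).
Proof.
move=> N0; have Ni : 0 < N^-1 by rewrite invr_gt0.
have A0 := A_gt0 N0.
split; first by move=> x; exact: gauss_density_ge0.
  exact: measurable_gauss_density.
transitivity (\int[mu]_x ((Num.sqrt (2 * pi * N) ^+ D)^-1 * expR (- (N^-1 * dot x x / 2)))%:E)%E.
  apply: eq_integral => x _; congr EFin; rewrite /gauss_density mulrC /heat.
  by congr (_ * expR _); field; rewrite gt_eqF.
rewrite EFin_integralZl//.
- by rewrite integral_gauss// invrK -EFinM mulVf ?gt_eqF.
- exact: (@measurable_freq_gauss R D N^-1).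
Qed.

Lemma gauss_density_le1 (N : R) x : 1 <= N -> gauss_density N x <= 1.
Proof.
move=> N1; have N0 : 0 < N by exact: lt_le_trans N1.
rewrite ler_pdivrMr ?A_gt0// mul1r (@le_trans _ _ 1)//.
  by rewrite -[leRHS]expR0 ler_expR oppr_le0 divr_ge0 ?dotxx_ge0// mulr_ge0// ltW.
rewrite exprn_ege1// -[leLHS]sqrtr1 ler_wsqrtr//.
have := pi_ge2 R => p2; rewrite (@le_trans _ _ (2 * pi))//; first lra.
by rewrite ler_peMr// mulr_ge0 ?pi_ge0.
Qed.

End gauss_density.

Section exponential_decay.
Context (R : realType).

(** Exponential decay beats [N^(-m/2)] with a constant independent of [N]. *)
Lemma expRN_le_sqrt (eta : R) (m : nat) : 0 < eta ->
  exists C : R, 0 <= C /\ forall N : R, 1 <= N ->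
    expR (- (eta * N)) <= C / Num.sqrt N ^+ m.
Proof.
move=> e0; exists (m.+1%:R ^+ m / eta ^+ m); split.
  by rewrite divr_ge0 ?exprn_ge0// ltW.
move=> N N1; have N0 : 0 < N by exact: lt_le_trans N1.
have s0 : 0 < Num.sqrt N ^+ m by rewrite exprn_gt0// sqrtr_gt0.
rewrite ler_pdivlMr// ler_pdivlMr ?exprn_gt0//.
rewrite expRN -mulrA [leLHS]mulrC ler_pdivrMr ?expR_gt0//.
apply: le_trans (expr_le_expR m (mulr_ge0 (ltW e0) (ltW N0))).
rewrite [leRHS]exprMn [leLHS]mulrC ler_wpM2l ?exprn_ge0 ?(ltW e0)//.
apply: lerXn2r; rewrite ?nnegrE ?sqrtr_ge0 ?(ltW N0)//.
rewrite -[leRHS]sqr_sqrtr ?(ltW N0)// expr2 ler_peMr ?sqrtr_ge0//.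
by rewrite -[leLHS]sqrtr1 ler_wsqrtr.
Qed.

Lemma expr_le_sqrt (tau : R) (m K : nat) : 0 <= tau -> tau < 1 ->
  exists C : R, 0 <= C /\ forall n : nat, (0 < n)%N -> (K <= n)%N ->
    tau ^+ (n - K) <= C / Num.sqrt n%:R ^+ m.
Proof.
move=> t0 t1; have e0 : 0 < 1 - tau by rewrite subr_gt0.
have [C [C0 hC]] := expRN_le_sqrt m e0.
exists (expR ((1 - tau) * K%:R) * C); split; first by rewrite mulr_ge0 ?expR_ge0.
move=> n n0 Kn; have n1 : 1 <= n%:R :> R by rewrite ler1n.
have te : tau <= expR (- (1 - tau)) by apply: le_trans (expR_ge1Dx _); lra.
apply: (@le_trans _ _ (expR (- (1 - tau)) ^+ (n - K))).
  by apply: lerXn2r; rewrite ?nnegrE ?expR_ge0.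
rewrite -expRM_natl natrB//.
have -> : (n%:R - K%:R) * - (1 - tau) = (1 - tau) * K%:R + - ((1 - tau) * n%:R) by ring.
by rewrite expRD -mulrA ler_wpM2l ?expR_ge0// hC.
Qed.

End exponential_decay.

Section local_limit.
Context (R : realType) (D : nat).
Local Notation E := (euclid R D).
Local Notation mu := (lebesgue R D).

(** The function [u] is [g^(1 + 1/k)]. Characterizing it by [std_power] keeps the
    exponents integral, and only the constants [k], [S] and [M] may enter the
    final bound. *)
Record standard_density (k : nat) (S M : R) (g u : E -> R) : Prop := StandardDensity {
  std_density : density g ;
  std_ge0 : forall x, 0 <= u x ;
  std_measurable : measurable_fun setT u ;
  std_power : forall x, u x ^+ k = g x ^+ k.+1 ;
  std_mass : (\int[mu]_x (u x)%:E <= S%:E)%E ;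
  std_moment : (\int[mu]_x (enorm x ^+ 3 * g x)%:E = M%:E)%E ;
  std_centered : forall i, (\int[mu]_x (coord x i * g x)%:E = 0)%E ;
  std_covariance : forall i j, (\int[mu]_x (coord x i * coord x j * g x)%:E =
    ((i == j)%:R)%:E)%E }.

Variables (k : nat) (S M : R) (g u : E -> R).
Hypothesis H : standard_density k S M g u.

Let dg := std_density H.
Let g0 := density_ge0 dg.
Let mg := density_measurable dg.

Let S_ge0 : 0 <= S.
Proof.
rewrite -lee_fin (le_trans _ (std_mass H))// integral_ge0// => x _.
by rewrite lee_fin (std_ge0 H).
Qed.

Let B_ge0 : 0 <= S ^+ k. Proof. exact: exprn_ge0. Qed.

(** Convolving with a probability density does not increase a uniform bound. *)
Lemma convolution_power_bounded n x : (k <= n)%N ->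
  (convolution_power g n.+1 x <= (S ^+ k)%:E)%E.
Proof.
have base y : (convolution_power g k.+1 y <= (S ^+ k)%:E)%E.
  have U0 : (0 <= \int[mu]_x (u x)%:E)%E.
    by apply: integral_ge0 => x' _; rewrite lee_fin (std_ge0 H).
  have ufin : (\int[mu]_x (u x)%:E)%E \is a fin_num.
    by rewrite ge0_fin_numE// (le_lt_trans (std_mass H))// ltry.
  apply: le_trans (convolution_power_le g0 mg (std_ge0 H) (std_measurable H)
    (std_power H) (esym (fineK ufin)) y) _.
  rewrite lee_fin; apply: lerXn2r => //; first by rewrite nnegrE fine_ge0.
  by rewrite -lee_fin fineK// (std_mass H).
elim: n x => [|n IH] x; rewrite leq_eqVlt => /predU1P[<-|] //.
rewrite ltnS => kn.
have mEg : measurable_fun setT (EFin \o g) by exact/measurable_EFinP.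
have mh := measurable_convolutions n (fun=> g0) (fun=> mg).
have h0 := convolutions_ge0 n (fun _ : nat => g0).
rewrite convolutionsE in mh h0.
rewrite [convolution_power _ _ _]/(convolution (EFin \o g) (convolution_power g n.+1) x).
have mgs : measurable_fun setT (fun y => (g (esub x y))%:E).
  by apply: (measurableT_comp mEg); exact: measurable_esub.
apply: (@le_trans _ _ (\int[mu]_y ((g (esub x y))%:E * (S ^+ k)%:E))%E).
  apply: ge0_le_integral => //.
  - by move=> y _; rewrite mule_ge0 ?lee_fin.
  - exact: measurable_convolution_section.
  - exact: emeasurable_funM.
  - by move=> y _; rewrite lee_wpmul2l ?lee_fin// IH.
rewrite ge0_integralZr ?lee_fin//; last by move=> y _; rewrite lee_fin.
rewrite (@ge0_integral_esub _ _ x (EFin \o g))//.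
by rewrite (density_mass dg) mul1e.
Qed.

Definition convolution_density n (x : E) : R := fine (convolution_power g n.+1 x).

Lemma convolution_densityE n x : (k <= n)%N ->
  (convolution_density n x)%:E = convolution_power g n.+1 x.
Proof.
move=> kn; rewrite /convolution_density fineK// ge0_fin_numE.
  by rewrite (le_lt_trans (convolution_power_bounded x kn))// ltry.
by rewrite -convolutionsE; exact: convolutions_ge0.
Qed.

Lemma convolution_density_le n x : (k <= n)%N -> convolution_density n x <= S ^+ k.
Proof.
by move=> kn; rewrite -lee_fin convolution_densityE// convolution_power_bounded.
Qed.

Lemma density_convolution_density n : (k <= n)%N -> density (convolution_density n).
Proof.
move=> kn; split.
- by move=> x; rewrite fine_ge0// -convolutionsE convolutions_ge0.
- have mh := measurable_convolutions n (fun=> g0) (fun=> mg).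
  by rewrite convolutionsE in mh; exact: (measurableT_comp (f := fine)).
- transitivity (\int[mu]_x convolutions (fun=> g) n x)%E.
    by apply: eq_integral => x _; rewrite convolution_densityE// convolutionsE.
  by rewrite (integral_convolutions n g0 mg (density_mass dg)) expr1n.
Qed.

Lemma one_plus_cf_convolution_density n xi th : (k <= n)%N ->
  one_plus_cf (convolution_density n) xi th =
  (1 + (cpow (cf_cos g xi) (cf_sin g xi) n.+1).1 * cos th -
   (cpow (cf_cos g xi) (cf_sin g xi) n.+1).2 * sin th)%:E.
Proof.
move=> kn; rewrite -one_plus_cf_convolution_power//.
by rewrite /one_plus_cf; apply: eq_integral => y _; rewrite EFinM convolution_densityE.
Qed.

Lemma cf_sqr_convolution_density n xi : (k <= n)%N ->
  cf_sqr (convolution_density n) xi = cf_sqr g xi ^+ n.+1.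
Proof.
move=> kn; rewrite /cf_sqr -cpow_norm.
have [-> ->] // := cf_unique (density_convolution_density kn)
  (fun th => one_plus_cf_convolution_density xi th kn).
Qed.

End local_limit.

Section frequency_estimate.
Context (R : realType) (D : nat).
Local Notation E := (euclid R D).
Local Notation mu := (lebesgue R D).
Variables (k : nat) (S M : R) (g u : E -> R).
Hypothesis H : standard_density k S M g u.
Variables (tau : R) (n : nat).
Let delta : R := (8 * (M + 1))^-1.
Hypothesis tau0 : 0 <= tau.
Hypothesis far_cf : forall xi, delta ^+ 2 <= dot xi xi -> cf_sqr g xi <= tau ^+ 2.
Hypothesis kn : (2 * k.+1 <= n.+2)%N.

Let N : R := n.+2%:R.
Let N1 : 1 <= N. Proof. by rewrite ler1n. Qed.
Let N0 : 0 < N. Proof. by rewrite ltr0n. Qed.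
Let sN := Num.sqrt N.
Let sN0 : 0 < sN. Proof. by rewrite sqrtr_gt0. Qed.

Let M0 : 0 <= M.
Proof. exact: (moment3_ge0 (std_density H) (std_moment H)). Qed.

Let M1 : 0 < M + 1. Proof. by rewrite ltr_wpDl. Qed.

Let delta0 : 0 < delta. Proof. by rewrite invr_gt0 mulr_gt0. Qed.

(** The three terms bound the gap between [phi ^ N] and the Gaussian near the
    origin, [phi ^ N] away from it, and the Gaussian away from it. *)
Let near (xi : E) : R := 128 * (M + 1) / sN * freq_gauss (N / 8) xi.
Let far (xi : E) : R := tau ^+ (n.+2 - 2 * k.+1) * cf_sqr g xi ^+ k.+1.
Let gauss_tail (xi : E) : R := expR (- (delta ^+ 2 / 4 * N)) * freq_gauss (N / 2) xi.

Let near_ge0 xi : 0 <= near xi.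
Proof.
apply: mulr_ge0; last exact: freq_gauss_ge0.
by apply: divr_ge0; [apply: mulr_ge0 => //; exact: ltW|exact: ltW].
Qed.

Let far_ge0 xi : 0 <= far xi.
Proof. by apply: mulr_ge0; apply: exprn_ge0 => //; exact: cf_sqr_ge0. Qed.

Let gauss_tail_ge0 xi : 0 <= gauss_tail xi.
Proof. by apply: mulr_ge0; [exact: expR_ge0|exact: freq_gauss_ge0]. Qed.

Definition gap (xi : E) : R := near xi + (far xi + gauss_tail xi).

Lemma gap_ge0 xi : 0 <= gap xi.
Proof. by rewrite !addr_ge0. Qed.

Let measurable_near : measurable_fun setT near.
Proof. by apply: measurable_funM => //; exact: measurable_freq_gauss. Qed.

Let measurable_far : measurable_fun setT far.
Proof.
apply: measurable_funM => //; apply: measurable_funX.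
exact: (measurable_cf_sqr (std_density H)).
Qed.

Let measurable_gauss_tail : measurable_fun setT gauss_tail.
Proof. by apply: measurable_funM => //; exact: measurable_freq_gauss. Qed.

Lemma measurable_gap : measurable_fun setT gap.
Proof. by apply: measurable_funD => //; exact: measurable_funD. Qed.

(** The square-integrability of the characteristic function is applied to the
    [(k+1)]-fold convolution, whose characteristic function has squared modulus
    [cf_sqr g ^+ k.+1]. *)
Lemma integral_gap_le :
  (\int[mu]_xi (gap xi)%:E <=
   (128 * (M + 1) * Num.sqrt (16 * pi) ^+ D / sN ^+ D.+1 +
    (tau ^+ (n.+2 - 2 * k.+1) * (S ^+ k * (2 * pi) ^+ D) +
     expR (- (delta ^+ 2 / 4 * N)) * Num.sqrt (4 * pi) ^+ D))%:E)%E.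
Proof.
have mft : measurable_fun setT (fun xi => far xi + gauss_tail xi) by exact: measurable_funD.
have ft0 xi : 0 <= far xi + gauss_tail xi by rewrite addr_ge0.
rewrite (EFin_integralD measurable_near mft near_ge0 ft0).
rewrite (EFin_integralD measurable_far measurable_gauss_tail far_ge0 gauss_tail_ge0).
rewrite !EFinD; apply: leeD; last apply: leeD.
- rewrite /near EFin_integralZl; last 3 first.
  + exact: measurable_freq_gauss.
  + exact: freq_gauss_ge0.
  + by rewrite divr_ge0 ?(ltW sN0)// mulr_ge0// ltW.
  rewrite integral_gauss ?divr_gt0// -EFinM lee_fin.
  have -> : Num.sqrt (2 * pi / (N / 8)) = Num.sqrt (16 * pi) / sN.
    rewrite -sqrtrV ?(ltW N0)// -sqrtrM ?mulr_ge0 ?pi_ge0//.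
    by congr Num.sqrt; field; rewrite gt_eqF.
  rewrite expr_div_n exprS le_eqVlt; apply/orP; left; apply/eqP.
  by field; rewrite !expf_neq0 ?gt_eqF.
- have kn' : (k <= k)%N by [].
  rewrite /far EFin_integralZl ?exprn_ge0//; last 2 first.
  + by apply: measurable_funX; exact: (measurable_cf_sqr (std_density H)).
  + by move=> xi; rewrite exprn_ge0// cf_sqr_ge0.
  rewrite [leRHS]EFinM lee_wpmul2l ?lee_fin ?exprn_ge0//.
  have := integral_cf_sqr_le (density_convolution_density H kn')
    (fun x => convolution_density_le H x kn').
  apply: le_trans; rewrite le_eqVlt; apply/orP; left; apply/eqP.
  by apply: eq_integral => xi _; rewrite (cf_sqr_convolution_density H).
- rewrite /gauss_tail EFin_integralZl ?expR_ge0//; last 2 first.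
  + exact: measurable_freq_gauss.
  + exact: freq_gauss_ge0.
  rewrite integral_gauss ?divr_gt0// -EFinM lee_fin ler_wpM2l ?expR_ge0//.
  apply: lerXn2r; rewrite ?nnegrE ?sqrtr_ge0// ler_wsqrtr//.
  rewrite (_ : 2 * pi / (N / 2) = 4 * pi / N); last by field; rewrite gt_eqF.
  by rewrite ler_pdivrMr// ler_peMr// mulr_ge0 ?pi_ge0.
Qed.

Let cfN (xi : E) := cpow (cf_cos g xi) (cf_sin g xi) n.+2.
Let W (xi : E) : R := expR (- (N * dot xi xi / 2)).

Let gap_near xi : dot xi xi <= delta ^+ 2 ->
  ((cfN xi).1 - W xi) ^+ 2 + (cfN xi).2 ^+ 2 <= near xi ^+ 2.
Proof.
rewrite -enorm_sqr => small.
have t0 := enorm_ge0 xi.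
have td : enorm xi <= (8 * (M + 1))^-1.
  by rewrite -(ler_pXn2r (n:=2))// ?nnegrE// ltW.
have := cpow_near_gauss n M0 t0 td.
rewrite enorm_sqr => /(_ (cf_cos g xi) (cf_sin g xi)).
move=> /(_ (cf_cos_taylor (std_density H) (std_moment H) (std_covariance H) xi)).
move=> /(_ (cf_sin_taylor (std_density H) (std_moment H) (std_centered H) xi)).
rewrite -/N -/(cfN xi) -/(W xi) => /le_trans; apply.
rewrite /near /freq_gauss le_eqVlt; apply/orP; left; apply/eqP.
by congr ((_ * expR (- _)) ^+ 2); field.
Qed.

Let gap_far xi : delta ^+ 2 <= dot xi xi ->
  (cfN xi).1 ^+ 2 + (cfN xi).2 ^+ 2 <= far xi ^+ 2.
Proof.
move=> large; rewrite cpow_norm -/(cf_sqr g xi) /far.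
have P0 := cf_sqr_ge0 g xi.
have -> : cf_sqr g xi ^+ n.+2 =
    cf_sqr g xi ^+ (n.+2 - 2 * k.+1) * (cf_sqr g xi ^+ k.+1) ^+ 2.
  by rewrite -exprM -exprD mulnC [in RHS]mulnC subnK// mulnC.
rewrite exprMn; apply: ler_wpM2r; first by apply: exprn_ge0; apply: exprn_ge0.
rewrite exprAC; apply: lerXn2r; last exact: far_cf.
  by rewrite nnegrE.
by rewrite nnegrE; apply: exprn_ge0.
Qed.

Let gap_tail xi : delta ^+ 2 <= dot xi xi -> W xi <= gauss_tail xi.
Proof.
move=> large; rewrite /W /gauss_tail /freq_gauss -expRD ler_expR.
have := ler_wpM2r (ltW N0) large; lra.
Qed.

Lemma cf_gap xi th :
  `|(1 + (cfN xi).1 * cos th - (cfN xi).2 * sin th) - (1 + W xi * cos th)| <= gap xi.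
Proof.
have unit1 : cos th ^+ 2 + (- sin th) ^+ 2 = 1 by rewrite sqrrN cos2Dsin2.
have unit2 : (- cos th) ^+ 2 + sin th ^+ 2 = 1 by rewrite sqrrN cos2Dsin2.
have fg0 := far_ge0 xi; have ng0 := near_ge0 xi; have tg0 := gauss_tail_ge0 xi.
have [small|large] := leP (dot xi xi) (delta ^+ 2).
  have h := gap_near small.
  have := cauchy_schwarz_unit ng0 unit1 h; have := cauchy_schwarz_unit ng0 unit2 h.
  by rewrite /gap ler_norml => h1 h2; apply/andP; split; lra.
have h := gap_far (ltW large); have ht := gap_tail (ltW large).
have := cauchy_schwarz_unit fg0 unit1 h; have := cauchy_schwarz_unit fg0 unit2 h.
have W0 : 0 <= W xi by exact: expR_ge0.
have : `|W xi * cos th| <= W xi by rewrite normrM (ger0_norm W0) ler_piMr// abs_cos_le1.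
rewrite ler_norml => /andP[h3 h4] h1 h2.
by rewrite /gap ler_norml; apply/andP; split; lra.
Qed.

(** The comparison of densities is applied in both directions. *)
Lemma ae_convolution_density_gauss (I : R) :
  (\int[mu]_xi (gap xi)%:E <= I%:E)%E ->
  {ae mu, forall x, `|convolution_density g n.+1 x - gauss_density N x| <= I / (2 * pi) ^+ D}.
Proof.
move=> gI.
have kn1 : (k <= n.+1)%N by lia.
have dG := density_convolution_density H kn1.
have dK := density_gauss_density D N0.
pose B := S ^+ k + 1.
have B0 : 0 <= S ^+ k.
  have [z _] : exists z : E, True by exists [tuple 0 | i < D].
  exact: le_trans (density_ge0 dG z) (convolution_density_le H z kn1).
have GB x : convolution_density g n.+1 x <= B.
  by rewrite (le_trans (convolution_density_le H x kn1))// lerDl.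
have KB (x : E) : gauss_density N x <= B.
  by rewrite (le_trans (gauss_density_le1 x N1))// lerDr.
have cfG xi th := one_plus_cf_convolution_density H xi th kn1.
have cfK (xi : E) th := one_plus_cf_gauss_density xi th N0.
have le1 xi th : (one_plus_cf (convolution_density g n.+1) xi th <=
    one_plus_cf (gauss_density N) xi th + (gap xi)%:E)%E.
  rewrite cfG cfK -EFinD lee_fin -/(cfN xi) -/(W xi).
  by have := cf_gap xi th; rewrite ler_norml => /andP[_]; lra.
have le2 xi th : (one_plus_cf (gauss_density N) xi th <=
    one_plus_cf (convolution_density g n.+1) xi th + (gap xi)%:E)%E.
  rewrite cfG cfK -EFinD lee_fin -/(cfN xi) -/(W xi).
  by have := cf_gap xi th; rewrite ler_norml => /andP[+ _]; lra.
have ae1 := ae_le_density (density_ge0 dG) (density_measurable dG) (density_ge0 dK)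
  (density_measurable dK) (density_mass dG) (density_mass dK) gap_ge0 measurable_gap gI le1 GB KB.
have ae2 := ae_le_density (density_ge0 dK) (density_measurable dK) (density_ge0 dG)
  (density_measurable dG) (density_mass dK) (density_mass dG) gap_ge0 measurable_gap gI le2 KB GB.
move: ae1 ae2; apply: filterS2 => x h1 h2.
by rewrite ler_distl; apply/andP; split; lra.
Qed.

End frequency_estimate.

Section local_limit_theorem.
Context (R : realType) (D : nat).
Local Notation E := (euclid R D).
Local Notation mu := (lebesgue R D).

Lemma std_second_moment k S M (g u : E -> R) : standard_density k S M g u ->
  (\int[mu]_x (enorm x ^+ 2 * g x)%:E = D%:R%:E)%E.
Proof.
move=> H; have dg := std_density H.
have c2 := cubic_growth_enorm2 R D.
rewrite -(expectation_enorm2 dg (std_moment H) (std_covariance H)) /expectation /Rintegral.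
rewrite fineK; first by apply: eq_integral => x _; rewrite mulrC.
apply: integrable_fin_num => //.
exact: (cubic_growth_integrable dg (std_moment H) c2).
Qed.

(** The constant is fixed before [g]: every quantity that it is built from depends
    on [D], [k], [S] and [M] only. *)
Lemma local_limit_bound (k : nat) (S M : R) : (0 < k)%N -> 0 <= S -> 0 <= M ->
  exists C : R, 0 <= C /\ forall g u : E -> R, standard_density k S M g u ->
    forall n, (2 * k.+1 <= n.+2)%N ->
    {ae mu, forall x, `|convolution_density g n.+1 x - gauss_density n.+2%:R x| <=
      C / Num.sqrt n.+2%:R ^+ D.+1}.
Proof.
move=> k0 S0 M0.
pose delta : R := (8 * (M + 1))^-1.
have M1 : 0 < M + 1 by rewrite ltr_wpDl.
have delta0 : 0 < delta by rewrite invr_gt0 mulr_gt0.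
have q0 : 0 < delta ^+ 2 by rewrite exprn_gt0.
have [m [L [rho [m0 L0 rho0 small]]]] := separation_constants D k S0 q0.
pose tau2 : R := 1 - (2 * m%:R ^+ 2)^-1.
have m1 : 1 <= m%:R ^+ 2 :> R by rewrite exprn_ege1// ler1n.
have inv1 : (2 * m%:R ^+ 2)^-1 <= 1 :> R by rewrite invf_le1; lra.
have inv0 : 0 < (2 * m%:R ^+ 2)^-1 :> R by rewrite invr_gt0; lra.
have tau20 : 0 <= tau2 by rewrite subr_ge0.
pose tau := Num.sqrt tau2.
have tauE : tau ^+ 2 = tau2 by rewrite sqr_sqrtr.
have tau0 : 0 <= tau by exact: sqrtr_ge0.
have tau1 : tau < 1.
  by rewrite -sqrtr1 ltr_sqrt// /tau2 ltrBlDr ltrDl.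
have [C2 [C20 hC2]] := expr_le_sqrt D.+1 (2 * k.+1) tau0 tau1.
have e0 : 0 < delta ^+ 2 / 4 by rewrite divr_gt0.
have [C3 [C30 hC3]] := expRN_le_sqrt D.+1 e0.
pose C1 : R := 128 * (M + 1) * Num.sqrt (16 * pi) ^+ D.
have C10 : 0 <= C1.
  apply: mulr_ge0; first by apply: mulr_ge0 => //; exact: ltW.
  by apply: exprn_ge0; exact: sqrtr_ge0.
have tp0 : 0 <= (2 * pi) ^+ D :> R by rewrite exprn_ge0// mulr_ge0 ?pi_ge0.
pose B : R := S ^+ k * (2 * pi) ^+ D.
have B0 : 0 <= B by apply: mulr_ge0 => //; exact: exprn_ge0.
pose A4 : R := Num.sqrt (4 * pi) ^+ D.
have A40 : 0 <= A4 by rewrite exprn_ge0// sqrtr_ge0.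
pose C := (C1 + (C2 * B + C3 * A4)) / (2 * pi) ^+ D.
have C0 : 0 <= C.
  by apply: divr_ge0 => //; apply: addr_ge0 => //; apply: addr_ge0; exact: mulr_ge0.
exists C; split => // g u H n kn.
have far_cf xi : delta ^+ 2 <= dot xi xi -> cf_sqr g xi <= tau ^+ 2.
  move=> large; rewrite tauE.
  exact: (cf_sqr_le_of_separated (std_density H) (std_ge0 H) (std_measurable H)
    (std_power H) (std_mass H) (std_second_moment H) k0 m0 L0 rho0 (ltW q0) large small).
have s0 : 0 < Num.sqrt n.+2%:R ^+ D.+1 :> R by rewrite exprn_gt0// sqrtr_gt0.
have gI := integral_gap_le H n tau0.
have gI' : (\int[mu]_xi (gap k M g tau n xi)%:E <=
    ((C1 + (C2 * B + C3 * A4)) / Num.sqrt n.+2%:R ^+ D.+1)%:E)%E.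
  apply: (le_trans gI); rewrite lee_fin -/C1 -/B -/A4 -/delta !mulrDl.
  apply: lerD => //; apply: lerD.
    by rewrite [leRHS]mulrAC ler_wpM2r//; exact: hC2.
  by rewrite [leRHS]mulrAC ler_wpM2r//; apply: hC3; rewrite ler1n.
have := ae_convolution_density_gauss H tau0 far_cf kn gI'.
by rewrite /C mulrAC.
Qed.

End local_limit_theorem.

(** * Reduction to bounded convolutions, and rescaling *)

Section sup_norm.
Context d (T : measurableType d) (R : realType) (mu : {measure set T -> \bar R}).

Let ae_null (P : set T) : mu setT = 0%E -> {ae mu, forall x, P x}.
Proof. by move=> mu0; exists setT; split. Qed.

(** The [L^oo] norm is an essential supremum except on a null space, where every
    property holds almost everywhere. *)
Lemma ae_le_Lnorm_oo (f : T -> \bar R) :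
  {ae mu, forall x, (`|f x| <= 'N[mu]_+oo[f])%E}.
Proof.
rewrite unlock; case: ifPn => [_|]; first exact: (ess_sup_ge mu (abse \o f)).
by rewrite -leNgt measure_le0 => /eqP; exact: ae_null.
Qed.

Lemma Lnorm_oo_le (f : T -> \bar R) (c : \bar R) : (0 <= c)%E ->
  {ae mu, forall x, (`|f x| <= c)%E} -> ('N[mu]_+oo[f] <= c)%E.
Proof. by move=> c0 fc; rewrite unlock; case: ifPn => // _; exact/ess_supP. Qed.

End sup_norm.

Lemma powR_le_add (R : realType) (a s r : R) : 0 <= a -> 1 <= s -> s <= r ->
  a `^ s <= a + a `^ r.
Proof.
move=> a0 s1 sr.
have [->|an0] := eqVneq a 0; first by rewrite powR0 ?addr_ge0 ?powR_ge0//; lra.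
have ap : 0 < a by rewrite lt_neqAle eq_sym an0.
have [a1|/ltW a1] := leP a 1.
  apply: (@le_trans _ _ (a `^ 1)); first by apply: ger_powR => //; rewrite ap.
  by rewrite powRr1// lerDl powR_ge0.
by apply: (@le_trans _ _ (a `^ r)); [exact: ler_powR|rewrite lerDr].
Qed.

(** Lowering the exponent [p] to [1 + 1/k] uses the mass of [g] when [g <= 1] and
    its [L^p] norm when [g >= 1]. *)
Lemma integrability_gain (R : realType) (p : \bar R) : (1 < p)%E ->
  exists k : nat, (0 < k)%N /\ forall K : R, exists S : R, 0 <= S /\
  forall D (f g : euclid R D -> R), measurable_fun setT f ->
  ('N[lebesgue R D]_p[EFin \o f] = K%:E)%E ->
  density g -> (forall x, g x <= `|f x|) ->
  (\int[lebesgue R D]_x (g x `^ (k.+1%:R / k%:R))%:E <= S%:E)%E.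
Proof.
case: p => [r||//]; last first.
  move=> _; exists 1%N; split => // K; exists `|K|; split => // D f g mf fK dg gf.
  have g0 := density_ge0 dg; have mg := density_measurable dg.
  have mEg : measurable_fun setT (EFin \o g) by exact/measurable_EFinP.
  rewrite (_ : 2%:R / 1%:R = 2%:R :> R); last by rewrite divr1.
  apply: (@le_trans _ _ (\int[lebesgue R D]_x (`|K| * g x)%:E)%E).
    apply: ae_ge0_le_integral => //.
    - by move=> x _; rewrite lee_fin powR_ge0.
    - by apply/measurable_EFinP; exact: (measurableT_comp (measurable_powR _)).
    - by move=> x _; rewrite lee_fin mulr_ge0.
    - by apply/measurable_EFinP; exact: measurable_funM.
    - have := ae_le_Lnorm_oo (lebesgue R D) (EFin \o f); rewrite fK.
      apply: filterS => x /=; rewrite !lee_fin => fx _.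
      rewrite powR_mulrn// expr2 ler_wpM2r//.
      exact: le_trans (le_trans (gf x) fx) (ler_norm _).
  by rewrite EFin_integralZl// (density_mass dg) mule1.
rewrite lte_fin => r1; have rm1 : 0 < r - 1 by rewrite subr_gt0.
pose k := (Num.trunc (r - 1)^-1).+1; exists k; split => // K.
have k0 : 0 < k%:R :> R by rewrite ltr0n.
have kr : k%:R^-1 <= r - 1.
  have h : (r - 1)^-1 < k%:R by exact: truncnS_gt.
  by rewrite -[leRHS]invrK lef_pV2 ?posrE ?invr_gt0//; exact: ltW.
have sE : k.+1%:R / k%:R = 1 + k%:R^-1 :> R.
  by rewrite -natr1 mulrDl divff ?gt_eqF// mul1r.
have ki : 0 < k%:R^-1 :> R by rewrite invr_gt0.
exists (1 + K `^ r); split => [|D f g mf fK dg gf]; first by rewrite addr_ge0 ?powR_ge0.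
have g0 := density_ge0 dg; have mg := density_measurable dg.
have rn0 : r != 0 by rewrite gt_eqF//; lra.
have fr : (\int[lebesgue R D]_x (`|f x| `^ r)%:E = (K `^ r)%:E)%E.
  have := poweR_Lnorm (lebesgue R D) (EFin \o f) rn0.
  by rewrite fK poweR_EFin => ->.
have mpow s : measurable_fun setT (fun x => g x `^ s).
  exact: (measurableT_comp (measurable_powR _)).
have mfpow : measurable_fun setT (fun x => `|f x| `^ r).
  by apply: (measurableT_comp (measurable_powR _)); exact: measurableT_comp.
rewrite EFinD -(density_mass dg) -fr -(EFin_integralD mg mfpow g0 (fun x => powR_ge0 _ _)).
apply: ge0_le_integral => //.
- by move=> x _; rewrite lee_fin powR_ge0.
- exact/measurable_EFinP.
- by apply/measurable_EFinP; exact: measurable_funD.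
- move=> x _; rewrite lee_fin; apply: (@le_trans _ _ (g x + g x `^ r)).
    by apply: powR_le_add => //; rewrite sE; lra.
  by rewrite lerD2l ge0_ler_powR ?nnegrE//; lra.
Qed.

Section positive_part.
Context (R : realType) (D : nat).
Local Notation E := (euclid R D).
Local Notation mu := (lebesgue R D).

(** A density that is nonnegative almost everywhere is replaced by its positive
    part, to which the results on nonnegative functions apply. *)
Definition pospart (g : E -> R) (x : E) : R := Num.max (g x) 0.

(** From the second convolution power on, the value at each point is an integral
    and hence insensitive to null sets. *)
Lemma convolution_power_pospart (g : E -> R) n x :
  measurable_fun setT g -> {ae mu, forall x, g x = pospart g x} ->
  convolution_power g n.+2 x = convolution_power (pospart g) n.+2 x.
Proof.
set h := pospart g => mg gh.
have mh : measurable_fun setT h by exact: measurable_maxr.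
have h0 y : 0 <= h y by rewrite le_max lexx orbT.
have mEg : measurable_fun setT (EFin \o g) by exact/measurable_EFinP.
have mEh : measurable_fun setT (EFin \o h) by exact/measurable_EFinP.
have Egh : {ae mu, forall x, (g x)%:E = (h x)%:E} by apply: filterS gh => y ->.
have mhn m : measurable_fun setT (convolution_power h m.+1).
  by rewrite -convolutionsE; exact: measurable_convolutions.
elim: n x => [|n IH] x; first exact: (eq_convolution x mEg mEh mEg mEh Egh Egh).
have e : convolution_power g n.+2 = convolution_power h n.+2 by apply/funext.
rewrite -[LHS]/(convolution (EFin \o g) (convolution_power g n.+2) x) e.
have ee : {ae mu, forall x, convolution_power h n.+2 x = convolution_power h n.+2 x}.
  exact: (aeW _ (fun=> erefl)).
exact: (eq_convolution x mEg mEh (mhn n.+1) (mhn n.+1) Egh ee).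
Qed.

End positive_part.

Section rescaling.
Context (R : realType) (D : nat).

Lemma gaussian_rescale (N : R) (x : euclid R D) : 0 < N ->
  gaussian x = Num.sqrt N ^+ D * gauss_density N (escale (Num.sqrt N) x).
Proof.
move=> N0; have tp : 0 < 2 * pi :> R by rewrite mulr_gt0// pi_gt0.
have sN : 0 < Num.sqrt N ^+ D by rewrite exprn_gt0// sqrtr_gt0.
have s2 : 0 < Num.sqrt (2 * pi) ^+ D :> R by rewrite exprn_gt0// sqrtr_gt0.
rewrite /gaussian /gauss_density /heat enorm_sqr (dot_escale (Num.sqrt N)) sqr_sqrtr ?(ltW N0)//.
rewrite powRN [D%:R / 2]mulrC powRrM powR12_sqrt ?(ltW tp)// powR_mulrn ?sqrtr_ge0//.
rewrite (sqrtrM N (ltW tp)) exprMn.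
have -> : N * dot x x / (2 * N) = dot x x / 2 by field; rewrite gt_eqF.
move: (expR _) (Num.sqrt N ^+ D) sN (Num.sqrt (2 * pi) ^+ D) s2 => e b b0 a a0.
by field; rewrite !gt_eqF.
Qed.

Lemma powR_half_nat (N : R) : 0 <= N -> N `^ (D%:R / 2) = Num.sqrt N ^+ D.
Proof. by move=> N0; rewrite mulrC powRrM powR12_sqrt// powR_mulrn ?sqrtr_ge0. Qed.

End rescaling.

Section standardization.
Context (R : realType) (D : nat).
Local Notation E := (euclid R D).
Local Notation mu := (lebesgue R D).

Lemma ae_pospart (g : E -> R) : is_density g -> {ae mu, forall x, g x = pospart g x}.
Proof. by case=> _ g0 _; apply: filterS g0 => x g0; rewrite /pospart max_l. Qed.

Lemma integral_pospart (g w : E -> R) : is_density g -> measurable_fun setT w ->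
  (\int[mu]_x (w x * pospart g x)%:E = \int[mu]_x (w x * g x)%:E)%E.
Proof.
move=> dg mw; have [mg _ _] := dg.
apply: ae_eq_integral => //.
- by apply/measurable_EFinP; apply: measurable_funM => //; exact: measurable_maxr.
- by apply/measurable_EFinP; exact: measurable_funM.
- by apply: filterS (ae_pospart dg) => x e _; rewrite -e.
Qed.

Lemma density_pospart (g : E -> R) : is_density g -> density (pospart g).
Proof.
move=> dg; have [mg _ g1] := dg; split.
- by move=> x; rewrite le_max lexx orbT.
- exact: measurable_maxr.
- rewrite -g1; have := @integral_pospart g (fun=> 1) dg (measurable_cst _).
  by under eq_integral do rewrite mul1r; under [in RHS]eq_integral do rewrite mul1r.
Qed.

Lemma standard_density_pospart (k : nat) (S M : R) (g : E -> R) : (0 < k)%N ->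
  is_density g -> centered g -> identity_covariance g -> moment 3 g = M%:E ->
  (\int[mu]_x (pospart g x `^ (k.+1%:R / k%:R))%:E <= S%:E)%E ->
  standard_density k S M (pospart g) (fun x => pospart g x `^ (k.+1%:R / k%:R)).
Proof.
move=> k0 dg cg vg mg uS; have dh := density_pospart dg; split => //.
- by move=> x; exact: powR_ge0.
- exact: (measurableT_comp (measurable_powR _) (density_measurable dh)).
- move=> x; rewrite -powR_mulrn ?powR_ge0// -powRrM divfK ?pnatr_eq0 -?lt0n//.
  by rewrite powR_mulrn// (density_ge0 dh).
- by rewrite integral_pospart//; apply: measurable_funX; exact: measurable_enorm.
- by move=> i; rewrite integral_pospart//; exact: measurable_coord.
- move=> i j; rewrite integral_pospart//.
  by apply: measurable_funM; exact: measurable_coord.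
Qed.

End standardization.

Theorem theorem6 (R : realType) (p : \bar R) (hp : (1 < p)%E) :
  exists Np : nat,
  forall (D : nat) (hD : (1 <= D)%N) (M3 K : R),
  exists CBE : R,
  forall g : euclid R D -> R,
    density_P3 g ->
    g \in Lfun (lebesgue R D) p ->
    centered g ->
    identity_covariance g ->
    moment 3 g = M3%:E ->
    ('N[lebesgue R D]_p[EFin \o g] = K%:E)%E ->
    forall N : nat, (Np <= N)%N ->
      ('N[lebesgue R D]_+oo[(fun x =>
          normalized_convolution g N x - (gaussian x)%:E)]
       <= (CBE / Num.sqrt N%:R)%:E)%E.
Proof.
have [k [k0 gain]] := integrability_gain hp; exists (2 * k.+1)%N => D _ M3 K.
have [S [S0 hS]] := gain K.
have M0 : 0 <= Num.max M3 0 by rewrite le_max lexx orbT.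
have [C [C0 hC]] := local_limit_bound D k0 S0 M0; exists C.
move=> g [dg _] _ cg vg mg gK N kN.
have [mfg _ _] := dg; have gh := ae_pospart dg.
pose h := pospart g; have dh : density h := density_pospart dg.
have uS : (\int[lebesgue R D]_x (h x `^ (k.+1%:R / k%:R))%:E <= S%:E)%E.
  apply: (hS D g h mfg gK dh) => x.
  by rewrite ge_max ler_norm normr_ge0.
have H := standard_density_pospart k0 dg cg vg mg uS.
(* The maximum only serves to have a nonnegative constant before [g] is given. *)
have M3E : Num.max M3 0 = M3 by apply/max_idPl; exact: moment3_ge0 dh (std_moment H).
rewrite M3E in hC.
case: N kN => [|[|n]] kN; [by []|by move: kN; rewrite mulnS|].
have kn : (k <= n.+1)%N by move: kN; rewrite mulnS; lia.
have N0 : 0 < n.+2%:R :> R by rewrite ltr0n.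
have s0 : 0 < Num.sqrt n.+2%:R :> R by rewrite sqrtr_gt0.
apply: Lnorm_oo_le; first by rewrite lee_fin divr_ge0// ltW.
have := ae_escale (lt0r_neq0 s0) (hC _ _ H n kN).
apply: filterS => x /= hx.
rewrite /normalized_convolution (convolution_power_pospart n _ mfg gh).
rewrite -(convolution_densityE H _ kn) powR_half_nat ?(ltW N0)//.
rewrite (gaussian_rescale x N0) -EFinM -EFinB lee_fin -mulrBr normrM.
rewrite ger0_norm ?exprn_ge0 ?(ltW s0)//.
apply: le_trans (ler_wpM2l (exprn_ge0 _ (ltW s0)) hx) _.
rewrite exprS le_eqVlt; apply/orP; left; apply/eqP.
by field; rewrite expf_neq0 ?gt_eqF.
Qed.
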